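(* Let $H_i:=L^2(X_i)$, $i\in I$, where each $X_i$ is a $\sigma$-finite measure space, and let $V_i\hookrightarrow H_i$ densely and uniformly continuously. Let $V=\bigoplus_{i\in I}V_i$, $H=\bigoplus_{i\in I}H_i$, and let $a=(a_{ij})_{i,j\in I}:V\times V\to\mathbb C$ be a continuous, $H$-elliptic and accretive form with associated semigroup $(e^{ta})_{t\ge0}$ on $H$. Then the following assertions hold. 1. The semigroup $(e^{ta})_{t\ge 0}$ is real if and only if both of the following conditions hold: - for all $i\in I$: $\psi\in V_i\Rightarrow\mathrm{Re}\,\psi\in V_i$; - for all $i,j\in I$ the mapping $a_{ij}$ is real, i.e. $\mathrm{Im}\,a_{ij}(\psi,\psi')=0$ for all real functions $\psi\in V_j$, $\psi'\in V_i$. 2. If the semigroup $(e^{ta})_{t\ge0}$ is real, then it is positive if and only if both of the following conditions hold: - for all $i\in I$ the semigroup $(e^{ta_{ii}})_{t\ge0}$ on $H_i$ is positive; - for all $i\ne j$ the mapping $-a_{ij}$ is positive, i.e. $a_{ij}(\psi,\psi')\le 0$ for all $0\le\psi\in V_j$, $0\le\psi'\in V_i$. 3. If the semigroup $(e^{ta})_{t\ge0}$ is contractive, then it is $L^\infty$-contractive if and only if both of the following conditions hold: - for all $i\in I$: $\psi\in V_i\Rightarrow(1\wedge|\psi|)\,\mathrm{sign}\,\psi\in V_i$; - for all $i\in I$ and all $\psi\in V\cap C_i^\infty$, $$\sum_{j\ne i}\big|a_{ij}(\psi_j,(|\psi_i|-1)^+\mathrm{sign}\,\psi_i)\big|\l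e\mathrm{Re}\,a_{ii}\big((|\psi_i|\wedge1)\,\mathrm{sign}\,\psi_i,(|\psi_i|-1)^+\mathrm{sign}\,\psi_i\big).$$
   Context: $I=\{1,\dots,m\}$ or $I=\mathbb N$; all Hilbert spaces are complex; direct sums are Hilbert space direct sums. ''Uniformly'' means that the norms of the embeddings $V_i\hookrightarrow H_i$ are bounded in $i$. Writing $a=(a_{ij})_{i,j\in I}$ means $a(\psi,\psi')=\sum_{i,j\in I}a_{ij}(\psi_j,\psi'_i)$, where $a_{ij}:V_j\times V_i\to\mathbb C$ is the sesquilinear mapping obtained by evaluating $a$ on vectors supported only in components $j$ and $i$, respectively. $(a,V)$ is continuous if $|a(\psi,\psi')|\le M\|\psi\|_V\|\psi'\|_V$, accretive if $\mathrm{Re}\,a(\psi,\psi)\ge0$ for all $\psi\in V$, and $H$-elliptic if there are $\alpha>0$, $\omega\in\mathbb R$ with $\mathrm{Re}\,a(\psi,\psi)+\omega\|\psi\|_H^2\ge\alpha\|\psi\|_V^2$ for all $\psi\in V$. The associated operator $A$ has domain $D(A)=\{\psi\in V:\exists f\in H\ \forall\psi'\in V:\ a(\psi,\psi')=(f\mid\psi')_H\}$ and $A\psi=-f$; it generates an analytic semigroup denoted $(e^{ta})_{t\ge0}$ on $H$ (similarly for $a_{ii}$ on $H_i$). $H$ is identified with $L^2(X)$, $X$ the disjoint union of the $X_i$; $\psi\in H$ is real (positive) if every $\psi_i$ is a.e. real (positive). A semigroup is real (positive) if it maps real (positive) functions to real (positive) functions, and $L^\infty$-contractive if it leaves invariant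 $\{f\in L^2(X):\|f\|_\infty\le1\}$. $C_i^\infty:=\{(\psi_j)_{j\in I}:\psi_i\in L^2(X_i),\ \psi_j\in L^\infty(X_j)\text{ with }\|\psi_j\|_\infty\le1\text{ for all }j\ne i\}$. $\mathrm{sign}\,\psi=\psi/|\psi|$ where $\psi\neq0$ and $0$ elsewhere. *)

(* Defs.v *)
Set Warnings "-all".
From HB Require Import structures.
From mathcomp Require Import all_boot all_order all_algebra.
From mathcomp Require Import all_classical all_reals all_analysis.
From mathcomp Require Import ring lra.
From mathcomp Require Import sesquilinear generic_quotient ring_quotient.

Set Implicit Arguments.
Unset Strict Implicit.
Unset Printing Implicit Defensive.
Import Order.TTheory GRing.Theory Num.Theory.
From mathcomp Require Import measurable_realfun.
Import numFieldNormedType.Exports.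
From mathcomp Require Import complex.
Import Normc.
Local Open Scope classical_set_scope.
Local Open Scope complex_scope.
Local Open Scope ring_scope.

Section complex_aux.
Context {R : realType}.
Implicit Type z w : R[i].

Lemma normcC z : (normc z)%:C = `|z|. Proof. by []. Qed.

Lemma normcRI z : normc z = Num.sqrt (Re z ^+ 2 + Im z ^+ 2).
Proof. by case: z. Qed.

Lemma normc_ge0 z : 0 <= normc z.
Proof. by rewrite normcRI sqrtr_ge0. Qed.

Lemma sqr_normcE z : normc z ^+ 2 = Re z ^+ 2 + Im z ^+ 2.
Proof. by rewrite normcRI sqr_sqrtr// addr_ge0// sqr_ge0. Qed.

Lemma normc_conj z : normc z ^+ 2 = Re (z * Num.conj z).
Proof. by rewrite sqr_normcE; case: z => a b /=; rewrite mulrN opprK !expr2. Qed.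

Lemma normc_real (x : R) : normc x%:C = `|x|.
Proof. by rewrite normcRI /= expr0n addr0 sqrtr_sqr. Qed.

Lemma ReD z w : Re (z + w) = Re z + Re w. Proof. by case: z w => ? ? [? ?]. Qed.
Lemma ImD z w : Im (z + w) = Im z + Im w. Proof. by case: z w => ? ? [? ?]. Qed.
Lemma ReM z w : Re (z * w) = Re z * Re w - Im z * Im w.
Proof. by case: z w => ? ? [? ?]. Qed.
Lemma ImM z w : Im (z * w) = Re z * Im w + Im z * Re w.
Proof. by case: z w => ? ? [? ?]. Qed.

Lemma Re_conj z : Re (Num.conj z) = Re z. Proof. by case: z. Qed.
Lemma Im_conj z : Im (Num.conj z) = - Im z. Proof. by case: z. Qed.

Lemma normRe_normc z : `|Re z| <= normc z.
Proof. by rewrite -lecR; exact: normc_ge_Re. Qed.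

Lemma normIm_normc z : `|Im z| <= normc z.
Proof. by rewrite normcRI -[leLHS]sqrtr_sqr ler_wsqrtr// lerDr sqr_ge0. Qed.

(* The sign of 0 is 0, because 0^-1 = 0. *)
Definition csign z : R[i] := z / `|z|.
(* (1 /\ |z|) sign z and (|z| - 1)^+ sign z; they add up to z (ctrunc_excess). *)
Definition ctrunc z : R[i] := (Num.min 1 (normc z))%:C * csign z.
Definition cexcess z : R[i] := (Num.max (normc z - 1) 0)%:C * csign z.

Lemma csignE z : csign z = (Re z / normc z) +i* (Im z / normc z).
Proof.
rewrite /csign -normcC -fmorphV; case: z => a b /=.
by rewrite /GRing.mul /= !mulr0 subr0 add0r.
Qed.

Lemma normc_csign z : normc (csign z) <= 1.
Proof.
rewrite -lecR normcC normrM normfV normr_id.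
have [->|z0] := eqVneq `|z| 0; first by rewrite mul0r ler01.
by rewrite divff.
Qed.

Lemma normc_ctrunc z : normc (ctrunc z) <= normc z.
Proof.
have z0 := normc_ge0 z.
rewrite normcM normc_real ger0_norm ?le_min ?ler01//.
by rewrite (le_trans (ler_piMr _ (normc_csign z)))// ?le_min ?ler01// ge_min lexx orbT.
Qed.

Lemma normc_cexcess z : normc (cexcess z) <= normc z.
Proof.
have z0 := normc_ge0 z.
have m0 : 0 <= Num.max (normc z - 1) 0 by rewrite le_max lexx orbT.
rewrite normcM normc_real ger0_norm//.
rewrite (le_trans (ler_piMr _ (normc_csign z)))// ge_max z0 andbT.
by rewrite gerBl.
Qed.

Lemma ctrunc_excess z : ctrunc z + cexcess z = z.
Proof.
rewrite /ctrunc /cexcess -mulrDl -rmorphD /=.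
rewrite (_ : Num.min 1 (normc z) + Num.max (normc z - 1) 0 = normc z); last first.
  have [h|/ltW h] := leP 1 (normc z).
    by rewrite max_l ?subr_ge0// addrC subrK.
  by rewrite max_r ?subr_le0// addr0.
rewrite /csign normcC; have [->|z0] := eqVneq z 0; first by rewrite normr0 mul0r.
by rewrite mulrCA divff ?mulr1// normr_eq0.
Qed.

End complex_aux.

Section square_integrable.
Context d (T : measurableType d) (R : realType).
Variable mu : {measure set T -> \bar R}.
Implicit Types f g : T -> R[i].

(* Borel measurability for the topology of C = R x R. *)
Definition cmeasurable f :=
  measurable_fun [set: T] (fun x => Re (f x)) /\
  measurable_fun [set: T] (fun x => Im (f x)).

Definition cintegral f : R[i] :=
  (\int[mu]_x Re (f x)) +i* (\int[mu]_x Im (f x)).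

Definition sqint : {pred T -> R[i]} :=
  mem [set f | cmeasurable f /\ (\int[mu]_x (normc (f x) ^+ 2)%:E < +oo)%E].

Lemma sqintP f : (f \in sqint) <->
  cmeasurable f /\ (\int[mu]_x (normc (f x) ^+ 2)%:E < +oo)%E.
Proof. by rewrite inE. Qed.

Lemma cmeasurable_normc2 f : cmeasurable f ->
  measurable_fun [set: T] (fun x => normc (f x) ^+ 2).
Proof.
move=> [mr mi]; under eq_fun do rewrite sqr_normcE.
by apply: measurable_funD; exact: measurable_funX.
Qed.

Lemma cmeasurable_normc f : cmeasurable f ->
  measurable_fun [set: T] (fun x => normc (f x)).
Proof.
move=> mf.
rewrite (_ : (fun x => normc (f x)) = (fun x => (normc (f x) ^+ 2) `^ 2^-1)).
  exact: (measurableT_comp (measurable_powR _) (cmeasurable_normc2 mf)).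
by apply/funext => x; rewrite powR12_sqrt ?sqr_ge0// sqrtr_sqr ger0_norm// normc_ge0.
Qed.

Lemma cmeasurable_csign f : cmeasurable f -> cmeasurable (fun x => csign (f x)).
Proof.
move=> mf; have mV : measurable_fun [set: T] (fun x => (normc (f x))^-1).
  under eq_fun do rewrite -powR_inv1 ?normc_ge0//.
  exact: (measurableT_comp (measurable_powR _) (cmeasurable_normc mf)).
by case: (mf) => mr mi; split; under eq_fun do rewrite csignE/=;
  exact: measurable_funM.
Qed.

Lemma cmeasurableZ (k : T -> R) f : measurable_fun [set: T] k ->
  cmeasurable f -> cmeasurable (fun x => (k x)%:C * f x).
Proof.
move=> mk [mr mi]; split.
  by under eq_fun do rewrite ReM /= mul0r subr0; exact: measurable_funM.
by under eq_fun do rewrite ImM /= mul0r addr0; exact: measurable_funM.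
Qed.

Lemma sqint_le f g : f \in sqint -> cmeasurable g ->
  (forall x, normc (g x) <= normc (f x)) -> g \in sqint.
Proof.
move=> /sqintP[mf lf] mg gf; apply/sqintP; split=> //.
apply: (le_lt_trans _ lf); apply: ge0_le_integral => //.
- by move=> x _; rewrite lee_fin sqr_ge0.
- exact/measurable_EFinP/cmeasurable_normc2.
- exact/measurable_EFinP/cmeasurable_normc2.
- by move=> x _; rewrite lee_fin ler_sqr ?nnegrE ?normc_ge0.
Qed.

Lemma sqint_Re f : f \in sqint -> (fun x => (Re (f x))%:C) \in sqint.
Proof.
move=> ff; have /sqintP[[mr mi] _] := ff; apply: sqint_le ff _ _.
  by split => //=; exact: measurable_cst.
by move=> x; rewrite normc_real normRe_normc.
Qed.

Lemma sqint_ctrunc f : f \in sqint -> (fun x => ctrunc (f x)) \in sqint.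
Proof.
move=> ff; have /sqintP[mf _] := ff; apply: sqint_le ff _ _.
  apply: cmeasurableZ (cmeasurable_csign mf).
  by apply: measurable_minr; [exact: measurable_cst|exact: cmeasurable_normc].
by move=> x; exact: normc_ctrunc.
Qed.

Lemma sqint_cexcess f : f \in sqint -> (fun x => cexcess (f x)) \in sqint.
Proof.
move=> ff; have /sqintP[mf _] := ff; apply: sqint_le ff _ _.
  apply: cmeasurableZ (cmeasurable_csign mf).
  apply: measurable_maxr; last exact: measurable_cst.
  by apply: measurable_funB; [exact: cmeasurable_normc|exact: measurable_cst].
by move=> x; exact: normc_cexcess.
Qed.

Lemma sqint_submod_closed : submod_closed sqint.
Proof.
split.
  apply/sqintP; split; first by split => /=; exact: measurable_cst.
  rewrite (eq_integral (cst 0%E)) ?integral0// => x _.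
  by rewrite -[X in normc X]/(0 : R[i]) normc0 expr0n.
move=> a f g /sqintP[mf lf] /sqintP[mg lg].
have maf : cmeasurable (a *: f + g).
  case: mf mg => [mr mi] [gr gi]; split.
    under eq_fun do rewrite ReD ReM.
    by apply: measurable_funD => //; apply: measurable_funB; apply: measurable_funM.
  under eq_fun do rewrite ImD ImM.
  by apply: measurable_funD => //; apply: measurable_funD; apply: measurable_funM.
apply/sqintP; split=> //.
have nn (h : T -> R[i]) x : (0 <= (normc (h x) ^+ 2)%:E)%E by rewrite lee_fin sqr_ge0.
have mE h : cmeasurable h -> measurable_fun [set: T] (fun x => (normc (h x) ^+ 2)%:E).
  by move=> mh; exact/measurable_EFinP/cmeasurable_normc2.
apply: (@le_lt_trans _ _ (\int[mu]_x ((2 * normc a ^+ 2)%:E * (normc (f x) ^+ 2)%:E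
     + 2%:E * (normc (g x) ^+ 2)%:E)))%E.
  apply: ge0_le_integral => //.
  - exact: mE.
  - apply: emeasurable_funD; apply: measurable_funeM; exact: mE.
  move=> x _; rewrite -!EFinM -EFinD lee_fin -mulrA -exprMn -normcM -mulrDr.
  have h := le_normcD (a * f x) (g x).
  apply: (@le_trans _ _ ((normc (a * f x) + normc (g x)) ^+ 2)).
    by rewrite ler_sqr ?nnegrE ?addr_ge0 ?normc_ge0.
  rewrite -subr_ge0 (_ : _ - _ = (normc (a * f x) - normc (g x)) ^+ 2) ?sqr_ge0//.
  by ring.
rewrite ge0_integralD//.
- rewrite !ge0_integralZl//; try exact: mE.
    by rewrite lte_add_pinfty// lte_mul_pinfty// lee_fin mulr_ge0// sqr_ge0.
  by rewrite lee_fin mulr_ge0// sqr_ge0.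
- by move=> x _; rewrite mule_ge0// lee_fin mulr_ge0// sqr_ge0.
- by apply: measurable_funeM; exact: mE.
- by move=> x _; rewrite mule_ge0.
- by apply: measurable_funeM; exact: mE.
Qed.

End square_integrable.

Section L2.
Context d (T : measurableType d) (R : realType).
Variable mu : {measure set T -> \bar R}.

HB.instance Definition _ := GRing.isSubmodClosed.Build _ _ (sqint mu)
  (sqint_submod_closed mu).

Record sqfun := SqFun { sqfun_val :> T -> R[i]; _ : sqfun_val \in sqint mu }.
HB.instance Definition _ := [isSub for sqfun_val].
HB.instance Definition _ := [Choice of sqfun by <:].
HB.instance Definition _ := [SubChoice_isSubLmodule of sqfun by <:].

Definition aenull : {pred sqfun} :=
  mem [set f : sqfun | \forall x \ae mu, f x = 0].

Lemma aenull_submod_closed : submod_closed aenull.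
Proof.
split; first by rewrite inE /=; apply: aeW.
move=> a f g /[!inE] /= f0 g0; move: f0 g0; apply: filterS2 => x fx gx.
rewrite -[LHS]/(a * (f x) + g x).
by rewrite fx gx mulr0 addr0.
Qed.

HB.instance Definition _ := GRing.isSubmodClosed.Build _ _ aenull
  aenull_submod_closed.

Local Open Scope quotient_scope.

(* Square-integrable functions modulo equality almost everywhere; the coercion to
   functions below picks a representative. *)
Definition L2 := Quotient.quot aenull.
HB.instance Definition _ := EqQuotient.on L2.
HB.instance Definition _ := GRing.Zmodule.on L2.

Definition L2_fun (u : L2) : T -> R[i] := repr u.
Coercion L2_fun : L2 >-> Funclass.

Lemma L2_eqP (f g : sqfun) :
  (\pi_L2 f = \pi_L2 g) <-> (\forall x \ae mu, f x = g x).
Proof.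
have -> : (\pi_L2 f = \pi_L2 g) <-> (f - g \in aenull).
  by rewrite Quotient.idealrBE; split => /eqP.
rewrite inE /=; split; apply: filterS => x.
  by rewrite -[X in X = 0 -> _]/(f x - g x) => /eqP; rewrite subr_eq0 => /eqP.
by move=> fg; rewrite -[LHS]/(f x - g x) fg subrr.
Qed.

Lemma L2_piD (f g : sqfun) : \pi_L2 (f + g) = \pi_L2 f + \pi_L2 g :> L2.
Proof. exact: (Quotient.pi_add aenull f g). Qed.

Lemma L2_pi0 : \pi_L2 0 = 0 :> L2.
Proof. by apply: (addrI (\pi_L2 0 : L2)); rewrite -L2_piD !addr0. Qed.

Lemma L2_reprE (f : sqfun) : \forall x \ae mu, (\pi_L2 f : L2) x = f x.
Proof. by apply/L2_eqP; rewrite reprK. Qed.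

Lemma L2P (u v : L2) : (u = v) <-> (\forall x \ae mu, u x = v x).
Proof. by rewrite -L2_eqP !reprK. Qed.

Lemma L2_funP (u : L2) : (u : T -> R[i]) \in sqint mu.
Proof. exact: valP (repr u). Qed.

Definition L2_scale (a : R[i]) (u : L2) : L2 := \pi_L2 (a *: repr u).

Lemma L2_scaleE a (f : sqfun) : L2_scale a (\pi_L2 f) = \pi_L2 (a *: f).
Proof.
apply/L2_eqP; have := L2_reprE f; apply: filterS => x fx.
by rewrite -[LHS]/(a * (repr (\pi_L2 f : L2)) x) -[RHS]/(a * f x) -fx.
Qed.

Fact L2_scaleA a b u : L2_scale a (L2_scale b u) = L2_scale (a * b) u.
Proof.
by elim/quotW: u => f; rewrite (L2_scaleE b f) !L2_scaleE scalerA.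
Qed.

Fact L2_scale1 : left_id 1 L2_scale.
Proof. by elim/quotW => f; rewrite L2_scaleE scale1r. Qed.

Fact L2_scaleDr : right_distributive L2_scale +%R.
Proof.
move=> a; elim/quotW => f; elim/quotW => g.
by rewrite -L2_piD !L2_scaleE scalerDr L2_piD.
Qed.

Fact L2_scaleDl u : {morph L2_scale^~ u : a b / a + b}.
Proof.
by move=> a b; elim/quotW: u => f; rewrite !L2_scaleE scalerDl L2_piD.
Qed.

HB.instance Definition _ := GRing.Zmodule_isLmodule.Build R[i] L2
  L2_scaleA L2_scale1 L2_scaleDr L2_scaleDl.

Definition L2_of (f : T -> R[i]) (lf : f \in sqint mu) : L2 := \pi_L2 (SqFun lf).

Lemma L2_ofE f lf : \forall x \ae mu, @L2_of f lf x = f x.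
Proof. exact: L2_reprE. Qed.

Lemma L2DE (u v : L2) : \forall x \ae mu, (u + v : L2) x = u x + v x.
Proof.
have -> : u + v = \pi_L2 (repr u + repr v).
  by rewrite L2_piD !reprK.
exact: L2_reprE.
Qed.

Lemma L2ZE a (u : L2) : \forall x \ae mu, (a *: u : L2) x = a * u x.
Proof. exact: L2_reprE. Qed.

Lemma L20E : \forall x \ae mu, (0 : L2) x = 0.
Proof.
have -> : (0 : L2) = \pi_L2 0 by rewrite L2_pi0.
exact: L2_reprE.
Qed.

Definition L2_Re (u : L2) : L2 := L2_of (sqint_Re (L2_funP u)).
Definition L2_trunc (u : L2) : L2 := L2_of (sqint_ctrunc (L2_funP u)).
Definition L2_excess (u : L2) : L2 := L2_of (sqint_cexcess (L2_funP u)).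

End L2.

Section hermitian_op.
Context {R : realType} (E : lmodType R[i]) (op : E -> E -> R[i]).
Hypothesis opP : forall a u v w, op (a *: u + v) w = a * op u w + op v w.
Hypothesis opC : forall u v, op u v = Num.conj (op v u).

Lemma herm_subl w : zmod_morphism (op^~ w).
Proof. by move=> u v; rewrite addrC -scaleN1r opP mulN1r addrC. Qed.

Lemma herm_subr w : zmod_morphism (op w).
Proof.
by move=> u v; rewrite opC herm_subl rmorphB/= -!opC.
Qed.

Lemma herm_scalel w : scalable_for *%R (op^~ w).
Proof.
move=> a u; have op0 : op 0 w = 0 by rewrite -(subrr 0) herm_subl subrr.
by rewrite -[a *: u]addr0 opP op0 addr0.
Qed.

Lemma herm_scaler w : scalable_for (Num.conj \; *%R) (op w).
Proof. by move=> a u; rewrite opC herm_scalel rmorphM/= -opC. Qed.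

Lemma herm_sym u v : op u v = (-1) ^+ false * Num.conj (op v u).
Proof. by rewrite mul1r. Qed.

End hermitian_op.

Section L2_dot.
Context d (T : measurableType d) (R : realType).
Variable mu : {measure set T -> \bar R}.
Implicit Types (u v w : L2 mu) (f g : T -> R[i]).

Definition cintegrable f :=
  mu.-integrable [set: T] (fun x => (Re (f x))%:E) /\
  mu.-integrable [set: T] (fun x => (Im (f x))%:E).

Lemma cintegrable_mul f g : f \in sqint mu -> g \in sqint mu ->
  cintegrable (fun x => f x * Num.conj (g x)).
Proof.
move=> /sqintP[[fr fi] lf] /sqintP[[gr gi] lg].
have mh (h k h' k' : T -> R) : measurable_fun setT h -> measurable_fun setT k ->
    measurable_fun setT h' -> measurable_fun setT k' ->
    measurable_fun setT (fun x => h x * k x + h' x * k' x).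
  by move=> *; apply: measurable_funD; apply: measurable_funM.
have mE h : cmeasurable h -> measurable_fun [set: T] (fun x => (normc (h x) ^+ 2)%:E).
  by move=> mh'; exact/measurable_EFinP/cmeasurable_normc2.
have I0 : mu.-integrable [set: T]
    (fun x => (normc (f x) ^+ 2)%:E + (normc (g x) ^+ 2)%:E)%E.
  apply: integrableD => //; apply/integrableP; split; try exact: mE.
    by under eq_integral do rewrite gee0_abs ?lee_fin ?sqr_ge0//.
  by under eq_integral do rewrite gee0_abs ?lee_fin ?sqr_ge0//.
have dom (x : T) (k : R) : `|k| <= normc (f x * Num.conj (g x)) ->
   (`|k%:E| <= `|(normc (f x) ^+ 2)%:E + (normc (g x) ^+ 2)%:E|)%E.
  move=> kn; rewrite -EFinD !abse_EFin lee_fin (le_trans kn)//.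
  rewrite normcM (_ : normc (Num.conj (g x)) = normc (g x)); last first.
    by case: (g x) => a b /=; rewrite sqrrN.
  rewrite ger0_norm ?addr_ge0 ?sqr_ge0//.
  have := normc_ge0 (f x); have := normc_ge0 (g x).
  set p := normc (f x); set q := normc (g x) => q0 p0; nra.
split; apply: le_integrable I0 => //.
- apply/measurable_EFinP.
  rewrite (_ : (fun x => _) = (fun x => Re (f x) * Re (g x) + Im (f x) * Im (g x))); first exact: mh.
  by apply/funext => x; case: (f x) (g x) => a b [a' b'] /=; rewrite mulrN opprK.
- by move=> x _; apply: dom; exact: normRe_normc.
- apply/measurable_EFinP.
  rewrite (_ : (fun x => _) = (fun x => Im (f x) * Re (g x) + - Re (f x) * Im (g x))).
    by apply: mh => //; exact: measurable_funN.
  by apply/funext => x; case: (f x) (g x) => a b [a' b'] /=; rewrite mulrN mulNr addrC.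
- by move=> x _; apply: dom; exact: normIm_normc.
Qed.

Lemma cintegralP a f g : cintegrable f -> cintegrable g ->
  cintegral mu (fun x => a * f x + g x) = a * cintegral mu f + cintegral mu g.
Proof.
move=> [fr fi] [gr gi]; rewrite /cintegral.
have Z (h : T -> R) (r : R) : mu.-integrable setT (EFin \o h) ->
   mu.-integrable setT (EFin \o (fun x => r * h x)).
  move=> hi; apply: (eq_integrable measurableT (fun x => r%:E * (h x)%:E)%E) => //.
  exact: integrableZl.
have D (h k : T -> R) : mu.-integrable setT (EFin \o h) ->
   mu.-integrable setT (EFin \o k) ->
   mu.-integrable setT (EFin \o (fun x => h x + k x)).
  move=> hi ki; apply: (eq_integrable measurableT (fun x => (h x)%:E + (k x)%:E)%E) => //.
  exact: integrableD.
have -> : \int[mu]_x Re (a * f x + g x) =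
    Re a * (\int[mu]_x Re (f x)) + - Im a * (\int[mu]_x Im (f x)) + \int[mu]_x Re (g x).
  under eq_Rintegral do rewrite ReD ReM -mulNr.
  rewrite RintegralD// ?RintegralD// ?RintegralZl//; try exact: Z.
  by apply: D; exact: Z.
have -> : \int[mu]_x Im (a * f x + g x) =
    Re a * (\int[mu]_x Im (f x)) + Im a * (\int[mu]_x Re (f x)) + \int[mu]_x Im (g x).
  under eq_Rintegral do rewrite ImD ImM.
  rewrite RintegralD// ?RintegralD// ?RintegralZl//; try exact: Z.
  by apply: D; exact: Z.
by rewrite mulNr; case: a => ? ?; apply/eqP; rewrite eq_complex /= !eqxx.
Qed.

Lemma ae_eq_cintegral f g : cmeasurable f -> cmeasurable g ->
  (\forall x \ae mu, f x = g x) -> cintegral mu f = cintegral mu g.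
Proof.
move=> [fr fi] [gr gi] fg; rewrite /cintegral /Rintegral.
congr (fine _ +i* fine _); apply: ae_eq_integral => //;
  try exact/measurable_EFinP; by apply: filterS fg => x /= -> .
Qed.

Definition L2_dot u v : R[i] := cintegral mu (fun x => u x * Num.conj (v x)).

Lemma cintegrable_meas f : cintegrable f -> cmeasurable f.
Proof.
by move=> [/measurable_int/measurable_EFinP ? /measurable_int/measurable_EFinP ?].
Qed.

Lemma L2_dotC u v : L2_dot u v = Num.conj (L2_dot v u).
Proof.
rewrite /L2_dot /cintegral.
have [vr vi] := cintegrable_mul (L2_funP v) (L2_funP u).
have -> : \int[mu]_x Im (u x * Num.conj (v x)) = -1 * \int[mu]_x Im (v x * Num.conj (u x)).
  rewrite -RintegralZl//; apply: eq_Rintegral => x _.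
  by case: (u x) (v x) => a b [a' b'] /=; ring.
have -> : \int[mu]_x Re (u x * Num.conj (v x)) = \int[mu]_x Re (v x * Num.conj (u x)).
  apply: eq_Rintegral => x _.
  by case: (u x) (v x) => a b [a' b'] /=; ring.
by rewrite mulN1r.
Qed.

Lemma L2_dotP a u v w : L2_dot (a *: u + v) w = a * L2_dot u w + L2_dot v w.
Proof.
have uw := cintegrable_mul (L2_funP u) (L2_funP w).
have vw := cintegrable_mul (L2_funP v) (L2_funP w).
rewrite /L2_dot -cintegralP//; apply: ae_eq_cintegral.
- exact/cintegrable_meas/cintegrable_mul/L2_funP/L2_funP.
- have [[? ?] [? ?]] := (cintegrable_meas uw, cintegrable_meas vw).
  split.
    under eq_fun do rewrite ReD ReM.
    by apply: measurable_funD => //; apply: measurable_funB; apply: measurable_funM.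
  under eq_fun do rewrite ImD ImM.
  by apply: measurable_funD => //; apply: measurable_funD; apply: measurable_funM.
- apply: filterS2 (L2DE (a *: u) v) (L2ZE a u) => x -> ->.
  by rewrite mulrDl mulrA.
Qed.

Lemma L2_dotuu u : L2_dot u u = (\int[mu]_x normc (u x) ^+ 2)%:C.
Proof.
rewrite /L2_dot /cintegral; congr (_ +i* _).
  by apply: eq_Rintegral => x _; rewrite normc_conj.
rewrite (@eq_Rintegral _ _ _ _ _ (cst 0)) ?Rintegral_cst ?mul0r// => x _.
by case: (u x) => a b /=; ring.
Qed.

Lemma L2_dot_gt0 u : u != 0 -> 0 < L2_dot u u.
Proof.
move=> u0; rewrite L2_dotuu ltcR lt_neqAle Rintegral_ge0 ?andbT; last first.
  by move=> x _; exact: sqr_ge0.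
have /sqintP[mu_ lu] := L2_funP u.
apply: contra_neq u0 => /esym u0; apply/L2P.
have {}u0 : (\int[mu]_x `|(normc (u x) ^+ 2)%:E| = 0)%E.
  under eq_integral do rewrite gee0_abs ?lee_fin ?sqr_ge0//.
  rewrite -[LHS]fineK ?[X in X%:E]u0// ge0_fin_numE//.
  by apply: integral_ge0 => x _; rewrite lee_fin sqr_ge0.
have mn : measurable_fun setT (fun x => (normc (u x) ^+ 2)%:E).
  exact/measurable_EFinP/cmeasurable_normc2.
have {}u0 := (ae_eq_integral_abs mu measurableT mn).1 u0.
apply: filterS2 u0 (L20E mu) => x /(_ I) [+] ->.
by move/eqP; rewrite sqrf_eq0 => /eqP; exact: eq0_normc.
Qed.

HB.instance Definition _ := isBilinear.Build R[i] (L2 mu) (L2 mu) R[i]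
  *%R (Num.conj \; *%R) L2_dot
  (herm_subl L2_dotP) (herm_subr L2_dotP L2_dotC)
  (herm_scalel L2_dotP) (herm_scaler L2_dotP L2_dotC).
HB.instance Definition _ := isHermitianSesquilinear.Build R[i] (L2 mu) false
  Num.conj L2_dot (herm_sym L2_dotC).
HB.instance Definition _ := isDotProduct.Build R[i] (L2 mu) L2_dot L2_dot_gt0.

End L2_dot.
Arguments L2_dot {d T R} mu u v.

Section rsum.
Context {I : choiceType} {R : realType}.
Implicit Types (F G : I -> R) (f g : I -> R[i]).

Definition rsummable F := summable setT (EFin \o F).

(* Unordered sum; meaningful for absolutely summable families only. *)
Definition rsum F : R :=
  fine (\esum_(i in setT) (EFin \o F)^\+ i - \esum_(i in setT) (EFin \o F)^\- i)%E.

Lemma rsummable_le F G : rsummable G -> (forall i, `|F i| <= G i) -> rsummable F.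
Proof.
move=> sG FG; apply: le_lt_trans sG; apply: le_esum => i _ /=.
by rewrite lee_fin (le_trans (FG i))// ler_norm.
Qed.

Lemma rsummableD F G : rsummable F -> rsummable G -> rsummable (fun i => F i + G i).
Proof. by move=> sF sG; exact: (summableD sF sG). Qed.

Lemma rsummable_pos F : rsummable F -> rsummable (fun i => Num.max (F i) 0).
Proof.
move=> sF; have sF' : rsummable (fun i => `|F i|).
  by apply: le_lt_trans sF; apply: le_esum => i _ /=; rewrite lee_fin normr_id.
apply: rsummable_le sF' _ => i; rewrite ger0_norm ?le_max ?lexx ?orbT//.
by rewrite ge_max ler_norm normr_ge0.
Qed.

Lemma rsummableN F : rsummable F -> rsummable (fun i => - F i).
Proof.
by move=> sF; rewrite /rsummable -[_ \o _]/(\- (EFin \o F))%E -summableN.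
Qed.

Let S F : R := fine (\esum_(i in setT) (F i)%:E)%E.

Lemma esum_fin F : rsummable F -> (forall i, 0 <= F i) ->
  (\esum_(i in setT) (F i)%:E)%E = (S F)%:E.
Proof.
move=> sF F0; rewrite fineK// ge0_fin_numE; last by apply: esum_ge0 => i _; rewrite lee_fin.
apply: le_lt_trans sF; apply: le_esum => i _ /=.
by rewrite lee_fin ler_norm.
Qed.

Lemma rsumB F G : rsummable F -> rsummable G -> (forall i, 0 <= F i) ->
  (forall i, 0 <= G i) -> rsum (fun i => F i - G i) = S F - S G.
Proof.
move=> sF sG F0 G0; rewrite /rsum.
have := esumB sF sG (fun i _ => F0 i) (fun i _ => G0 i).
rewrite -[(_ \- _)%E]/(EFin \o (fun i => F i - G i)) => ->.
by rewrite !esum_fin.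
Qed.

Lemma posnegE F : F = (fun i => Num.max (F i) 0 - Num.max (- F i) 0).
Proof.
apply/funext => i; case: (leP (F i) 0) => Fi.
  by rewrite max_l ?oppr_ge0// opprK add0r.
by rewrite max_r ?oppr_le0 ?subr0// ltW.
Qed.

Lemma rsumE F : rsummable F ->
  rsum F = S (fun i => Num.max (F i) 0) - S (fun i => Num.max (- F i) 0).
Proof.
move=> sF; rewrite {1}[F]posnegE rsumB//; first exact: rsummable_pos.
- exact/rsummable_pos/rsummableN.
- by move=> i; rewrite le_max lexx orbT.
- by move=> i; rewrite le_max lexx orbT.
Qed.

Lemma rsum_ge0E F : rsummable F -> (forall i, 0 <= F i) ->
  (rsum F)%:E = (\esum_(i in setT) (F i)%:E)%E.
Proof.
move=> sF F0; rewrite esum_fin//; congr EFin.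
rewrite -[in LHS](_ : (fun i => F i - 0) = F); last by apply/funext => i; rewrite subr0.
rewrite rsumB// ?[X in _ - X](_ : _ = 0) ?subr0//.
  by rewrite /S esum1.
by rewrite /rsummable /summable esum1// => i _; rewrite /= normr0.
Qed.

Let SD F G : rsummable F -> rsummable G -> (forall i, 0 <= F i) ->
  (forall i, 0 <= G i) -> S (fun i => F i + G i) = S F + S G.
Proof.
move=> sF sG F0 G0; apply: EFin_inj; rewrite EFinD -!esum_fin//.
- by rewrite -esumD// => i _; rewrite lee_fin.
- exact: rsummableD.
- by move=> i; rewrite addr_ge0.
Qed.

Lemma rsumD F G : rsummable F -> rsummable G ->
  rsum (fun i => F i + G i) = rsum F + rsum G.
Proof.
move=> sF sG.
have p0 (H : I -> R) i : 0 <= Num.max (H i) 0 by rewrite le_max lexx orbT.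
have sNF := rsummableN sF; have sNG := rsummableN sG.
rewrite (_ : (fun i => F i + G i) = (fun i => (Num.max (F i) 0 + Num.max (G i) 0)
   - (Num.max (- F i) 0 + Num.max (- G i) 0))); last first.
  apply/funext => i; rewrite opprD addrACA.
  by rewrite -[F i in LHS]/((fun i => F i) i) [in LHS](posnegE F) [in LHS](posnegE G).
rewrite rsumB; last 4 first.
- by apply: rsummableD; exact: rsummable_pos.
- by apply: rsummableD; exact: rsummable_pos.
- by move=> i; rewrite addr_ge0// p0.
- by move=> i; rewrite addr_ge0// (p0 (fun i => - _ i)).
rewrite !SD//; try exact: rsummable_pos; try exact: p0;
  try exact: (p0 (fun i => - _ i)).
by rewrite !rsumE// opprD addrACA.
Qed.

Lemma esumZ (r : R) F : 0 <= r -> (forall i, 0 <= F i) ->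
  (\esum_(i in setT) (r * F i)%:E = r%:E * \esum_(i in setT) (F i)%:E)%E.
Proof.
move=> r0 F0.
have le (s : R) G : 0 <= s -> (forall i, 0 <= G i) ->
  (\esum_(i in setT) (s * G i)%:E <= s%:E * \esum_(i in setT) (G i)%:E)%E.
  move=> s0 G0; apply: ge_ereal_sup => _ [A [fA _]] <-.
  under eq_fsbigr do rewrite EFinM.
  rewrite -ge0_mule_fsumr; last by move=> i; rewrite lee_fin.
  rewrite lee_wpmul2l ?lee_fin//.
  by apply: esum_ge; exists A.
apply/eqP; rewrite eq_le le//=.
have [->|rn0] := eqVneq r 0.
  by rewrite mul0e esum_ge0// => i _; rewrite lee_fin mul0r.
have rp : 0 < r by rewrite lt_neqAle eq_sym rn0.
rewrite -lee_pdivlMl// (le_trans _ (le r^-1 (fun i => r * F i) _ _))//.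
- by apply: le_esum => i _; rewrite mulKf.
- by rewrite invr_ge0.
- by move=> i; rewrite mulr_ge0.
Qed.

Lemma rsummableZ (r : R) F : rsummable F -> rsummable (fun i => r * F i).
Proof.
move=> sF; rewrite /rsummable /summable.
rewrite (eq_esum (b := fun i => (`|r| * `|F i|)%:E)); last first.
  by move=> i _; rewrite /= normrM.
by rewrite esumZ// lte_mul_pinfty// lee_fin.
Qed.

Let SZ (r : R) F : 0 <= r -> rsummable F -> (forall i, 0 <= F i) ->
  S (fun i => r * F i) = r * S F.
Proof.
move=> r0 sF F0; apply: EFin_inj; rewrite EFinM -!esum_fin ?esumZ//.
- exact: rsummableZ.
- by move=> i; rewrite mulr_ge0.
Qed.

Lemma rsumZ (r : R) F : rsummable F -> rsum (fun i => r * F i) = r * rsum F.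
Proof.
move=> sF; have sNF := rsummableN sF.
have sp := rsummable_pos sF; have sn := rsummable_pos sNF.
have p0 i : 0 <= Num.max (F i) 0 by rewrite le_max lexx orbT.
have n0 i : 0 <= Num.max (- F i) 0 by rewrite le_max lexx orbT.
have FE i : F i = Num.max (F i) 0 - Num.max (- F i) 0.
  by rewrite [in LHS](posnegE F).
have [r0|/ltW r0] := leP 0 r.
  rewrite (_ : (fun i => _) = (fun i => r * Num.max (F i) 0 - r * Num.max (- F i) 0)).
    rewrite rsumB; last 4 first.
    - exact: rsummableZ.
    - exact: rsummableZ.
    - by move=> i; rewrite mulr_ge0.
    - by move=> i; rewrite mulr_ge0.
    by rewrite (SZ r0 sp p0) (SZ r0 sn n0) rsumE// mulrBr.
  by apply/funext => i; rewrite [in LHS]FE mulrBr.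
have r0' : 0 <= - r by rewrite oppr_ge0.
rewrite (_ : (fun i => _) = (fun i => (- r) * Num.max (- F i) 0 - (- r) * Num.max (F i) 0)).
  rewrite rsumB; last 4 first.
  - exact: rsummableZ.
  - exact: rsummableZ.
  - by move=> i; rewrite mulr_ge0.
  - by move=> i; rewrite mulr_ge0.
  by rewrite (SZ r0' sn n0) (SZ r0' sp p0) rsumE// mulrBr !mulNr opprK addrC.
by apply/funext => i; rewrite [in LHS]FE; ring.
Qed.

Definition csummable f := rsummable (fun i => Re (f i)) /\ rsummable (fun i => Im (f i)).
Definition csum f : R[i] := rsum (fun i => Re (f i)) +i* rsum (fun i => Im (f i)).

Lemma csumP a f g : csummable f -> csummable g ->
  csum (fun i => a * f i + g i) = a * csum f + csum g.
Proof.
move=> [fr fi] [gr gi]; rewrite /csum.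
have -> : rsum (fun i => Re (a * f i + g i)) =
    Re a * rsum (fun i => Re (f i)) + - Im a * rsum (fun i => Im (f i)) + rsum (fun i => Re (g i)).
  under eq_fun do rewrite ReD ReM -mulNr.
  rewrite rsumD; [|by apply: rsummableD; apply: rsummableZ|by []].
  rewrite rsumD; [|by apply: rsummableZ|by apply: rsummableZ].
  by rewrite (rsumZ _ fr) (rsumZ _ fi).
have -> : rsum (fun i => Im (a * f i + g i)) =
    Re a * rsum (fun i => Im (f i)) + Im a * rsum (fun i => Re (f i)) + rsum (fun i => Im (g i)).
  under eq_fun do rewrite ImD ImM.
  rewrite rsumD; [|by apply: rsummableD; apply: rsummableZ|by []].
  rewrite rsumD; [|by apply: rsummableZ|by apply: rsummableZ].
  by rewrite (rsumZ _ fi) (rsumZ _ fr).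
by rewrite mulNr; case: a => ? ?; apply/eqP; rewrite eq_complex /= !eqxx.
Qed.

End rsum.

Section hilbert_sum.
Context {R : realType}.

Definition hnorm (E : lmodType R[i]) (dot : {dot E for Num.conj}) (u : E) : R :=
  Num.sqrt (Re (dot u u)).

Section hnorm_lemmas.
Variables (E : lmodType R[i]) (dot : {dot E for Num.conj}).
Implicit Types u v : E.

Lemma dotuuE u : dot u u = (hnorm dot u ^+ 2)%:C.
Proof.
have := dnorm_ge0 dot u; rewrite /hnorm; case: (dot u u) => a b.
by rewrite lecE /= => /andP[/eqP -> a0]; rewrite sqr_sqrtr.
Qed.

Lemma hnorm_ge0 u : 0 <= hnorm dot u. Proof. exact: sqrtr_ge0. Qed.

Lemma sqr_hnorm u : hnorm dot u ^+ 2 = Re (dot u u).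
Proof. by rewrite dotuuE. Qed.

Lemma hnorm0 : hnorm dot 0 = 0.
Proof. by rewrite /hnorm linear0l sqrtr0. Qed.

Lemma sqr_hnormZ a u : hnorm dot (a *: u) ^+ 2 = normc a ^+ 2 * hnorm dot u ^+ 2.
Proof.
apply: complexI; rewrite -dotuuE dnormZ dotuuE -normcC.
by rewrite -(rmorphXn (real_complex R)) -(rmorphM (real_complex R)).
Qed.

Lemma sqr_hnormD u v : hnorm dot (u + v) ^+ 2 =
  hnorm dot u ^+ 2 + hnorm dot v ^+ 2 + 2 * Re (dot u v).
Proof.
rewrite !sqr_hnorm dnormD !ReD; congr (_ + _).
by case: (dot u v) => a b /=; rewrite mulr_natl mulr2n.
Qed.

Lemma sqr_hnormN u : hnorm dot (- u) ^+ 2 = hnorm dot u ^+ 2.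
Proof.
by rewrite -scaleN1r sqr_hnormZ [normc _](_ : _ = 1) ?expr1n ?mul1r// normcN normc1.
Qed.

Lemma Re_dot_le u v : `|Re (dot u v)| <= hnorm dot u ^+ 2 + hnorm dot v ^+ 2.
Proof.
have := sqr_hnormD u v; have := sqr_hnormD u (- v).
rewrite sqr_hnormN linearNr/= [Re (- _)](_ : _ = - Re (dot u v)); last first.
  by case: (dot u v).
have := sqr_ge0 (hnorm dot (u + v)); have := sqr_ge0 (hnorm dot (u - v)).
have := sqr_ge0 (hnorm dot u); have := sqr_ge0 (hnorm dot v).
by rewrite ler_norml => *; apply/andP; split; lra.
Qed.

Lemma Im_dot_le u v : `|Im (dot u v)| <= hnorm dot u ^+ 2 + hnorm dot v ^+ 2.
Proof.
have := Re_dot_le ((- 'i%C) *: u) v.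
rewrite linearZl_LR/= sqr_hnormZ [normc _](_ : _ = 1) ?expr1n ?mul1r; last first.
  by rewrite normcN normcRI /= expr0n expr1n add0r sqrtr1.
by congr (`|_| <= _); case: (dot u v) => a b /=; ring.
Qed.

Lemma sqr_hnormD_le u v :
  hnorm dot (u + v) ^+ 2 <= 2 * hnorm dot u ^+ 2 + 2 * hnorm dot v ^+ 2.
Proof.
have := sqr_hnormD u v; have := sqr_hnormD u (- v).
rewrite sqr_hnormN linearNr/= [Re (- _)](_ : _ = - Re (dot u v)); last first.
  by case: (dot u v).
have := sqr_ge0 (hnorm dot (u - v)); lra.
Qed.

End hnorm_lemmas.

Section hsum_def.
Context {I : choiceType} {E : I -> lmodType R[i]}.
Variable dE : forall i, {dot E i for Num.conj}.

Definition sq_summable (x : forall i, E i) : Prop :=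
  (\esum_(i in [set: I]) (hnorm (dE i) (x i) ^+ 2)%:E < +oo)%E.

Record hsum := HSum { hsum_val :> forall i, E i; hsumP : sq_summable hsum_val }.

Lemma hsum_ext (x y : hsum) : (forall i, x i = y i) -> x = y.
Proof.
case: x y => [x sx] [y sy] /= xy.
have exy : x = y by exact: functional_extensionality_dep.
by case: y / exy sy {xy} => sy; congr HSum; exact: Prop_irrelevance.
Qed.

HB.instance Definition _ := gen_eqMixin hsum.
HB.instance Definition _ := gen_choiceMixin hsum.

Lemma sq_summableE x : sq_summable x <->
  rsummable (fun i => hnorm (dE i) (x i) ^+ 2).
Proof.
rewrite /sq_summable /rsummable /summable.
under [X in _ <-> is_true (X < _)%E]eq_esum do
  rewrite /= ger0_norm ?sqr_ge0//.
by [].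
Qed.

Lemma sq_summable0 : sq_summable (fun i => 0).
Proof. by rewrite /sq_summable esum1// => i _; rewrite hnorm0 expr0n. Qed.

Lemma sq_summableZ a x : sq_summable x -> sq_summable (fun i => a *: x i).
Proof.
move=> /sq_summableE/(rsummableZ (normc a ^+ 2)) sx; apply/sq_summableE.
by apply: rsummable_le sx _ => i; rewrite sqr_hnormZ ger0_norm// mulr_ge0// sqr_ge0.
Qed.

Lemma sq_summableN x : sq_summable x -> sq_summable (fun i => - x i).
Proof.
move=> /(sq_summableZ (-1)); congr sq_summable.
by apply: functional_extensionality_dep => i; rewrite scaleN1r.
Qed.

Lemma sq_summableD x y : sq_summable x -> sq_summable y ->
  sq_summable (fun i => x i + y i).
Proof.
move=> /sq_summableE/(rsummableZ 2) sx /sq_summableE/(rsummableZ 2) sy.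
apply/sq_summableE; apply: rsummable_le (rsummableD sx sy) _ => i.
by rewrite ger0_norm ?sqr_ge0// sqr_hnormD_le.
Qed.

Definition hsum0 := HSum sq_summable0.
Definition hsum_opp (x : hsum) := HSum (sq_summableN (hsumP x)).
Definition hsum_add (x y : hsum) := HSum (sq_summableD (hsumP x) (hsumP y)).
Definition hsum_scale a (x : hsum) := HSum (sq_summableZ a (hsumP x)).

Fact hsum_addA : associative hsum_add.
Proof. by move=> x y z; apply: hsum_ext => i /=; rewrite addrA. Qed.
Fact hsum_addC : commutative hsum_add.
Proof. by move=> x y; apply: hsum_ext => i /=; rewrite addrC. Qed.
Fact hsum_add0 : left_id hsum0 hsum_add.
Proof. by move=> x; apply: hsum_ext => i /=; rewrite add0r. Qed.
Fact hsum_addN : left_inverse hsum0 hsum_opp hsum_add.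
Proof. by move=> x; apply: hsum_ext => i /=; rewrite addNr. Qed.
HB.instance Definition _ := GRing.isZmodule.Build hsum
  hsum_addA hsum_addC hsum_add0 hsum_addN.

Fact hsum_scaleA a b x : hsum_scale a (hsum_scale b x) = hsum_scale (a * b) x.
Proof. by apply: hsum_ext => i /=; rewrite scalerA. Qed.
Fact hsum_scale1 : left_id 1 hsum_scale.
Proof. by move=> x; apply: hsum_ext => i /=; rewrite scale1r. Qed.
Fact hsum_scaleDr : right_distributive hsum_scale +%R.
Proof. by move=> a x y; apply: hsum_ext => i /=; rewrite scalerDr. Qed.
Fact hsum_scaleDl x : {morph hsum_scale^~ x : a b / a + b}.
Proof. by move=> a b; apply: hsum_ext => i /=; rewrite scalerDl. Qed.
HB.instance Definition _ := GRing.Zmodule_isLmodule.Build R[i] hsum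
  hsum_scaleA hsum_scale1 hsum_scaleDr hsum_scaleDl.

Definition hsum_dot (x y : hsum) : R[i] := csum (fun i => dE i (x i) (y i)).

Lemma csummable_dot (x y : hsum) : csummable (fun i => dE i (x i) (y i)).
Proof.
have sxy := rsummableD ((sq_summableE x).1 (hsumP x)) ((sq_summableE y).1 (hsumP y)).
by split; apply: rsummable_le sxy _ => i; [exact: Re_dot_le|exact: Im_dot_le].
Qed.

Lemma hsum_dotP a x y z :
  hsum_dot (a *: x + y) z = a * hsum_dot x z + hsum_dot y z.
Proof.
rewrite /hsum_dot -csumP; [|exact: csummable_dot..].
by congr csum; apply/funext => i /=; rewrite linearPl.
Qed.

Lemma hsum_dotC x y : hsum_dot x y = Num.conj (hsum_dot y x).
Proof.
rewrite /hsum_dot /csum; have [sr si] := csummable_dot y x.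
have -> : (fun i => Re (dE i (x i) (y i))) = (fun i => Re (dE i (y i) (x i))).
  by apply/funext => i; rewrite hermC mul1r/= Re_conj.
have -> : (fun i => Im (dE i (x i) (y i))) = (fun i => -1 * Im (dE i (y i) (x i))).
  by apply/funext => i; rewrite hermC mul1r/= Im_conj mulN1r.
by rewrite rsumZ// mulN1r.
Qed.

Lemma hsum_dotuu x :
  hsum_dot x x = (rsum (fun i => hnorm (dE i) (x i) ^+ 2))%:C.
Proof.
rewrite /hsum_dot /csum; congr (_ +i* _).
  by congr rsum; apply/funext => i; rewrite sqr_hnorm.
apply: EFin_inj; rewrite rsum_ge0E.
- by rewrite esum1// => i _; rewrite dotuuE.
- exact: (csummable_dot x x).2.
- by move=> i; rewrite dotuuE.
Qed.

Lemma hsum_dot_gt0 x : x != 0 -> 0 < hsum_dot x x.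
Proof.
move=> x0; rewrite hsum_dotuu ltcR -lte_fin.
rewrite rsum_ge0E; last 2 first.
- exact: (sq_summableE x).1 (hsumP x).
- by move=> i; exact: sqr_ge0.
have [i xi] : exists i, x i != 0.
  apply: contrapT => /forallNP xi; move/eqP: x0; apply; apply: hsum_ext => i.
  by have /negP := xi i; rewrite negbK => /eqP.
have : (0 < (hnorm (dE i) (x i) ^+ 2)%:E)%E.
  by rewrite lte_fin -ltcR -dotuuE neq0_dnorm_gt0.
move=> /lt_le_trans; apply.
apply: esum_ge; exists [set i]; last by rewrite fsbig_set1.
by split => //; exact: finite_set1.
Qed.

HB.instance Definition _ := isBilinear.Build R[i] hsum hsum R[i]
  *%R (Num.conj \; *%R) hsum_dot
  (herm_subl hsum_dotP) (herm_subr hsum_dotP hsum_dotC)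
  (herm_scalel hsum_dotP) (herm_scaler hsum_dotP hsum_dotC).
HB.instance Definition _ := isHermitianSesquilinear.Build R[i] hsum false
  Num.conj hsum_dot (herm_sym hsum_dotC).
HB.instance Definition _ := isDotProduct.Build R[i] hsum hsum_dot hsum_dot_gt0.

Lemma sq_summable_single i (u : E i) :
  sq_summable (dfwith (fun k => 0 : E k) i u).
Proof.
rewrite /sq_summable (esumID [set i]); last by move=> k _; rewrite lee_fin sqr_ge0.
rewrite setIidr//= esum_set1 ?lee_fin ?sqr_ge0// [X in (_ + X)%E](_ : _ = 0%E) ?adde0 ?ltry//.
rewrite esum1// => k [_ /eqP ki].
by rewrite dfwithout 1?eq_sym// hnorm0 expr0n.
Qed.

Definition hsum_single i (u : E i) : hsum := HSum (sq_summable_single u).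

End hsum_def.

Section hsum_map.
Context {I : choiceType} {E F : I -> lmodType R[i]}.
Variables (dE : forall i, {dot E i for Num.conj}) (dF : forall i, {dot F i for Num.conj}).
Variables (j : forall i, {linear E i -> F i}) (c : R).
Hypothesis jc : forall i (u : E i), hnorm (dF i) (j i u) <= c * hnorm (dE i) u.

Lemma sq_summable_map (x : hsum dE) : sq_summable dF (fun i => j i (x i)).
Proof.
apply/sq_summableE; have /sq_summableE := hsumP x.
move=> /(rsummableZ (c ^+ 2)) sx; apply: rsummable_le sx _ => i.
rewrite ger0_norm ?sqr_ge0// -exprMn ler_sqr ?nnegrE ?hnorm_ge0//.
exact: le_trans (hnorm_ge0 _ _) (jc _).
Qed.

Definition hsum_map (x : hsum dE) : hsum dF := HSum (sq_summable_map x).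

Lemma hsum_map_linear : linear hsum_map.
Proof. by move=> a x y; apply: hsum_ext => i /=; rewrite linearP. Qed.

HB.instance Definition _ := GRing.isLinear.Build R[i] (hsum dE) (hsum dF) _
  hsum_map hsum_map_linear.

End hsum_map.
End hilbert_sum.
Arguments hsum_dot {R I E} dE x y.

Notation L2_sum mu := (hsum (fun i => L2_dot (mu i))).
Notation L2_sum_dot mu := (hsum_dot (fun i => L2_dot (mu i))).

Section forms.
Context {R : realType}.

Definition complete_dot (V : lmodType R[i]) (dV : {dot V for Num.conj}) : Prop :=
  forall u : nat -> V,
    (forall e : R, 0 < e ->
       exists N, forall m n, (N <= m)%N -> (N <= n)%N -> hnorm dV (u m - u n) < e) ->
    exists l, hnorm dV (u n - l) @[n --> \oo] --> (0 : R).

Context {H V : lmodType R[i]}.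
Variables (dH : {dot H for Num.conj}) (dV : {dot V for Num.conj}) (j : V -> H).

(* V is embedded in H by j (injective and linear in all uses). *)
Definition dense_range : Prop :=
  forall (u : H) (e : R), 0 < e -> exists v, hnorm dH (u - j v) < e.

Variable a : V -> V -> R[i].

Definition form_continuous : Prop :=
  exists M : R, forall u v, normc (a u v) <= M * hnorm dV u * hnorm dV v.

Definition form_accretive : Prop := forall u, 0 <= Re (a u u).

Definition form_elliptic : Prop :=
  exists alpha omega : R, 0 < alpha /\
    forall u, alpha * hnorm dV u ^+ 2 <= Re (a u u) + omega * hnorm dH (j u) ^+ 2.

(* Graph of the operator A associated with a: [form_op u g] means that u lies in
   D(A) and A u = g, so that the f with a(u, v) = (f | v)_H is - g. *)
Definition form_op (u g : H) : Prop :=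
  exists2 psi, j psi = u & forall psi', a psi psi' = dH (- g) (j psi').

(* Only the values T t with 0 <= t matter. *)
Record C0_semigroup (T : R -> H -> H) : Prop := {
  sg_linear : forall t, 0 <= t -> linear (T t) ;
  sg_bounded : forall t, 0 <= t ->
    exists M : R, forall u, hnorm dH (T t u) <= M * hnorm dH u ;
  sg0 : forall u, T 0 u = u ;
  sgD : forall s t u, 0 <= s -> 0 <= t -> T (s + t) u = T s (T t u) ;
  sg_cvg : forall u, hnorm dH (T t u - u) @[t --> 0^'+] --> (0 : R) }.

Definition generator (T : R -> H -> H) (u g : H) : Prop :=
  hnorm dH ((t^-1)%:C *: (T t u - u) - g) @[t --> 0^'+] --> (0 : R).

(* T is the semigroup (e^{ta})_{t >= 0}. A C0-semigroup is determined by its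
   generator; analyticity follows from the continuity and ellipticity of a. *)
Definition form_semigroup (T : R -> H -> H) : Prop :=
  C0_semigroup T /\ forall u g, generator T u g <-> form_op u g.

Definition contractive (T : R -> H -> H) : Prop :=
  forall t u, 0 <= t -> hnorm dH (T t u) <= hnorm dH u.

Definition preserves (C : H -> Prop) (T : R -> H -> H) : Prop :=
  forall t u, 0 <= t -> C u -> C (T t u).

End forms.

(* The component a_{ik} : V_k x V_i -> C; note the order of the arguments. *)
Definition form_comp {R : realType} {I : choiceType} {V : I -> lmodType R[i]}
    {dV : forall i, {dot V i for Num.conj}} (a : hsum dV -> hsum dV -> R[i])
    (i k : I) (u : V k) (v : V i) : R[i] :=
  a (hsum_single dV u) (hsum_single dV v).

Section L2_order.
Context d (T : measurableType d) (R : realType) (mu : {measure set T -> \bar R}).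

Definition L2_real (u : L2 mu) : Prop := \forall x \ae mu, Im (u x) = 0.

(* The order of R[i] is the partial one: 0 <= z entails Im z = 0. *)
Definition L2_pos (u : L2 mu) : Prop := \forall x \ae mu, 0 <= u x.

(* The essential supremum of |u| is at most 1. *)
Definition L2_Linf1 (u : L2 mu) : Prop :=
  (Lnorm mu +oo (fun x => (normc (u x))%:E) <= 1)%E.

Lemma L2_trunc_excess (u : L2 mu) : L2_trunc u + L2_excess u = u.
Proof.
apply/L2P; apply: filterS3 (L2DE (L2_trunc u) (L2_excess u))
  (L2_ofE (sqint_ctrunc (L2_funP u))) (L2_ofE (sqint_cexcess (L2_funP u))).
by move=> x -> -> ->; exact: ctrunc_excess.
Qed.

End L2_order.

(* Main.v *)
(** A closed convex set C with projection P is invariant under the semigroup if and only if every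
    u in V satisfies P u in V and Re a(P u, u - P u) >= 0 (Ouhabaz). If this holds, the squared
    distance of an orbit to C has a nonpositive upper right Dini derivative. Conversely, if C is
    invariant, contractivity gives Re (A w | w - P w) <= 0 on D(A), so C is invariant under the
    resolvents, whose values at P u are bounded in V and converge to P u.

    The three assertions are the cases where P acts componentwise as z |-> Re z, as
    z |-> (Re z)^+ and as z |-> (1 /\ |z|) sign z. The inequality Re a_ii(P u, u - P u) >= 0 bounds
    the norm of P u in V_i by that of u uniformly in i, so that P maps V to V, and approximation
    by vectors with finitely many nonzero components reduces Re a(P u, u - P u) >= 0 to
    inequalities for the a_ij. Conversely, these follow by testing with vectors with few nonzero
    components. *)

Require Import Defs.
Set Warnings "-notation-overridden,-ambiguous-paths,-notation-incompatible-prefix".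
From HB Require Import structures.
From mathcomp Require Import all_boot all_order all_algebra.
From mathcomp Require Import all_classical all_reals all_analysis.
From mathcomp Require Import ring lra measurable_realfun ess_sup_inf.
Import Order.TTheory GRing.Theory Num.Theory.
Import numFieldNormedType.Exports.
From mathcomp Require Import sesquilinear complex.
Import Normc Defs.

Set Implicit Arguments.
Unset Strict Implicit.
Unset Printing Implicit Defensive.
Local Open Scope classical_set_scope.
Local Open Scope complex_scope.
Local Open Scope ring_scope.

(** * Hilbert spaces and real-linear functionals *)

Section real_linear.
Context {R : realType} {V : lmodType R[i]}.

(** The sets concerned are convex over the reals only, and so functionals, Riesz representation and
    Lax-Milgram are treated over the reals; imaginary parts come back by testing with ['i%C *: v].
    Completeness is assumed of V, hence every compactness argument takes place in V, through nested
    closed bounded convex sets. The obstacle is that the semigroup is bounded at each single time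
    and strongly continuous at 0 from the right, whereas the Dini argument also needs control of
    orbits from the left. This control is first obtained for short times and initial values in D(A),
    from uniform boundedness on V and Garding's inequality. The Dini argument with C = {0} then
    yields contractivity, which gives continuity from the left at all times and for all initial
    values, so that the argument applies to general C. Sufficiency of the form inequality rests on
    Re a(u, u - P u) = Re a(u - P u, u - P u) + Re a(P u, u - P u), where the first summand is
    nonnegative by accretivity and the left side is - Re (A u | u - P u) for u in D(A). *)

Definition real_linear (f : V -> R) := forall (r : R) u v,
  f (r%:C *: u + v) = r * f u + f v.

Variables (f : V -> R) (lf : real_linear f).

Lemma real_linear0 : f 0 = 0.
Proof. by have := lf 1 0 0; rewrite scaler0 addr0 mul1r => h; lra. Qed.

Lemma real_linearZ (r : R) u : f (r%:C *: u) = r * f u.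
Proof. by rewrite -[_ *: u]addr0 lf real_linear0 addr0. Qed.

Lemma real_linearD u v : f (u + v) = f u + f v.
Proof. by rewrite -[u in LHS]scale1r (lf 1) mul1r. Qed.

Lemma real_linearN u : f (- u) = - f u.
Proof. by rewrite -[u in LHS]scale1r -scaleNr -rmorphN real_linearZ mulN1r. Qed.

Lemma real_linearB u v : f (u - v) = f u - f v.
Proof. by rewrite real_linearD real_linearN. Qed.

End real_linear.

Section real_dot.
Context {R : realType} {E : lmodType R[i]} (dE : {dot E for Num.conj}).
Implicit Types (u v w : E) (r : R).

Definition rdot u v : R := Re (dE u v).

Lemma rdotC u v : rdot u v = rdot v u.
Proof. by rewrite /rdot hermC mul1r/= Re_conj. Qed.

Lemma rdotPl w : real_linear (rdot^~ w).
Proof.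
move=> r u v; rewrite /rdot linearDl/= linearZl_LR/= ReD ReM /=.
by rewrite mul0r subr0.
Qed.

Lemma rdotPr w : real_linear (rdot w).
Proof. by move=> r u v; rewrite ![rdot w _]rdotC rdotPl. Qed.

Lemma rdotDl u v w : rdot (u + v) w = rdot u w + rdot v w.
Proof. exact: (real_linearD (rdotPl w)). Qed.
Lemma rdotDr u v w : rdot w (u + v) = rdot w u + rdot w v.
Proof. exact: (real_linearD (rdotPr w)). Qed.
Lemma rdotBl u v w : rdot (u - v) w = rdot u w - rdot v w.
Proof. exact: (real_linearB (rdotPl w)). Qed.
Lemma rdotBr u v w : rdot w (u - v) = rdot w u - rdot w v.
Proof. exact: (real_linearB (rdotPr w)). Qed.
Lemma rdotNl u w : rdot (- u) w = - rdot u w.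
Proof. exact: (real_linearN (rdotPl w)). Qed.
Lemma rdotNr u w : rdot w (- u) = - rdot w u.
Proof. exact: (real_linearN (rdotPr w)). Qed.
Lemma rdotZl r u w : rdot (r%:C *: u) w = r * rdot u w.
Proof. exact: (real_linearZ (rdotPl w)). Qed.
Lemma rdotZr r u w : rdot w (r%:C *: u) = r * rdot w u.
Proof. exact: (real_linearZ (rdotPr w)). Qed.
Lemma rdot0l w : rdot 0 w = 0.
Proof. exact: (real_linear0 (rdotPl w)). Qed.
Lemma rdot0r w : rdot w 0 = 0.
Proof. exact: (real_linear0 (rdotPr w)). Qed.

Lemma rdotuu u : rdot u u = hnorm dE u ^+ 2.
Proof. by rewrite sqr_hnorm. Qed.

Lemma sqr_hnormD_rdot u v :
  hnorm dE (u + v) ^+ 2 = hnorm dE u ^+ 2 + 2 * rdot u v + hnorm dE v ^+ 2.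
Proof. by rewrite sqr_hnormD -/(rdot u v); ring. Qed.

Lemma sqr_hnormB_rdot u v :
  hnorm dE (u - v) ^+ 2 = hnorm dE u ^+ 2 - 2 * rdot u v + hnorm dE v ^+ 2.
Proof. by rewrite sqr_hnormD_rdot sqr_hnormN rdotNr; ring. Qed.

Lemma hnorm_eq0 u : hnorm dE u = 0 -> u = 0.
Proof.
move=> u0; apply: contrapT => /eqP un0.
have : 0 < dE u u by rewrite neq0_dnorm_gt0.
by rewrite dotuuE u0 expr0n ltxx.
Qed.

Lemma hnormZ r u : hnorm dE (r%:C *: u) = `|r| * hnorm dE u.
Proof.
apply/eqP; rewrite -(@eqrXn2 _ 2)// ?mulr_ge0 ?hnorm_ge0//.
by rewrite sqr_hnormZ normc_real exprMn.
Qed.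

Lemma hnormN u : hnorm dE (- u) = hnorm dE u.
Proof. by apply/eqP; rewrite -(@eqrXn2 _ 2)// ?hnorm_ge0// sqr_hnormN. Qed.

Lemma hnormBC u v : hnorm dE (u - v) = hnorm dE (v - u).
Proof. by rewrite -hnormN opprB. Qed.

Lemma rdot_le_hnorm u v : rdot u v <= hnorm dE u * hnorm dE v.
Proof.
have [->|u0] := eqVneq u 0; first by rewrite rdot0l hnorm0 mul0r.
have [->|v0] := eqVneq v 0; first by rewrite rdot0r hnorm0 mulr0.
have pos w : w != 0 -> 0 < hnorm dE w.
  move=> w0; rewrite lt_neqAle hnorm_ge0 andbT.
  by apply: contra_neq w0 => /esym /hnorm_eq0.
have := pos _ u0; have := pos _ v0.
have := sqr_ge0 (hnorm dE ((hnorm dE v)%:C *: u - (hnorm dE u)%:C *: v)).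
rewrite sqr_hnormB_rdot !hnormZ rdotZl rdotZr !ger0_norm ?hnorm_ge0//.
set x := hnorm dE u; set y := hnorm dE v => h x0 y0.
have xy : 0 < x * y by rewrite mulr_gt0.
rewrite -(ler_pM2l xy) -subr_ge0; lra.
Qed.

Lemma normr_rdot_le u v : `|rdot u v| <= hnorm dE u * hnorm dE v.
Proof.
rewrite ler_norml rdot_le_hnorm andbT lerNl -rdotNl.
by rewrite (le_trans (rdot_le_hnorm _ _))// hnormN.
Qed.

Lemma hnormD_le u v : hnorm dE (u + v) <= hnorm dE u + hnorm dE v.
Proof.
rewrite -(@ler_pXn2r _ 2)// ?nnegrE ?addr_ge0 ?hnorm_ge0//.
by rewrite sqr_hnormD_rdot; have := rdot_le_hnorm u v; lra.
Qed.

Lemma hnormB_le u v : hnorm dE (u - v) <= hnorm dE u + hnorm dE v.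
Proof. by rewrite (le_trans (hnormD_le _ _))// hnormN. Qed.

Lemma hnorm_tri w u v : hnorm dE (u - v) <= hnorm dE (u - w) + hnorm dE (w - v).
Proof. by rewrite (le_trans _ (hnormD_le _ _))// addrA subrK. Qed.

Lemma hnorm_le_dist u v : hnorm dE u <= hnorm dE v + hnorm dE (u - v).
Proof. by rewrite -{1}(subrK v u) addrC hnormD_le. Qed.

Lemma eq_rdotl u v : (forall w, rdot u w = rdot v w) -> u = v.
Proof.
move=> uv; apply/eqP; rewrite -subr_eq0; apply/eqP/hnorm_eq0/eqP.
by rewrite -(@eqrXn2 _ 2)// ?hnorm_ge0// -rdotuu rdotBl uv subrr expr0n.
Qed.

End real_dot.

Lemma invrS_gt0 {R : realType} n : 0 < n.+1%:R^-1 :> R.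
Proof. by rewrite invr_gt0. Qed.

Lemma invrS_lt {R : realType} (e : R) : 0 < e ->
  exists N, forall n, (N <= n)%N -> n.+1%:R^-1 < e.
Proof.
move=> e0; have [N _ hN] := near_infty_natSinv_lt (PosNum e0).
by exists N => n Nn; exact: hN.
Qed.

(** * Completeness: nested convex sets, Riesz representation, Lax-Milgram *)

Section nested.
Context {R : realType} {V : lmodType R[i]} (dV : {dot V for Num.conj}).
Hypothesis V_complete : complete_dot dV.
Local Notation N := (hnorm dV).

(** Midpoints are all that the parallelogram identity asks for. *)
Definition mid_convex (K : set V) := forall u v, K u -> K v -> K (2^-1%:C *: (u + v)).

Definition norm_closed (K : set V) :=
  forall l, (forall e : R, 0 < e -> exists2 v, K v & N (v - l) < e) -> K l.

(** The distances [d n] from 0 to [K n] increase to a finite limit [D]. Almost minimal elements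
    [v n] form a Cauchy sequence: the midpoint of two late ones still lies in an early [K M], so its
    norm is almost [D], and the parallelogram identity makes their difference small. *)
Lemma nested_convex (K : nat -> set V) (B : R) :
  (forall n, K n !=set0) -> (forall n, K n.+1 `<=` K n) ->
  (forall n, mid_convex (K n)) -> (forall n, norm_closed (K n)) ->
  (forall v, K 0%N v -> N v <= B) -> exists l, forall n, K n l.
Proof.
move=> K0 KS Kc Kcl KB.
have Kle m n : (m <= n)%N -> K n `<=` K m.
  elim: n => [|n IH]; first by rewrite leqn0 => /eqP ->.
  rewrite leq_eqVlt => /predU1P[-> //|]; rewrite ltnS => /IH h.
  exact: subset_trans (KS n) h.
pose A n := [set N v | v in K n].
have hi n : has_inf (A n).
  split; first by have [v Kv] := K0 n; exists (N v), v.
  by exists 0 => _ [v _ <-]; exact: hnorm_ge0.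
pose d n := inf (A n).
have dle n v : K n v -> d n <= N v.
  by move=> Kv; apply: (ge_inf (hi n).2); exists v.
have dmono m n : (m <= n)%N -> d m <= d n.
  move=> mn; apply: (lb_le_inf (hi n).1) => _ [v Kv <-].
  exact/dle/(Kle _ _ mn).
have d0 n : 0 <= d n.
  by apply: (lb_le_inf (hi n).1) => _ [v Kv <-]; exact: hnorm_ge0.
have dB n : d n <= B.
  by have [v Kv] := K0 n; apply: le_trans (dle _ _ Kv) _; exact/KB/(Kle 0%N n).
have hs : has_sup (range d) by split; [exists (d 0%N), 0%N|exists B => _ [n _ <-]].
pose D := sup (range d).
have dD n : d n <= D by apply: (ub_le_sup hs.2); exists n.
have hv n : exists v, K n v /\ N v < d n + n.+1%:R^-1.
  have [_ [w Kw <-] lw] := @inf_adherent _ (A n) n.+1%:R^-1 (invrS_gt0 _) (hi n).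
  by exists w.
have [v vP] := choice hv.
have D0 : 0 <= D by exact: le_trans (d0 0%N) (dD _).
have cauchy (e : R) : 0 < e ->
    exists M, forall m n, (M <= m)%N -> (M <= n)%N -> N (v m - v n) < e.
  (* The squared distance of two late elements is at most [4 * ((D + eta) ^+ 2 - d M ^+ 2)], hence
     at most [8 * eta * (2 * D + 1)]; the factor 16 makes the final inequality strict. *)
  move=> e0; pose eta := Num.min 1 (e ^+ 2 / (16 * (2 * D + 1))).
  have q0 : 0 < 16 * (2 * D + 1) by lra.
  have eta0 : 0 < eta by rewrite lt_min ltr01 divr_gt0// exprn_gt0.
  have eta1 : eta <= 1 by rewrite ge_min lexx.
  have etae : eta * (16 * (2 * D + 1)) <= e ^+ 2.
    by rewrite -ler_pdivlMr// ge_min lexx orbT.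
  have [M1 hM1] := invrS_lt eta0.
  have [_ [M2 _ <-] hM2] := sup_adherent eta0 hs; rewrite -/D in hM2.
  pose M := maxn M1 M2; exists M => m n Mm Mn.
  have small k : (M <= k)%N -> N (v k) < D + eta.
    move=> Mk; apply: lt_le_trans (vP k).2 _; apply: lerD => //.
    by apply/ltW/hM1; apply: leq_trans Mk; exact: leq_maxl.
  have dM : D - eta < d M by apply: lt_le_trans hM2 _; apply: dmono; exact: leq_maxr.
  have KM : K M (2^-1%:C *: (v m + v n)).
    by apply: Kc; [have := (vP m).1|have := (vP n).1]; exact: Kle.
  have := dle _ _ KM; rewrite hnormZ ger0_norm ?invr_ge0// => hmid.
  have := small m Mm; have := small n Mn.
  have := hnorm_ge0 dV (v m); have := hnorm_ge0 dV (v n).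
  have := hnorm_ge0 dV (v m + v n); have := hnorm_ge0 dV (v m - v n).
  have := sqr_hnormB_rdot dV (v m) (v n); have := sqr_hnormD_rdot dV (v m) (v n).
  have := dD M; have := d0 M.
  move: hmid dM; set x := N (v m); set y := N (v n); set s := N (_ + _); set t := N (_ - _).
  set r := rdot _ _ _; set dm := d M.
  move=> hs' hd dm0 dmD es et t0 s0 y0 x0 yl xl.
  have t2 : t ^+ 2 = 2 * x ^+ 2 + 2 * y ^+ 2 - s ^+ 2 by lra.
  rewrite -(@ltr_pXn2r _ 2)// ?nnegrE// ?(ltW e0)//.
  have x2 : x ^+ 2 <= (D + eta) ^+ 2 by rewrite ler_pXn2r ?nnegrE//; lra.
  have y2 : y ^+ 2 <= (D + eta) ^+ 2 by rewrite ler_pXn2r ?nnegrE//; lra.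
  have s2 : (2 * dm) ^+ 2 <= s ^+ 2 by rewrite ler_pXn2r ?nnegrE//; lra.
  have f1 : (D + eta) ^+ 2 - dm ^+ 2 <= 2 * eta * (2 * D + 1).
    have -> : (D + eta) ^+ 2 - dm ^+ 2 = (D + eta - dm) * (D + eta + dm) by ring.
    by apply: ler_pM; lra.
  have f2 : 0 < eta * (2 * D + 1) by rewrite mulr_gt0//; lra.
  by rewrite t2; lra.
have [l hl] := V_complete cauchy.
exists l => n; apply: Kcl => e e0.
have /cvgrPdist_lt /(_ _ e0)[M _ hM] := hl.
exists (v (maxn n M)); first by apply: (Kle n (maxn n M)) (leq_maxl _ _) _ (vP _).1.
by have := hM _ (leq_maxr n M); rewrite sub0r normrN ger0_norm ?hnorm_ge0.
Qed.

Definition lipschitz (f : V -> R) := exists L : R, forall u v, `|f u - f v| <= L * N (u - v).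

Lemma lipschitz_closed f c : lipschitz f -> norm_closed [set v | f v <= c].
Proof.
move=> [L fL] l hl /=; apply/ler_addgt0Pr => e e0.
pose L' := `|L| + 1; have L0 : 0 < L' by rewrite ltr_wpDl.
have [v /= fv vl] := hl _ (divr_gt0 e0 L0).
have := fL l v; rewrite hnormBC ler_norml => /andP[_ h].
have : L * N (v - l) <= e.
  apply: (@le_trans _ _ (L' * N (v - l))).
    by rewrite ler_wpM2r ?hnorm_ge0// (le_trans (ler_norm _))// lerDl.
  by rewrite mulrC -ler_pdivlMr// ltW.
lra.
Qed.

Lemma norm_closedI (K K' : set V) : norm_closed K -> norm_closed K' -> norm_closed (K `&` K').
Proof.
move=> cK cK' l hl; split; [apply: cK|apply: cK'] => e /hl[v [Kv K'v] vl];
  by exists v.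
Qed.

Lemma mid_convexI (K K' : set V) : mid_convex K -> mid_convex K' -> mid_convex (K `&` K').
Proof. by move=> cK cK' u v [? ?] [? ?]; split; [apply: cK|apply: cK']. Qed.

Lemma lipschitz_dist w : lipschitz (fun v => N (v - w)).
Proof.
exists 1 => u v; rewrite mul1r ler_norml; apply/andP; split.
  by have := hnorm_tri dV u v w; rewrite (hnormBC dV v u); lra.
by have := hnorm_tri dV v u w; lra.
Qed.

Lemma dist_mid_convex w c : mid_convex [set v | N (v - w) <= c].
Proof.
move=> u v /= uw vw.
have -> : 2^-1%:C *: (u + v) - w = 2^-1%:C *: ((u - w) + (v - w)).
  rewrite addrACA -opprD scalerBr; congr (_ - _).
  by rewrite scalerDr -scalerDl -rmorphD /= (_ : _ + _ = 1) ?scale1r//; field.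
rewrite hnormZ ger0_norm ?invr_ge0//.
have := hnormD_le dV (u - w) (v - w); lra.
Qed.


Lemma real_linear_mid_convex (f : V -> R) c : real_linear f -> mid_convex [set v | f v <= c].
Proof.
by move=> lf u v /= fu fv; rewrite (real_linearZ lf) (real_linearD lf); lra.
Qed.

Definition bounded_functional (f : V -> R) := exists L : R, forall v, `|f v| <= L * N v.

Lemma bounded_lipschitz (f : V -> R) : real_linear f -> bounded_functional f -> lipschitz f.
Proof. by move=> lf [L fL]; exists L => u v; rewrite -real_linearB. Qed.

(** The first-order condition at a minimum: a quadratic polynomial that vanishes at 0 and is
    nonnegative has no linear term. The test value is - r / s' with s' = |s| + 1, positive whatever
    the sign of [s]. *)
Lemma linear_coef_eq0 (r s : R) : (forall t, 0 <= 2 * t * r + t ^+ 2 * s) -> r = 0.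
Proof.
move=> h; pose s' := `|s| + 1; have s0 : 0 < s' by rewrite ltr_wpDl.
have ss : s <= s' by rewrite (le_trans (ler_norm _))// lerDl.
have := h (- r / s'); rewrite expr_div_n sqrrN.
have -> : 2 * (- r / s') * r + r ^+ 2 / s' ^+ 2 * s =
   - (r ^+ 2 / s') * (2 - s / s') by field; rewrite gt_eqF.
rewrite mulNr oppr_ge0 pmulr_lle0; last first.
  by have : s / s' <= 1 by [rewrite ler_pdivrMr// mul1r]; lra.
rewrite pmulr_lle0 ?invr_gt0// => r2; apply/eqP; rewrite -sqrf_eq0.
by rewrite eq_le r2 sqr_ge0.
Qed.

(** The element [u] of least norm in the affine hyperplane where [f] equals 1 is orthogonal to the
    kernel of [f], and its multiple by [(N u ^+ 2)^-1] represents [f]. *)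
Lemma riesz (f : V -> R) : real_linear f -> bounded_functional f ->
  exists u, forall v, f v = rdot dV u v.
Proof.
move=> lf bf; have [f0|] := pselect (forall v, f v = 0).
  by exists 0 => v; rewrite f0 rdot0l.
move=> /existsNP[w /eqP fw].
pose A := [set N v | v in [set v | f v = 1]].
have A0 : A !=set0.
  by exists (N ((f w)^-1%:C *: w)), ((f w)^-1%:C *: w) => //=; rewrite real_linearZ// mulVf.
have hi : has_inf A by split=> //; exists 0 => _ [v _ <-]; exact: hnorm_ge0.
(* The hyperplane is cut out by two inequalities because closedness and convexity are available for
   sublevel sets. The last set keeps the almost minimal vectors. *)
pose K n := [set v | f v <= 1] `&` [set v | - f v <= -1] `&`
  [set v | N (v - 0) <= inf A + n.+1%:R^-1].
have lNf : real_linear (fun v => - f v) by move=> r u v; rewrite lf; ring.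
have [||||v|u uP] := @nested_convex K (inf A + 1).
- move=> n; have [_ [v /= fv <-] lv] := @inf_adherent _ A n.+1%:R^-1 (invrS_gt0 _) hi.
  by exists v; split; [split => /=; rewrite fv|rewrite /= subr0 ltW].
- move=> n v [Kv /= lv]; split => //=; apply: le_trans lv _.
  by rewrite lerD2l lef_pV2 ?posrE// ler_nat.
- move=> n; apply: mid_convexI; last exact: dist_mid_convex.
  by apply: mid_convexI; exact: real_linear_mid_convex.
- move=> n; apply: norm_closedI; last exact/lipschitz_closed/lipschitz_dist.
  apply: norm_closedI; apply: lipschitz_closed; first exact: bounded_lipschitz.
  apply: bounded_lipschitz => //; have [L fL] := bf; exists L => v.
  by rewrite normrN.
- by move=> [_ /=]; rewrite subr0 invr1.
have fu : f u = 1.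
  by have [[/= h1 h2] _] := uP 0%N; apply/eqP; rewrite eq_le h1 -lerN2 h2.
have umin v : f v = 1 -> N u <= N v.
  move=> fv; apply: (@le_trans _ _ (inf A)); last first.
    by apply: (ge_inf hi.2); exists v.
  apply/ler_addgt0Pr => e /invrS_lt[n /(_ n (leqnn n)) ne].
  have [_ /=] := uP n; rewrite subr0 => h; apply: le_trans h _.
  by rewrite lerD2l ltW.
have orth v : f v = 0 -> rdot dV u v = 0.
  move=> fv; apply: (@linear_coef_eq0 _ (N v ^+ 2)) => t.
  have /umin : f (u + t%:C *: v) = 1.
    by rewrite real_linearD// real_linearZ// fv mulr0 addr0.
  rewrite -(@ler_pXn2r _ 2)// ?nnegrE ?hnorm_ge0//.
  by rewrite sqr_hnormD_rdot hnormZ rdotZr exprMn real_normK ?num_real//; lra.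
have u0 : N u ^+ 2 != 0.
  rewrite sqrf_eq0; apply/eqP => /hnorm_eq0 u0.
  by move/eqP: fu; rewrite u0 real_linear0// eq_sym oner_eq0.
exists ((N u ^+ 2)^-1%:C *: u) => v.
have := orth (v - (f v)%:C *: u); rewrite rdotBr rdotZr rdotZl rdotuu.
rewrite real_linearB// real_linearZ// fu mulr1 subrr => /(_ erefl)/eqP.
by rewrite subr_eq0 => /eqP ->; rewrite mulrC mulfK.
Qed.

(** With [B] and [g] representing [b] and [f], the residual [N (B u - g)] is minimized over [u].
    Coercivity bounds the minimizing sets, at a minimizer the residual is orthogonal to the range of
    [B], and coercivity applied to the residual itself shows that it is 0. *)
Lemma lax_milgram (b : V -> V -> R) (f : V -> R) (M alpha : R) :
  (forall w, real_linear (b^~ w)) -> (forall w, real_linear (b w)) ->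
  (forall u v, `|b u v| <= M * N u * N v) ->
  0 < alpha -> (forall u, alpha * N u ^+ 2 <= b u u) ->
  real_linear f -> bounded_functional f -> exists u, forall v, b u v = f v.
Proof.
move=> bl br bM alpha0 balpha lf bf.
have [g gP] := riesz lf bf.
have [B BP] : exists B : V -> V, forall u v, b u v = rdot dV (B u) v.
  have h u : exists Bu, forall v, b u v = rdot dV Bu v.
    by apply: riesz => //; exists (M * N u) => v; exact: bM.
  by have [B BP] := choice h; exists B.
have BZ r u : B (r%:C *: u) = r%:C *: B u.
  apply: (@eq_rdotl _ _ dV) => w; rewrite rdotZl -!BP.
  exact: (real_linearZ (bl w)).
have BD u v : B (u + v) = B u + B v.
  by apply: (@eq_rdotl _ _ dV) => w; rewrite rdotDl -!BP (real_linearD (bl w)).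
have BB u v : B (u - v) = B u - B v.
  by apply: (@eq_rdotl _ _ dV) => w; rewrite rdotBl -!BP (real_linearB (bl w)).
have BM u : N (B u) <= `|M| * N u.
  have [->|Bu0] := eqVneq (N (B u)) 0; first by rewrite mulr_ge0 ?hnorm_ge0.
  have Bu_gt0 : 0 < N (B u) by rewrite lt_neqAle eq_sym Bu0 hnorm_ge0.
  rewrite -(ler_pM2r Bu_gt0) -expr2 -rdotuu -BP (le_trans (ler_norm _))//.
  rewrite (le_trans (bM _ _))// ler_wpM2r ?hnorm_ge0// ler_wpM2r ?hnorm_ge0//.
  exact: ler_norm.
have Balpha u : alpha * N u <= N (B u).
  have [->|u0] := eqVneq (N u) 0; first by rewrite mulr0 hnorm_ge0.
  have u_gt0 : 0 < N u by rewrite lt_neqAle eq_sym u0 hnorm_ge0.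
  rewrite -(ler_pM2r u_gt0) -mulrA -expr2 (le_trans (balpha u))// BP.
  exact: rdot_le_hnorm.
pose A := [set N (B u - g) | u in setT].
have hi : has_inf A.
  by split; [exists (N (B 0 - g)), 0|exists 0 => _ [v _ <-]; exact: hnorm_ge0].
pose K n := [set u | N (B u - g) <= inf A + n.+1%:R^-1].
have lip : lipschitz (fun u => N (B u - g)).
  have [L hL] := lipschitz_dist g; exists (`|L| * `|M|) => u v.
  rewrite (le_trans (hL _ _))// -mulrA (@le_trans _ _ (`|L| * N (B u - B v)))//.
    by rewrite ler_wpM2r ?hnorm_ge0// ler_norm.
  by rewrite ler_wpM2l// -BB BM.
have [||||u|u uP] := @nested_convex K (alpha^-1 * (inf A + 1 + N g)).
- move=> n; have [_ [v /= _ <-] lv] := @inf_adherent _ A n.+1%:R^-1 (invrS_gt0 _) hi.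
  by exists v; exact: ltW.
- by move=> n v /= lv; apply: le_trans lv _; rewrite lerD2l lef_pV2 ?posrE// ler_nat.
- by move=> n u v Ku Kv; rewrite /K /= BZ BD; exact: dist_mid_convex.
- by move=> n; exact: lipschitz_closed.
- rewrite /K /= invr1 => h; rewrite ler_pdivlMl// (le_trans (Balpha u))//.
  have := hnorm_le_dist dV (B u) g; lra.
have umin v : N (B u - g) <= N (B v - g).
  apply: (@le_trans _ _ (inf A)); last first.
    by apply: (ge_inf hi.2); exists v.
  apply/ler_addgt0Pr => e /invrS_lt[n /(_ n (leqnn n)) ne].
  by apply: le_trans (uP n) _; rewrite lerD2l ltW.
have orth v : rdot dV (B u - g) (B v) = 0.
  apply: (@linear_coef_eq0 _ (N (B v) ^+ 2)) => t.
  have := umin (u + t%:C *: v).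
  rewrite -(@ler_pXn2r _ 2)// ?nnegrE ?hnorm_ge0// BD BZ addrAC.
  by rewrite (sqr_hnormD_rdot _ (B u - g)) hnormZ rdotZr exprMn real_normK ?num_real//; lra.
have : B u - g = 0.
  have := balpha (B u - g); rewrite BP rdotC orth pmulr_rle0// => r0.
  apply: (@hnorm_eq0 _ _ dV); apply/eqP.
  by rewrite -sqrf_eq0 eq_le r0 sqr_ge0.
move=> /eqP; rewrite subr_eq0 => /eqP Bg.
by exists u => v; rewrite gP BP Bg.
Qed.

End nested.

(** * Invariance of convex sets under the semigroup of a form *)

Lemma cvg_right0P {R : realType} (f : R -> R) : (forall t, 0 <= f t) ->
  f t @[t --> 0^'+] --> (0 : R) <->
  forall e : R, 0 < e -> exists2 d : R, 0 < d & forall t : R, 0 < t -> t < d -> f t < e.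
Proof.
move=> f0; split=> [/cvgrPdist_lt h e /h [d /= d0 hd]|h].
  exists d => // t t0 td; have := hd t.
  by rewrite /= !sub0r !normrN !ger0_norm ?(ltW t0)// => /(_ td t0).
apply/cvgrPdist_lt => e /h[d d0 hd]; near=> t.
by rewrite sub0r normrN ger0_norm//; apply: hd.
Unshelve. all: by end_near. Qed.

(** The two hypotheses say that the upper right Dini derivative is nonpositive and that [f] does not
    jump upwards when approached from the left. For [e > 0], let [s] be the supremum of the times
    with [f t <= f 0 + e * t]: the second hypothesis shows that [s] is such a time, the first that
    it cannot be smaller than [tau]. *)
Lemma right_dini_le {R : realType} (f : R -> R) (tau : R) : 0 <= tau ->
  (forall t : R, 0 <= t -> t < tau -> forall e : R, 0 < e ->
     exists2 d : R, 0 < d & forall h : R, 0 < h -> h < d -> f (t + h) <= f t + e * h) ->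
  (forall t : R, 0 < t -> t <= tau -> forall e : R, 0 < e ->
     exists2 d : R, 0 < d & forall h : R, 0 < h -> h < d -> h <= t -> f t <= f (t - h) + e) ->
  f tau <= f 0.
Proof.
move=> tau0 hr hl; apply/ler_addgt0Pr => e' e'0.
pose e := e' / (tau + 1); have e0 : 0 < e by rewrite divr_gt0// ltr_wpDl.
suff : f tau <= f 0 + e * tau.
  move=> h; apply: le_trans h _; rewrite lerD2l mulrAC ler_pdivrMr ?ltr_wpDl//.
  by rewrite ler_pM2l// lerDl.
pose S := [set t | [/\ 0 <= t, t <= tau & f t <= f 0 + e * t]].
have S0 : S 0 by split=> //; rewrite mulr0 addr0.
have hS : has_sup S by split; [exists 0|exists tau => t []].
pose s := sup S.
have s0 : 0 <= s by apply: (ub_le_sup hS.2).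
have stau : s <= tau by apply: (ge_sup hS.1) => t [].
have Ss : f s <= f 0 + e * s.
  have [->|sn0] := eqVneq s 0; first by rewrite mulr0 addr0.
  have sp : 0 < s by rewrite lt_neqAle eq_sym sn0.
  apply/ler_addgt0Pr => e1 e10; have [d d0 hd] := hl _ sp stau _ e10.
  have [t [t0 ttau ft] st] := sup_adherent d0 hS; rewrite -/s in st.
  have ts : t <= s by apply: (ub_le_sup hS.2).
  have es : e * t <= e * s by rewrite ler_pM2l.
  have [tse|tns] := eqVneq t s; first by move: ft es; rewrite tse; lra.
  have tlts : t < s by rewrite lt_neqAle tns.
  have := hd (s - t); rewrite subr_gt0 tlts subKr.
  have std : s - t < d by lra.
  have sts : s - t <= s by lra.
  by move=> /(_ isT std sts); lra.
have [<-//|sntau] := eqVneq s tau.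
have slt : s < tau by rewrite lt_neqAle sntau.
have [d d0 hd] := hr _ s0 slt _ e0.
pose h := Num.min (d / 2) (tau - s).
have h0 : 0 < h by rewrite lt_min divr_gt0//= subr_gt0.
have hd2 : h <= d / 2 by rewrite ge_min lexx.
have htau : h <= tau - s by rewrite ge_min lexx orbT.
have := hd h h0; have -> : h < d by lra.
move=> /(_ isT) fsh.
have : s + h <= s.
  apply: (ub_le_sup hS.2); split; [lra|lra|].
  by rewrite mulrDr; lra.
by rewrite gerDl leNgt h0.
Qed.

Lemma exists_gt3 {R : realDomainType} (x y z : R) :
  exists t, [/\ x < t, y < t, z < t & 0 < t].
Proof.
exists (`|x| + `|y| + `|z| + 1).
have [[? ?] ?] := (ler_norm x, ler_norm y, ler_norm z).
have [[? ?] ?] := (normr_ge0 x, normr_ge0 y, normr_ge0 z).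
by split; lra.
Qed.

(** The variational inequality characterizing the nearest point; closedness and convexity of [C]
    enter only through it. *)
Definition projection_on {R : realType} {H : lmodType R[i]} (dH : {dot H for Num.conj})
    (C : H -> Prop) (P : H -> H) :=
  (forall u, C (P u)) /\ (forall u q, C q -> rdot dH (q - P u) (u - P u) <= 0).

Section projection.
Context {R : realType} {H : lmodType R[i]} (dH : {dot H for Num.conj}).
Variables (C : H -> Prop) (P : H -> H) (CP : projection_on dH C P).

Lemma projection_dist u q : C q -> hnorm dH (u - P u) <= hnorm dH (u - q).
Proof.
move=> /(CP.2 u) h; rewrite -(@ler_pXn2r _ 2)// ?nnegrE ?hnorm_ge0//.
rewrite -[u - q](subrKA (P u)) (sqr_hnormD_rdot _ (u - P u)) -(opprB q) rdotNr rdotC.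
by have := sqr_ge0 (hnorm dH (- (q - P u))); lra.
Qed.

Lemma projection_dist_lip u v :
  hnorm dH (u - P u) <= hnorm dH (u - v) + hnorm dH (v - P v).
Proof. exact: le_trans (projection_dist u (CP.1 v)) (hnorm_tri dH v u (P v)). Qed.

Lemma projection_id u : C u -> P u = u.
Proof.
move=> /(projection_dist u); rewrite subrr hnorm0 => h.
apply/eqP; rewrite eq_sym -subr_eq0; apply/eqP/(@hnorm_eq0 _ _ dH)/eqP.
by rewrite eq_le h hnorm_ge0.
Qed.

Lemma projection_in u : hnorm dH (u - P u) <= 0 -> C u.
Proof.
move=> h; suff -> : u = P u by exact: CP.1.
apply/eqP; rewrite -subr_eq0; apply/eqP/(@hnorm_eq0 _ _ dH)/eqP.
by rewrite eq_le h hnorm_ge0.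
Qed.

End projection.

(** * The operator of a form, its resolvents, and bounds in V *)

Section form_theory.
Context {R : realType} {H V : lmodType R[i]}.
Variables (dH : {dot H for Num.conj}) (dV : {dot V for Num.conj}) (j : {linear V -> H}).
Variables (c : R) (a : {bilinear V -> V -> R[i] | *%R & Num.conj \; *%R}).
Hypothesis V_complete : complete_dot dV.
Hypothesis j_inj : injective j.
Hypothesis j_dense : dense_range dH j.
Hypothesis j_bounded : forall u, hnorm dH (j u) <= c * hnorm dV u.
Hypothesis a_continuous : form_continuous dV a.
Hypothesis a_elliptic : form_elliptic dH dV j a.
Hypothesis a_accretive : form_accretive a.
Local Notation N := (hnorm dV).
Local Notation NH := (hnorm dH).

Lemma Re_formPl w : real_linear (fun u => Re (a u w)).
Proof. by move=> r u v; rewrite linearDl/= linearZl_LR/= ReD ReM /= mul0r subr0. Qed.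

Lemma Re_formPr w : real_linear (fun u => Re (a w u)).
Proof. by move=> r u v; rewrite linearDr/= linearZr_LR/= ReD ReM /= oppr0 mul0r subr0. Qed.

Lemma Re_formB w u v : Re (a w (u - v)) = Re (a w u) - Re (a w v).
Proof. exact: (real_linearB (Re_formPr w)). Qed.
Lemma Re_formBl w u v : Re (a (u - v) w) = Re (a u w) - Re (a v w).
Proof. exact: (real_linearB (Re_formPl w)). Qed.

Lemma Re_form_bound : exists2 M : R, 0 <= M & forall u v, `|Re (a u v)| <= M * N u * N v.
Proof.
have [M hM] := a_continuous; exists `|M| => // u v.
rewrite (le_trans (normRe_normc _))// (le_trans (hM u v))//.
by rewrite ler_wpM2r ?hnorm_ge0// ler_wpM2r ?hnorm_ge0// ler_norm.
Qed.

Lemma form_garding : exists alpha omega : R, [/\ 0 < alpha, 0 <= omega &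
  forall u, alpha * N u ^+ 2 <= Re (a u u) + omega * NH (j u) ^+ 2].
Proof.
have [alpha [omega [alpha0 h]]] := a_elliptic; exists alpha, `|omega|; split=> // u.
by rewrite (le_trans (h u))// lerD2l ler_wpM2r ?sqr_ge0// ler_norm.
Qed.

Lemma real_linear_j f : real_linear (fun v => rdot dH f (j v)).
Proof. by move=> r u v; rewrite linearP/= rdotPr. Qed.

Lemma bounded_j f : bounded_functional dV (fun v => rdot dH f (j v)).
Proof.
exists (NH f * c) => v; rewrite (le_trans (normr_rdot_le _ _ _))//.
by rewrite -mulrA ler_wpM2l ?hnorm_ge0.
Qed.

(** Testing with ['i%C *: v] as well as [v] recovers the imaginary part of the identity. *)
Lemma form_opP w g : (forall v, Re (a w v) = - rdot dH g (j v)) -> form_op dH j a (j w) g.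
Proof.
move=> h; exists w => // v; have := h v; have := h ('i%C *: v).
rewrite linearZr_LR/= linearZ_LR linearNl/= /rdot linearZr_LR/=.
case: (a w v) => x y /=; case: (dH g (j v)) => x' y' /=.
by move=> h1 h2; apply/eqP; rewrite eq_complex /=; apply/andP; split; apply/eqP; lra.
Qed.

Lemma form_opE u g : form_op dH j a u g ->
  exists2 w, j w = u & forall v, Re (a w v) = - rdot dH g (j v).
Proof. by move=> [w wu h]; exists w => // v; rewrite h -rdotNl. Qed.

Lemma form_opB u g u' g' : form_op dH j a u g -> form_op dH j a u' g' ->
  form_op dH j a (u - u') (g - g').
Proof.
move=> /form_opE[w <- h] /form_opE[w' <- h']; rewrite -raddfB; apply: form_opP => v.
by rewrite Re_formBl h h' rdotBl; ring.
Qed.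

(** Here [j w] is lam (lam - A)^-1 f, the resolvent normalized so as to approximate the identity. By
    Garding's inequality, Re a + lam (. | .) is coercive as soon as [lam] exceeds [omega]. *)
Lemma resolvent_ex : exists lam0 : R, forall lam, lam0 < lam ->
  forall f, exists w, form_op dH j a (j w) (lam%:C *: (j w - f)).
Proof.
have [M M0 hM] := Re_form_bound; have [alpha [omega [alpha0 omega0 hE]]] := form_garding.
exists omega => lam lamo f; have lam0 : 0 <= lam by rewrite (le_trans omega0)// ltW.
pose b u v := Re (a u v) + lam * rdot dH (j u) (j v).
have [|||||||w wP] := @lax_milgram _ _ dV V_complete b (fun v => lam * rdot dH f (j v))
  (M + lam * c ^+ 2) alpha.
- by move=> w r u v; rewrite /b Re_formPl linearP/= rdotPl; ring.
- by move=> w r u v; rewrite /b Re_formPr linearP/= rdotPr; ring.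
- move=> u v; rewrite (le_trans (ler_normD _ _))// -!mulrA mulrDl lerD ?mulrA//.
  rewrite normrM (ger0_norm lam0) -!mulrA ler_wpM2l//.
  rewrite (le_trans (normr_rdot_le _ _ _))//.
  rewrite (le_trans (ler_pM _ _ (j_bounded u) (j_bounded v))) ?hnorm_ge0//.
  by rewrite [leRHS]mulrA mulrACA.
- exact: alpha0.
- move=> u; rewrite (le_trans (hE u))// /b rdotuu lerD2l.
  by rewrite ler_wpM2r ?sqr_ge0// ltW.
- by move=> r u v; rewrite (real_linear_j f); ring.
- have [L hL] := bounded_j f; exists (lam * L) => v.
  by rewrite normrM (ger0_norm lam0) -mulrA ler_wpM2l.
exists w; apply: form_opP => v; rewrite rdotZl rdotBl.
have {}wP : Re (a w v) + lam * rdot dH (j w) (j v) = lam * rdot dH f (j v) := wP v.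
by rewrite mulrBr -wP; ring.
Qed.

Lemma resolvent_form lam f w v : form_op dH j a (j w) (lam%:C *: (j w - f)) ->
  Re (a w v) = lam * rdot dH (f - j w) (j v).
Proof.
by move=> /form_opE[w' /j_inj -> ->]; rewrite -rdotNl -scalerN opprB rdotZl.
Qed.

(** Accretivity at [w - w'] says that the inner product of [(f - f') - (j w - j w')] with
    [j w - j w'] is nonnegative; Cauchy-Schwarz does the rest. *)
Lemma resolvent_contractive lam f f' w w' : 0 < lam ->
  form_op dH j a (j w) (lam%:C *: (j w - f)) ->
  form_op dH j a (j w') (lam%:C *: (j w' - f')) -> NH (j w - j w') <= NH (f - f').
Proof.
move=> lam0 hw hw'; have := a_accretive (w - w').
rewrite Re_formBl (resolvent_form _ hw) (resolvent_form _ hw') -mulrBr -rdotBl.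
rewrite pmulr_rge0// (raddfB j) (_ : f - j w - (f' - j w') = (f - f') - (j w - j w')); last first.
  by rewrite !opprD !opprK addrACA.
rewrite rdotBl rdotuu subr_ge0 => h.
have [->|n0] := eqVneq (NH (j w - j w')) 0; first exact: hnorm_ge0.
have np : 0 < NH (j w - j w') by rewrite lt_neqAle eq_sym n0 hnorm_ge0.
by rewrite -(ler_pM2r np) -expr2 (le_trans h)// rdot_le_hnorm.
Qed.

(** For data in V, testing the resolvent equation with [w - v] turns Garding's inequality into a
    bound in V that is uniform in [lam] together with a rate of convergence in H. *)
Lemma resolvent_estimate : exists2 K : R, 0 <= K & exists lam1 : R, forall lam, lam1 < lam ->
  forall v w, form_op dH j a (j w) (lam%:C *: (j w - j v)) ->
  N (w - v) <= K * N v /\ (lam - lam1) * NH (j w - j v) ^+ 2 <= K * N v ^+ 2.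
Proof.
have [M M0 hM] := Re_form_bound; have [alpha [omega [alpha0 omega0 hE]]] := form_garding.
(* The two estimates hold with [M / alpha] and [M / alpha * M] respectively; this constant dominates
   both. *)
exists (M / alpha * (M + 1)); first by rewrite mulr_ge0 ?divr_ge0 ?addr_ge0 ?(ltW alpha0).
exists omega => lam lamo v w hw.
have e1 : Re (a w (w - v)) = - lam * NH (j w - j v) ^+ 2.
  rewrite (resolvent_form _ hw) -rdotuu raddfB -(opprB (j w) (j v)) rdotNl; ring.
have e2 := hE (w - v); rewrite (raddfB j) Re_formBl e1 in e2.
have e3 : `|Re (a v (w - v))| <= M * N v * N (w - v) by [].
move: e3; rewrite ler_norml => /andP[e3 _].
have t0 : 0 <= (lam - omega) * NH (j w - j v) ^+ 2.
  by rewrite mulr_ge0 ?sqr_ge0// subr_ge0 ltW.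
have e4 : alpha * N (w - v) ^+ 2 + (lam - omega) * NH (j w - j v) ^+ 2
   <= M * N v * N (w - v) by rewrite mulrBl; lra.
have x0 := hnorm_ge0 dV (w - v); have y0 := hnorm_ge0 dV v.
have e5 : N (w - v) <= M / alpha * N v.
  have [->|n0] := eqVneq (N (w - v)) 0; first by rewrite mulr_ge0 ?divr_ge0// ltW.
  have np : 0 < N (w - v) by rewrite lt_neqAle eq_sym n0.
  rewrite mulrAC ler_pdivlMr// mulrC -(ler_pM2r np) -mulrA -expr2; lra.
have MA : 0 <= M / alpha by rewrite divr_ge0// ltW.
split; first by rewrite (le_trans e5)// ler_wpM2r// ler_peMr// lerDr.
apply: (@le_trans _ _ (M * N v * (M / alpha * N v))).
  apply: (@le_trans _ _ (M * N v * N (w - v))).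
    by have := mulr_ge0 (ltW alpha0) (sqr_ge0 (N (w - v))); lra.
  by rewrite ler_wpM2l// mulr_ge0.
have -> : M * N v * (M / alpha * N v) = M / alpha * M * N v ^+ 2 by ring.
by rewrite ler_wpM2r ?sqr_ge0// ler_wpM2l// lerDl.
Qed.

(** For data in [V] the rate of [resolvent_estimate] suffices. General data are approximated from
    [V], and contractivity makes the error independent of [lam]. *)
Lemma resolvent_cvg f (e : R) : 0 < e -> exists lam1 : R, forall lam, lam1 < lam ->
  forall w, form_op dH j a (j w) (lam%:C *: (j w - f)) -> NH (j w - f) < e.
Proof.
move=> e0; have e4 : 0 < e / 4 by rewrite divr_gt0.
have [v fv] := j_dense f e4.
have [K K0 [lam1 hK]] := resolvent_estimate; have [lam0 hex] := resolvent_ex.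
have [lam2 [l0 l1 l2 _]] := exists_gt3 lam0 (K * N v ^+ 2 / (e / 4) ^+ 2 + lam1) 0.
have q0 : 0 <= K * N v ^+ 2 / (e / 4) ^+ 2 by rewrite divr_ge0 ?sqr_ge0// mulr_ge0 ?sqr_ge0.
exists lam2 => lam hlam w hw.
have lam00 : lam0 < lam by exact: lt_trans hlam.
have lam10 : lam1 < lam by lra.
have lamp : 0 < lam by exact: lt_trans hlam.
have [w' hw'] := hex _ lam00 (j v).
have [_ h1] := hK _ lam10 _ _ hw'.
have h2 := resolvent_contractive lamp hw hw'.
have h3 : NH (j w' - j v) < e / 4.
  rewrite -(@ltr_pXn2r _ 2)// ?nnegrE ?hnorm_ge0 ?(ltW e4)//.
  have lq : K * N v ^+ 2 / (e / 4) ^+ 2 < lam - lam1.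
    by lra.
  have lp : 0 < lam - lam1 by rewrite subr_gt0.
  rewrite -(ltr_pM2l lp); apply: le_lt_trans h1 _.
  by rewrite -ltr_pdivrMr// exprn_gt0.
have := hnorm_tri dH (j w') (j w) f; have := hnorm_tri dH (j v) (j w') f.
rewrite (hnormBC dH (j v) f); lra.
Qed.

Lemma form_op_dense f (e : R) : 0 < e -> exists u g, form_op dH j a u g /\ NH (u - f) < e.
Proof.
move=> /(resolvent_cvg f)[lam1 h1]; have [lam0 h0] := resolvent_ex.
have [lam [l0 l1 _ _]] := exists_gt3 lam0 lam1 0; have [w hw] := h0 _ l0 f.
by exists (j w), (lam%:C *: (j w - f)); split=> //; exact: (h1 _ l1).
Qed.

(* Nested convex sets replace the weak compactness of the ball. *)
Lemma form_ball_closed f (B : R) :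
  (forall e : R, 0 < e -> exists2 v, N v <= B & NH (j v - f) <= e) -> exists p, j p = f.
Proof.
move=> hB; pose K n := [set v | N (v - 0) <= B] `&` [set v | NH (j v - f) <= n.+1%:R^-1].
have [||||v|p pP] := @nested_convex _ _ dV V_complete K B.
- move=> n; have [v vB vf] := hB _ (invrS_gt0 n); exists v; split=> //=.
  by rewrite subr0.
- move=> n v [Kv /= lv]; split => //=; apply: le_trans lv _.
  by rewrite lef_pV2 ?posrE// ler_nat.
- move=> n; apply: mid_convexI; first exact: dist_mid_convex.
  by move=> u v /= hu hv; rewrite linearZ_LR raddfD; exact: dist_mid_convex.
- move=> n; apply: norm_closedI; first exact/lipschitz_closed/lipschitz_dist.
  apply: lipschitz_closed; have [L hL] := lipschitz_dist dH f.
  exists (`|L| * c) => u v; rewrite (le_trans (hL _ _))// -raddfB -mulrA.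
  apply: (@le_trans _ _ (`|L| * NH (j (u - v)))).
    by rewrite ler_wpM2r ?hnorm_ge0// ler_norm.
  by rewrite ler_wpM2l.
- by move=> [/=]; rewrite subr0.
exists p; apply/eqP; rewrite -subr_eq0; apply/eqP/(@hnorm_eq0 _ _ dH)/eqP.
rewrite eq_le hnorm_ge0 andbT; apply/ler_addgt0Pr => e /invrS_lt[n /(_ n (leqnn n)) ne].
by rewrite add0r; have [_ /= h] := pP n; rewrite (le_trans h)// ltW.
Qed.

(** Boundedness in V and convergence to 0 in H imply weak convergence to 0 in V. Otherwise the sets
    of vectors in the ball with small image and with [e <= f v] would have a common point; its image
    under [j] is 0, hence so is the point, although [f] is at least [e] there. *)
Lemma form_weak_cvg0 (f : V -> R) (B e : R) : real_linear f -> bounded_functional dV f ->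
  0 < e -> exists2 d : R, 0 < d & forall v, N v <= B -> NH (j v) <= d -> f v < e.
Proof.
move=> lf bf e0; apply: contrapT => hn.
pose K n := [set v | N (v - 0) <= B] `&` [set v | NH (j v - 0) <= n.+1%:R^-1]
  `&` [set v | - f v <= - e].
have lNf : real_linear (fun v => - f v) by move=> r u v; rewrite lf; ring.
have [||||v|p pP] := @nested_convex _ _ dV V_complete K B.
- move=> n; apply: contrapT => hK; apply: hn; exists n.+1%:R^-1; first exact: invrS_gt0.
  move=> v vB vn; rewrite ltNge; apply/negP => ef; apply: hK; exists v; split.
    by split; rewrite /= subr0.
  by rewrite /= lerN2.
- move=> n v [[Kv /= lv] ?]; split => //=; split=> //=; apply: le_trans lv _.
  by rewrite lef_pV2 ?posrE// ler_nat.
- move=> n; apply: mid_convexI; last exact: real_linear_mid_convex.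
  apply: mid_convexI; first exact: dist_mid_convex.
  by move=> u v /= hu hv; rewrite linearZ_LR raddfD; exact: dist_mid_convex.
- move=> n; apply: norm_closedI; last first.
    apply: lipschitz_closed; apply: bounded_lipschitz => //.
    by have [L hL] := bf; exists L => v; rewrite normrN.
  apply: norm_closedI; first exact/lipschitz_closed/lipschitz_dist.
  apply: lipschitz_closed; have [L hL] := lipschitz_dist dH 0.
  exists (`|L| * c) => u v; rewrite (le_trans (hL _ _))// -raddfB -mulrA.
  apply: (@le_trans _ _ (`|L| * NH (j (u - v)))).
    by rewrite ler_wpM2r ?hnorm_ge0// ler_norm.
  by rewrite ler_wpM2l.
- by move=> [[/=]]; rewrite subr0.
have jp0 : j p = j 0.
  rewrite raddf0; apply/(@hnorm_eq0 _ _ dH)/eqP.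
  rewrite eq_le hnorm_ge0 andbT; apply/ler_addgt0Pr => d /invrS_lt[n /(_ n (leqnn n)) ne].
  rewrite add0r; have [[_ /=]] := pP n; rewrite subr0 => h _.
  by rewrite (le_trans h)// ltW.
have [_ /=] := pP 0%N; rewrite (j_inj jp0) real_linear0// oppr0 oppr_ge0.
by rewrite leNgt e0.
Qed.


(* K depends on the form only; hence it does not depend on i when u is supported in the
   component i. *)
Lemma form_projection_bound : exists2 K : R, 0 <= K & forall u p,
  0 <= Re (a p (u - p)) -> NH (j p) <= NH (j u) -> N p <= K * N u.
Proof.
have [M M0 hM] := Re_form_bound; have [alpha [omega [alpha0 omega0 hE]]] := form_garding.
(* When [N u < N p], the terms [Re (a p u)] and [omega * NH (j p) ^+ 2] are bounded by
   [M * N p * N u] and [omega * c ^+ 2 * N u * N p], and Garding's inequality becomes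
   [alpha * N p <= L * N u]. *)
pose L := M + omega * c ^+ 2.
have L0 : 0 <= L by rewrite addr_ge0// mulr_ge0// sqr_ge0.
have La : 0 <= L / alpha by rewrite divr_ge0// ltW.
exists (1 + L / alpha) => [|u p]; first by rewrite addr_ge0.
rewrite Re_formB => h1 h2; have u0 := hnorm_ge0 dV u.
rewrite mulrDl mul1r; have [pu|up] := leP (N p) (N u).
  by rewrite (le_trans pu)// lerDl mulr_ge0.
have p0 : 0 < N p by exact: le_lt_trans up.
suff : alpha * N p <= L * N u by rewrite -ler_pdivlMl// [_^-1 * _]mulrCA mulrA; lra.
rewrite -(ler_pM2r p0) -mulrA -expr2; have := hE p.
have := hM p u; rewrite ler_norml => /andP[_ h3].
have h4 : omega * NH (j p) ^+ 2 <= omega * (c ^+ 2 * N u ^+ 2).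
  rewrite ler_wpM2l// -exprMn ler_pXn2r// ?nnegrE ?hnorm_ge0//.
    exact: le_trans h2 (j_bounded u).
  exact: le_trans (hnorm_ge0 dH (j u)) (j_bounded u).
have h5 : omega * (c ^+ 2 * N u ^+ 2) <= omega * (c ^+ 2 * (N u * N p)).
  by rewrite ler_wpM2l// ler_wpM2l ?sqr_ge0// expr2 ler_wpM2l// ltW.
by rewrite /L; lra.
Qed.

(** * Orbits of the semigroup and their distance to a convex set *)

Section semigroup.
Variable T : R -> H -> H.
Hypothesis T_semigroup : form_semigroup dH j a T.

Lemma semigroup_cvg u (e : R) : 0 < e ->
  exists2 d : R, 0 < d & forall t : R, 0 < t -> t < d -> NH (T t u - u) < e.
Proof.
have h0 t : 0 <= NH (T t u - u) by exact: hnorm_ge0.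
by have [+ _] := cvg_right0P h0; apply; exact: (sg_cvg T_semigroup.1).
Qed.

Lemma semigroup_diff u g (e : R) : form_op dH j a u g -> 0 < e -> exists2 d : R,
  0 < d & forall t : R, 0 < t -> t < d -> NH ((t^-1)%:C *: (T t u - u) - g) < e.
Proof.
move=> /(T_semigroup.2 u g).2 ug.
have h0 t : 0 <= NH ((t^-1)%:C *: (T t u - u) - g) by exact: hnorm_ge0.
by have [+ _] := cvg_right0P h0; apply.
Qed.

Lemma semigroupP (t : R) r u v : 0 <= t -> T t (r *: u + v) = r *: T t u + T t v.
Proof. by move=> t0; exact: (sg_linear T_semigroup.1). Qed.

Lemma semigroupB (t : R) u v : 0 <= t -> T t (u - v) = T t u - T t v.
Proof. by move=> t0; rewrite addrC -scaleN1r semigroupP// scaleN1r addrC. Qed.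

Lemma semigroup0 (t : R) : 0 <= t -> T t 0 = 0.
Proof. by move=> t0; have := semigroupB 0 0 t0; rewrite !subrr. Qed.

Lemma semigroupZ (t : R) r u : 0 <= t -> T t (r *: u) = r *: T t u.
Proof. by move=> t0; rewrite -[r *: u]addr0 semigroupP// semigroup0// addr0. Qed.

Lemma semigroupD (t : R) u v : 0 <= t -> T t (u + v) = T t u + T t v.
Proof. by move=> t0; have := semigroupP 1 u v t0; rewrite !scale1r. Qed.

Lemma semigroup_bounded (t : R) : 0 <= t ->
  exists2 M : R, 0 <= M & forall u, NH (T t u) <= M * NH u.
Proof.
move=> /(sg_bounded T_semigroup.1)[M hM]; exists `|M| => // u.
by rewrite (le_trans (hM u))// ler_wpM2r ?hnorm_ge0// ler_norm.
Qed.

(** The difference quotients at [T t u] are the images under [T t] of those at [u]. *)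
Lemma form_op_semigroup (t : R) u g : 0 <= t -> form_op dH j a u g ->
  form_op dH j a (T t u) (T t g).
Proof.
move=> t0 ug; have [M M0 hM] := semigroup_bounded t0.
apply/(T_semigroup.2 _ _).1/cvg_right0P => [h|e e0]; first exact: hnorm_ge0.
have M1 : 0 < M + 1 by rewrite ltr_wpDl.
have [d d0 hd] := semigroup_diff ug (divr_gt0 e0 M1).
exists d => // h h0 /(hd h h0).
rewrite -(sgD T_semigroup.1 u (ltW h0) t0) [h + t]addrC.
rewrite (sgD T_semigroup.1 u t0 (ltW h0)) -semigroupB// -semigroupZ// -semigroupB// => hlt.
rewrite (le_lt_trans (hM _))//; move: hlt; rewrite ltr_pdivlMr//.
have := hnorm_ge0 dH ((h^-1)%:C *: (T h u - u) - g).
by rewrite mulrDr mulr1 [M * _]mulrC; lra.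
Qed.

(* Banach-Steinhaus for the operators [v |-> T t (j v)] on V, by nested balls: it is V that is
   assumed to be complete. *)
Lemma semigroup_locally_bounded : exists (d K : R), [/\ 0 < d, 0 <= K &
  forall t : R, 0 < t -> t < d -> forall v, NH (T t (j v)) <= K * N v].
Proof.
apply: contrapT => hn.
have step n (x : V) (r : R) : 0 < r -> exists p : V * R, [/\ 0 < p.2, p.2 <= r / 2,
    N (p.1 - x) <= r / 2 & exists t : R, [/\ 0 < t, t < n.+1%:R^-1 &
      forall y, N (y - p.1) <= p.2 -> n%:R <= NH (T t (j y))]].
  (* Failure of the bound with this [K] gives a vector whose multiple of norm [r / 2] has an image
     of norm greater than [n%:R + 1]. *)
  move=> r0; pose K := (n%:R + 1) / (r / 2).
  have r2 : 0 < r / 2 by rewrite divr_gt0.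
  have K0 : 0 < K by rewrite divr_gt0// ltr_wpDl.
  have [t [t0 tn [v hv]]] : exists t : R, [/\ 0 < t, t < n.+1%:R^-1 &
      exists v, K * N v < NH (T t (j v))].
    apply: contrapT => ht; apply: hn; exists n.+1%:R^-1, K; split=> //; first exact: ltW.
    move=> t t0 tn v; rewrite leNgt; apply/negP => hv; apply: ht.
    by exists t; split=> //; exists v.
  have v0 : 0 < N v.
    rewrite lt_neqAle hnorm_ge0 andbT; apply: contraTneq hv => /esym /hnorm_eq0 ->.
    by rewrite raddf0 semigroup0 ?(ltW t0)// !hnorm0 mulr0 ltxx.
  have t0' := ltW t0; have [M M0 hM] := semigroup_bounded t0'.
  pose w := (r / 2 / N v)%:C *: v.
  have wr : N w = r / 2 by rewrite hnormZ ger0_norm ?divfK ?gt_eqF// divr_ge0 ?ltW.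
  have Tw : n%:R + 1 < NH (T t (j w)).
    rewrite linearZ_LR/= semigroupZ// hnormZ ger0_norm; last by rewrite divr_ge0 ?ltW.
    rewrite -ltr_pdivrMl ?divr_gt0//; apply: le_lt_trans hv.
    by rewrite /K invf_div mulrC [leRHS]mulrAC mulrA.
  (* The images of [x + w] and [x - w] differ by twice that of [w], so one of the two is large. *)
  have [y yx hy] : exists2 y, N (y - x) = r / 2 & n%:R + 1 < NH (T t (j y)).
    have := hnormB_le dH (T t (j (x + w))) (T t (j (x - w))).
    rewrite -semigroupB// -(raddfB j).
    have -> : x + w - (x - w) = w + w by rewrite opprB addrC addrA subrK.
    rewrite (raddfD j w) semigroupD// => h.
    have h2 : NH (T t (j w) + T t (j w)) = 2 * NH (T t (j w)).
      rewrite -[X in X + _]scale1r -[X in _ + X]scale1r -scalerDl.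
      by rewrite -(rmorph1 (real_complex R)) -rmorphD hnormZ ger0_norm.
    rewrite h2 in h.
    have [h3|h3] := leP (NH (T t (j (x + w)))) (n%:R + 1).
      by exists (x - w); [rewrite addrC addKr hnormN|lra].
    by exists (x + w) => //; rewrite addrC addKr.
  have c1 : 0 < M * `|c| + 1 by rewrite ltr_wpDl// mulr_ge0.
  (* On a ball of this radius the image moves by at most 1, which uses up the surplus in
     [n%:R + 1]. *)
  exists (y, Num.min (r / 2) (M * `|c| + 1)^-1); split => /=.
  - by rewrite lt_min r2 invr_gt0.
  - by rewrite ge_min lexx.
  - by rewrite yx.
  exists t; split=> // z; rewrite le_min => /andP[_ zy].
  have : NH (T t (j (z - y))) <= 1.
    rewrite (le_trans (hM _))//.
    apply: (@le_trans _ _ ((M * `|c| + 1) * N (z - y))); last first.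
      by rewrite mulrC -ler_pdivlMr// mul1r.
    rewrite mulrDl -mulrA; apply: (@le_trans _ _ (M * (`|c| * N (z - y)))).
      rewrite ler_wpM2l// (le_trans (j_bounded _))// ler_wpM2r ?hnorm_ge0//.
      exact: ler_norm.
    by rewrite lerDl mul1r hnorm_ge0.
  rewrite raddfB semigroupB//; have := hnorm_tri dH (T t (j z)) (T t (j y)) 0.
  by rewrite !subr0 hnormBC; lra.
have [F FP] : exists F : nat -> V * R -> V * R, forall n p, 0 < p.2 -> [/\ 0 < (F n p).2,
    (F n p).2 <= p.2 / 2, N ((F n p).1 - p.1) <= p.2 / 2 &
    exists t : R, [/\ 0 < t, t < n.+1%:R^-1 &
      forall y, N (y - (F n p).1) <= (F n p).2 -> n%:R <= NH (T t (j y))]].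
  have h (np : nat * (V * R)) : exists q : V * R, 0 < np.2.2 -> [/\ 0 < q.2,
      q.2 <= np.2.2 / 2, N (q.1 - np.2.1) <= np.2.2 / 2 &
      exists t : R, [/\ 0 < t, t < np.1.+1%:R^-1 &
        forall y, N (y - q.1) <= q.2 -> np.1%:R <= NH (T t (j y))]].
    have [p0|p0] := pselect (0 < np.2.2); last by exists np.2.
    by have [q hq] := step np.1 np.2.1 np.2.2 p0; exists q.
  by have [F hF] := choice h; exists (fun n p => F (n, p)) => n p; exact: (hF (n, p)).
pose p := fix p n := if n is m.+1 then F m (p m) else (0 : V, 1 : R).
have p0 n : 0 < (p n).2 by elim: n => [|n IH] /=; [exact: ltr01|have [] := FP n _ IH].
pose B n := [set y | N (y - (p n).1) <= (p n).2].
have [||||v|x hx] := @nested_convex _ _ dV V_complete B 1.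
- by move=> n; exists (p n).1; rewrite /B /= subrr hnorm0 ltW.
- move=> n y; rewrite /B => /= hy; have [_ h1 h2 _] := FP n _ (p0 n).
  by have := hnorm_tri dV (F n (p n)).1 y (p n).1; lra.
- by move=> n; exact: dist_mid_convex.
- by move=> n; exact/lipschitz_closed/lipschitz_dist.
- by rewrite /B /= subr0.
(* At the common point [x] of the balls, [NH (T t (j x))] is at least [n%:R] for some [t] below
   [n.+1%:R^-1], which contradicts strong continuity at 0 for large [n]. *)
have [d d0 hd] := semigroup_cvg (j x) ltr01.
have [n1 hn1] := invrS_lt d0.
pose n := maxn n1 (Num.truncn (NH (j x) + 1)).+1.
have [_ _ _ [t [t0 tn ht]]] := FP n _ (p0 n).
have := ht x (hx n.+1); have := hd t t0 (lt_trans tn (hn1 n (leq_maxl _ _))).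
have : NH (j x) + 1 < n%:R.
  apply: lt_le_trans (truncnS_gt _) _; rewrite ler_nat; exact: leq_maxr.
by have := hnorm_le_dist dH (T t (j x)) (j x); lra.
Qed.

(* For u in D(A), Garding's inequality makes T h u - u small in V, not only in H. *)
Lemma semigroup_left_cvg : exists2 d : R, 0 < d & forall u g, form_op dH j a u g ->
  forall t : R, 0 < t -> t < d -> forall e : R, 0 < e ->
  exists2 eta : R, 0 < eta & forall h : R, 0 < h -> h < eta -> h < t ->
    NH (T (t - h) u - T t u) < e.
Proof.
have [d [K [d0 K0 hK]]] := semigroup_locally_bounded.
have [alpha [omega [alpha0 omega0 hE]]] := form_garding.
exists d => // u g ug t t0 td e e0.
(* With [j w = T h u - u], the bound [alpha * N w ^+ 2 < q] gives [K * N w < e]. The left side is at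
   most [(omega + 1) * NH (j w)], because [T h g - g] and [j w] have norm at most 1; hence the
   choice of [s]. *)
pose q := alpha * (e / (K + 1)) ^+ 2.
have K1 : 0 < K + 1 by rewrite ltr_wpDl.
have q0 : 0 < q by rewrite mulr_gt0// exprn_gt0// divr_gt0.
pose s := Num.min 1 (q / (omega + 1)).
have o1 : 0 < omega + 1 by rewrite ltr_wpDl.
have s0 : 0 < s by rewrite lt_min ltr01 divr_gt0.
have s1 : s <= 1 by rewrite ge_min lexx.
have sq : s * (omega + 1) <= q by rewrite -ler_pdivlMr// ge_min lexx orbT.
have [d1 d10 h1] := semigroup_cvg u s0; have [d2 d20 h2] := semigroup_cvg g ltr01.
exists (Num.min d1 d2); first by rewrite lt_min d10.
move=> h h0; rewrite lt_min => /andP[hd1 hd2] ht.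
have th : 0 < t - h by rewrite subr_gt0.
have := form_opB (form_op_semigroup (ltW h0) ug) ug => /form_opE[w wE wP].
have -> : T t u = T (t - h) (T h u).
  by rewrite -(sgD T_semigroup.1) ?ltW// subrK.
rewrite hnormBC -semigroupB ?ltW// -wE.
have hlt : t - h < d by lra.
rewrite (le_lt_trans (hK _ th hlt w))//.
have := h1 h h0 hd1; have := h2 h h0 hd2; rewrite -wE => x1 x2.
have y1 := hnorm_ge0 dH (T h g - g); have y2 := hnorm_ge0 dH (j w).
have : alpha * N w ^+ 2 < q.
  apply: le_lt_trans (hE w) _; rewrite wP; apply: lt_le_trans sq.
  have := normr_rdot_le dH (T h g - g) (j w); rewrite ler_norml => /andP[z1 _].
  have z2 : NH (T h g - g) * NH (j w) <= NH (j w) by rewrite ler_piMl// ltW.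
  have z3 : NH (j w) ^+ 2 <= NH (j w) by rewrite expr2 ler_piMl//; lra.
  have z4 : omega * NH (j w) ^+ 2 <= omega * NH (j w) by rewrite ler_wpM2l.
  have z5 : (omega + 1) * NH (j w) < (omega + 1) * s by rewrite ltr_pM2l.
  lra.
rewrite ltr_pM2l// ltr_pXn2r// ?nnegrE ?hnorm_ge0 ?divr_ge0 ?(ltW e0) ?(ltW K1)//.
rewrite ltr_pdivlMr// => h3.
by have := hnorm_ge0 dV w; lra.
Qed.

(** The distance from [T (t + h) u] to [C] is at most that to the fixed point [P (T t u)], whose
    square has the derivative 2 Re (A v | v - P v) at h = 0, where v = [T t u]. Continuity from the
    left is a hypothesis because it is supplied in two ways, before and after contractivity is
    known. *)
Lemma orbit_dist_le C P u g (tau : R) : projection_on dH C P ->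
  (forall w g', form_op dH j a w g' -> rdot dH g' (w - P w) <= 0) ->
  form_op dH j a u g -> 0 <= tau ->
  (forall t : R, 0 < t -> t <= tau -> forall e : R, 0 < e ->
    exists2 eta : R, 0 < eta & forall h : R, 0 < h -> h < eta -> h < t ->
      NH (T (t - h) u - T t u) < e) ->
  NH (T tau u - P (T tau u)) <= NH (u - P u).
Proof.
move=> CP hP ug tau0 hleft; pose D t := NH (T t u - P (T t u)).
have D0 t : 0 <= D t by exact: hnorm_ge0.
rewrite -[u in leRHS](sg0 T_semigroup.1) -/(D tau) -/(D 0).
rewrite -(@ler_pXn2r _ 2)// ?nnegrE//.
apply: (@right_dini_le _ (fun t => D t ^+ 2)) => // [t t0 ttau e e0|t t0 ttau e e0].
  have ug' := form_op_semigroup t0 ug.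
  have hn := hP _ _ ug'.
  set v := T t u in ug' hn; set g' := T t g in ug' hn.
  (* The square of the distance grows by at most [h * s * (2 * D t + (NH g' + 1) ^+ 2)]: the first
     term comes from the error [r] of the difference quotient, the second from the quadratic term,
     where one factor [h] is bounded by [s]. *)
  pose B := 2 * D t + (NH g' + 1) ^+ 2 + 1.
  have B0 : 0 < B by rewrite ltr_wpDl// addr_ge0 ?sqr_ge0// mulr_ge0.
  pose s := Num.min 1 (e / B).
  have s0 : 0 < s by rewrite lt_min ltr01 divr_gt0.
  have s1 : s <= 1 by rewrite ge_min lexx.
  have sB : s * B <= e by rewrite -ler_pdivlMr// ge_min lexx orbT.
  have [d d0 hd] := semigroup_diff ug' s0.
  exists (Num.min d s); first by rewrite lt_min d0.
  move=> h h0; rewrite lt_min => /andP[hd' hs].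
  have h0' := ltW h0.
  have := hd h h0 hd'; rewrite [h^-1%:C *: _](_ : _ = h^-1%:C *: (T h v - v))//.
  set r := _ - g' => rs.
  have vE : T h v = v + h%:C *: (g' + r).
    rewrite /r [g' + _]addrC subrK scalerA -rmorphM /= mulfV ?gt_eqF// scale1r.
    by rewrite addrC subrK.
  have hC := CP.1 v.
  have := projection_dist CP (T h v) hC.
  have -> : T h v = T (t + h) u by rewrite addrC (sgD T_semigroup.1).
  rewrite -/(D (t + h)) -(@ler_pXn2r _ 2)// ?nnegrE ?hnorm_ge0//.
  have -> : T (t + h) u = T h v by rewrite addrC (sgD T_semigroup.1).
  rewrite vE addrAC (sqr_hnormD_rdot _ (v - P v)) -/(D t) rdotZr rdotDr => hle.
  rewrite rdotC in hn.
  have r1 : rdot dH (v - P v) r <= D t * s.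
    by rewrite (le_trans (rdot_le_hnorm _ _ _))// ler_wpM2l ?D0// ltW.
  have r2 : NH (h%:C *: (g' + r)) ^+ 2 <= h * (s * (NH g' + 1) ^+ 2).
    rewrite hnormZ exprMn real_normK ?num_real// expr2 -mulrA ler_wpM2l//.
    apply: ler_pM => //; [exact: sqr_ge0|exact: ltW|].
    rewrite ler_pXn2r// ?nnegrE ?hnorm_ge0 ?addr_ge0 ?hnorm_ge0//.
    by rewrite (le_trans (hnormD_le _ _ _))// lerD2l (le_trans (ltW rs)).
  have r3 : h * (rdot dH (v - P v) g' + rdot dH (v - P v) r) <= h * (D t * s).
    by rewrite ler_wpM2l//; lra.
  have r4 : h * (s * B) <= h * e by rewrite ler_wpM2l.
  have r5 : 0 < h * s by rewrite mulr_gt0.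
  move: r4; rewrite /B => r4; lra.
(* If the distance increases from [t - h] to [t], its square increases by at most [x * (2 * D t)],
   where [x] is the displacement of the orbit. *)
pose q := 2 * D t + 1; have q0 : 0 < q by rewrite ltr_wpDl// mulr_ge0.
have [eta eta0 hd] := hleft t t0 ttau _ (divr_gt0 e0 q0).
exists (Num.min eta t); first by rewrite lt_min eta0.
move=> h h0; rewrite lt_min => /andP[h1 h2] _; have := hd h h0 h1 h2.
have := projection_dist_lip CP (T t u) (T (t - h) u).
rewrite (hnormBC _ (T t u) (T _ u)) -/(D t) -/(D _).
set x := NH _ => l1; rewrite ltr_pdivlMr// => l2.
have [l3|l3] := leP (D t) (D (t - h)).
  apply: (@le_trans _ _ (D (t - h) ^+ 2)); last by rewrite lerDl ltW.
  by rewrite ler_pXn2r// nnegrE.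
have x0 : 0 <= x by exact: hnorm_ge0.
have l4 : (D t - D (t - h)) * (D t + D (t - h)) <= x * q.
  apply: ler_pM; [lra|by rewrite addr_ge0|lra|by rewrite /q; lra].
have l5 : (D t - D (t - h)) * (D t + D (t - h)) = D t ^+ 2 - D (t - h) ^+ 2 by ring.
lra.
Qed.

(** For [C] reduced to 0 the distance is the norm, and the generator inequality is accretivity. The
    left control of orbits in D(A) restricts this to short times; density and the semigroup law
    remove the restrictions. *)
Lemma semigroup_contractive : contractive dH T.
Proof.
have CP : projection_on dH (fun u => u = 0) (fun=> 0).
  by split=> // u q ->; rewrite subrr rdot0l.
have hP w g : form_op dH j a w g -> rdot dH g (w - 0) <= 0.
  move=> /form_opE[v <- h]; rewrite subr0; have := a_accretive v.
  by rewrite h oppr_ge0.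
have [d d0 hd] := semigroup_left_cvg.
have small (t : R) u : 0 <= t -> t < d -> NH (T t u) <= NH u.
  move=> t0 td; have [M M0 hM] := semigroup_bounded t0.
  apply/ler_addgt0Pr => e e0; have M1 : 0 < M + 1 by rewrite ltr_wpDl.
  have [w [g [wg wu]]] := form_op_dense u (divr_gt0 e0 M1).
  have := @orbit_dist_le _ _ w g t CP hP wg t0; rewrite !subr0.
  have hl (s : R) : 0 < s -> s <= t -> forall e : R, 0 < e ->
      exists2 eta : R, 0 < eta & forall h : R, 0 < h -> h < eta -> h < s ->
        NH (T (s - h) w - T s w) < e.
    by move=> s0 st; apply: (hd w g wg s s0); exact: le_lt_trans st td.
  move=> /(_ hl) h1; have := hnorm_le_dist dH (T t u) (T t w).
  rewrite -semigroupB// => h2; have := hM (u - w); rewrite (hnormBC _ u).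
  have := hnorm_le_dist dH w u; move: wu; rewrite ltr_pdivlMr// mulrDr mulr1 => h3 h4 h5.
  lra.
(* A time below [n.+1%:R * d] is cut into [n.+1] equal steps, each shorter than [d]. *)
have big n (t : R) u : 0 <= t -> t < n%:R * d -> NH (T t u) <= NH u.
  elim: n t u => [t u t0|n IH t u t0 tn]; first by rewrite mul0r ltNge t0.
  have n0 : (0 : R) < n.+1%:R by [].
  have e1 : t = t / n.+1%:R + n%:R * (t / n.+1%:R).
    by rewrite -[X in X + _]mul1r -mulrDl -natr1 [1 + _]addrC natr1 mulrC divfK ?gt_eqF.
  have s0 : 0 <= t / n.+1%:R by rewrite divr_ge0.
  have sd : t / n.+1%:R < d by rewrite ltr_pdivrMr// mulrC.
  rewrite e1 (sgD T_semigroup.1) ?mulr_ge0//; apply: le_trans (small _ _ s0 sd) _.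
  case: n IH {tn n0 e1} s0 sd => [|n] IH s0 sd.
    by rewrite mul0r (sg0 T_semigroup.1).
  by apply: IH; [rewrite mulr_ge0|rewrite ltr_pM2l].
move=> t u t0; apply: (big (Num.truncn (t / d)).+1) => //.
by rewrite -ltr_pdivrMr// truncnS_gt.
Qed.

Lemma orbit_left_cvg (t : R) u (e : R) : 0 < t -> 0 < e ->
  exists2 eta : R, 0 < eta & forall h : R, 0 < h -> h < eta -> h < t ->
    NH (T (t - h) u - T t u) < e.
Proof.
move=> t0 /(semigroup_cvg u)[d d0 hd]; exists d => // h h0 hd' ht.
have th : 0 <= t - h by rewrite subr_ge0 ltW.
have -> : T t u = T (t - h) (T h u) by rewrite -(sgD T_semigroup.1) ?(ltW h0)// subrK.
rewrite hnormBC -semigroupB//; apply: le_lt_trans (semigroup_contractive _ th) _.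
exact: hd.
Qed.

(** * Invariance in terms of the generator and of the form *)

Section criterion.
Variables (C : H -> Prop) (P : H -> H) (CP : projection_on dH C P).

(** For necessity, put y = w - P w and write [T h w - w] as [(T h w - T h (P w)) + (T h (P w) - P w)
    - y]. Against y, the first term contributes at most the squared norm of y by contractivity and
    the second at most 0 because [T h (P w)] lies in [C]; the third cancels the first. Sufficiency
    follows from [orbit_dist_le] by density of D(A). *)
Lemma preserves_generator : preserves C T <->
  forall w g, form_op dH j a w g -> rdot dH g (w - P w) <= 0.
Proof.
split=> [inv w g wg|hP t u t0 Cu].
  rewrite leNgt; apply/negP => r0.
  set y := w - P w in r0; set r := rdot dH g y in r0.
  have y1 : 0 < NH y + 1 by rewrite ltr_wpDl ?hnorm_ge0.
  have [d d0 hd] := semigroup_diff wg (divr_gt0 r0 y1).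
  pose h := d / 2; have h0 : 0 < h by rewrite divr_gt0.
  have hd' : h < d by rewrite /h; lra.
  have := hd h h0 hd'; rewrite ltr_pdivlMr//; set z := _ - g => hz.
  have TE : T h w - w = h%:C *: (g + z).
    by rewrite /z [g + _]addrC subrK scalerA -rmorphM /= mulfV ?gt_eqF// scale1r.
  have h1 : rdot dH (T h w - T h (P w)) y <= NH y ^+ 2.
    rewrite -semigroupB ?(ltW h0)// (le_trans (rdot_le_hnorm _ _ _))// expr2.
    by rewrite ler_wpM2r ?hnorm_ge0// semigroup_contractive// ltW.
  have h2 := CP.2 w _ (inv h _ (ltW h0) (CP.1 w)).
  have h3 : rdot dH (T h w - w) y <= 0.
    have -> : T h w - w = (T h w - T h (P w)) + (T h (P w) - P w) - y.
      by rewrite /y subrKA opprB addrA subrK.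
    by rewrite rdotBl (rdotDl _ (T h w - T h (P w))) rdotuu; rewrite -/y in h2; lra.
  move: h3; rewrite TE rdotZl pmulr_rle0// rdotDl -/r.
  have := normr_rdot_le dH z y; rewrite ler_norml => /andP[h4 _].
  by have := hnorm_ge0 dH z; lra.
apply: (projection_in CP); apply/ler_addgt0Pr => e e0; rewrite add0r.
have e2 : 0 < e / 2 by rewrite divr_gt0.
have [w [g [wg wu]]] := form_op_dense u e2.
have h1 := orbit_dist_le CP hP wg t0 (fun s s0 _ e e0 => orbit_left_cvg w s0 e0).
have h2 := projection_dist_lip CP (T t u) (T t w).
have h3 := projection_dist_lip CP w u.
rewrite (projection_id CP Cu) subrr hnorm0 addr0 in h3.
have h4 := semigroup_contractive (u - w) t0; rewrite semigroupB// (hnormBC _ u) in h4.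
lra.
Qed.

(* Ouhabaz' criterion. Necessity: for f = P (j u), the resolvent approximations w of f stay in C,
   which gives Re a(w, w - u) <= 0; hence they are bounded in V, so f lies in V, and passing to
   the limit gives the inequality. *)
Lemma preserves_form : preserves C T <->
  forall u, exists2 p, j p = P (j u) & 0 <= Re (a p (u - p)).
Proof.
rewrite preserves_generator; split=> [hgen u|hform w g /form_opE[u <- h]]; last first.
  have [p pE hp] := hform u; rewrite -pE -raddfB -oppr_ge0 -h.
  have := a_accretive (u - p); rewrite Re_formBl; lra.
have [lam0 hex] := resolvent_ex.
have [K K0 [lam1 hK]] := resolvent_estimate.
pose f := P (j u).
have Cf : C f by exact: CP.1.
(* The squared distance of [j w] to [C] is the sum of two inner products, nonpositive by the
   generator inequality and by the projection property at [f]. *)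
have resC lam w : 0 < lam -> form_op dH j a (j w) (lam%:C *: (j w - f)) -> C (j w).
  move=> lamp /hgen; rewrite rdotZl pmulr_rle0// => h1.
  have h2 := CP.2 (j w) f Cf; apply: (projection_in CP).
  suff : NH (j w - P (j w)) ^+ 2 <= 0.
    by move=> h3; rewrite -(@ler_pXn2r _ 2)// ?nnegrE ?hnorm_ge0// expr0n.
  have -> : NH (j w - P (j w)) ^+ 2 =
      rdot dH (j w - f) (j w - P (j w)) + rdot dH (f - P (j w)) (j w - P (j w)).
    by rewrite -rdotDl subrKA rdotuu.
  lra.
(* The resolvent equation turns the left side into [lam] times an inner product, and [j w] is a
   competitor in [C] for the projection [f] of [j u]. *)
have res_le lam w : 0 < lam -> form_op dH j a (j w) (lam%:C *: (j w - f)) ->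
    Re (a w (w - u)) <= 0.
  move=> lamp hw; rewrite (resolvent_form _ hw) pmulr_rle0//.
  have := CP.2 (j u) (j w) (resC _ _ lamp hw); rewrite -/f => h1.
  rewrite raddfB (_ : j w - j u = (j w - f) - (j u - f)); last by rewrite opprB subrKA.
  rewrite rdotBr -(opprB (j w) f) !rdotNl rdotuu.
  by have := sqr_ge0 (NH (j w - f)); lra.
have [p pf] : exists p, j p = f.
  have [M M0 hM] := Re_form_bound; have [alpha [omega [alpha0 omega0 hE]]] := form_garding.
  (* Garding's inequality and [res_le] give [alpha * N w ^+ 2 <= M * N w * N u + omega * y ^+ 2].
     When [1 < N w] this may be divided by [N w]; the summand 1 covers the other case. *)
  pose y := NH f + 1; pose B := 1 + (M * N u + omega * y ^+ 2) / alpha.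
  have y0 : 0 <= y by rewrite addr_ge0 ?hnorm_ge0.
  have q0 : 0 <= M * N u + omega * y ^+ 2.
    by rewrite addr_ge0 ?mulr_ge0 ?hnorm_ge0 ?sqr_ge0.
  apply: (@form_ball_closed _ B) => e e0.
  have e1 : 0 < Num.min e 1 by rewrite lt_min e0 ltr01.
  have [lam2 h2] := resolvent_cvg f e1.
  have [lam [l0 _ l2 lp]] := exists_gt3 lam0 lam0 lam2.
  have [w hw] := hex lam l0 f; have := h2 lam l2 w hw; rewrite lt_min => /andP[we w1].
  exists w; last exact: ltW.
  have := res_le _ _ lp hw; rewrite Re_formB => h3.
  have := hM w u; rewrite ler_norml => /andP[_ h4].
  have h5 : NH (j w) <= y by have := hnorm_le_dist dH (j w) f; rewrite /y; lra.
  have h6 : omega * NH (j w) ^+ 2 <= omega * y ^+ 2.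
    by rewrite ler_wpM2l// ler_pXn2r// nnegrE hnorm_ge0.
  have [h7|h7] := leP (N w) 1; first by rewrite (le_trans h7)// lerDl divr_ge0 ?(ltW alpha0).
  have w0 : 0 < N w by apply: lt_trans h7.
  apply: (@le_trans _ _ ((M * N u + omega * y ^+ 2) / alpha)); last by rewrite lerDr.
  rewrite ler_pdivlMr// mulrC -(ler_pM2r w0) -mulrA -expr2.
  have := hE w; have h8 : 0 <= omega * y ^+ 2 by rewrite mulr_ge0 ?sqr_ge0.
  have : omega * y ^+ 2 <= omega * y ^+ 2 * N w by rewrite ler_peMr// ltW.
  by rewrite [(_ + _) * N w]mulrDl; lra.
exists p => //; rewrite -(opprB p) (real_linearN (Re_formPr p)) oppr_ge0.
apply/ler_addgt0Pr => e e0; rewrite add0r.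
(* Expanding [Re (a w (w - u)) <= 0] at [w = p + v] and dropping the nonnegative [Re (a v v)] leaves
   [Re (a p (p - u)) <= F v], which is linear in [v]; weak convergence therefore suffices. *)
pose F v := - Re (a p v) - Re (a v (p - u)).
have lF : real_linear F by move=> r v v'; rewrite /F Re_formPr Re_formPl; ring.
have [M M0 hM] := Re_form_bound.
have bF : bounded_functional dV F.
  exists (M * N p + M * N (p - u)) => v; rewrite (le_trans (ler_normB _ _))//.
  rewrite normrN mulrDl lerD// (le_trans (hM _ _))//.
  by rewrite -!mulrA [N v * _]mulrC.
have [d d0 hd] := form_weak_cvg0 (K * N p) lF bF e0.
have [lam2 h2] := resolvent_cvg f d0.
have [lam [l0 l1 l2 lp]] := exists_gt3 lam0 lam1 lam2.
have [w hw] := hex lam l0 f.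
(* Now that [f] is the image of [p], [resolvent_estimate] bounds [w - p] in V uniformly in [lam]. *)
have := res_le _ _ lp hw; have hwp := hw; rewrite -pf in hwp.
have [h3 _] := hK _ l1 _ _ hwp.
have jwp : j (w - p) = j w - f by rewrite linearB /= pf.
have := hd (w - p) h3; rewrite jwp => /(_ (ltW (h2 _ l2 _ hw))).
have := a_accretive (w - p).
rewrite /F !Re_formB !Re_formBl; lra.
Qed.

End criterion.

End semigroup.

End form_theory.

(** * Hilbert sums *)

Section finite_sums.
Context {R : realType} {I : choiceType} (F : I -> R).
Hypothesis F0 : forall i, 0 <= F i.

Lemma sum_le_subset (s0 s : seq I) : uniq s0 -> uniq s -> {subset s0 <= s} ->
  \sum_(i <- s0) F i <= \sum_(i <- s) F i.
Proof.
move=> us0 us s0s; rewrite [leRHS](bigID [in s0])/= -[X in _ <= X + _]big_filter.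
have -> : \sum_(i <- [seq i <- s | i \in s0]) F i = \sum_(i <- s0) F i.
  apply: perm_big; apply: uniq_perm; rewrite ?filter_uniq// => i.
  by rewrite mem_filter andb_idr//; exact: s0s.
by rewrite lerDl sumr_ge0.
Qed.

Lemma finite_set_seq (A : set I) : finite_set A -> exists2 s, uniq s & A = [set` s].
Proof.
move=> /finite_seqP[s ->]; exists (undup s); first exact: undup_uniq.
by apply/seteqP; split=> i /=; rewrite mem_undup.
Qed.

Lemma esum_le_seq (D : set I) (K : R) :
  (forall s, uniq s -> [set` s] `<=` D -> \sum_(i <- s) F i <= K) ->
  (\esum_(i in D) (F i)%:E <= K%:E)%E.
Proof.
move=> h; apply: ge_ereal_sup => _ [A [/finite_set_seq[s us ->] sD]] <-.
by rewrite -fsbig_seq// sumEFin lee_fin h.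
Qed.

Lemma lt_esum_seq (K : R) : (K%:E < \esum_(i in [set: I]) (F i)%:E)%E ->
  exists2 s, uniq s & K < \sum_(i <- s) F i.
Proof.
move=> /ereal_sup_gt[_ [A [/finite_set_seq[s us ->] _]] <-] h.
by exists s => //; move: h; rewrite -fsbig_seq// sumEFin lte_fin.
Qed.

End finite_sums.

Lemma form_approx_ge0 {R : realType} {V : lmodType R[i]} (dV : {dot V for Num.conj})
    (a : {bilinear V -> V -> R[i] | *%R & Num.conj \; *%R}) x y :
  form_continuous dV a ->
  (forall d : R, 0 < d -> exists x' y', [/\ hnorm dV (x - x') < d,
     hnorm dV (y - y') < d & 0 <= Re (a x' y')]) -> 0 <= Re (a x y).
Proof.
move=> a_continuous h; rewrite -oppr_le0; apply/ler_addgt0Pr => e e0; rewrite add0r.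
have [M M0 hM] := Re_form_bound a_continuous.
(* Replacing [x], [y] by [x'], [y'] changes the real part by at most [M * d * hnorm dV y + M *
   (hnorm dV x + 1) * d]. *)
pose B := M * (hnorm dV x + hnorm dV y + 1) + 1.
have [x0 y0] := (hnorm_ge0 dV x, hnorm_ge0 dV y).
have B0 : 0 < B by rewrite ltr_wpDl// mulr_ge0// !addr_ge0.
pose d := Num.min 1 (e / B).
have d0 : 0 < d by rewrite lt_min ltr01 divr_gt0.
have d1 : d <= 1 by rewrite ge_min lexx.
have dB : d * B <= e by rewrite -ler_pdivlMr// ge_min lexx orbT.
have [x' [y' [h1 h2 h3]]] := h d d0.
have h4 : hnorm dV x' <= hnorm dV x + 1.
  by have := hnorm_le_dist dV x' x; rewrite hnormBC; lra.
have := hM (x - x') y; have := hM x' (y - y').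
rewrite !ler_norml Re_formB Re_formBl => /andP[h5 _] /andP[h6 _].
have h7 : M * hnorm dV x' * hnorm dV (y - y') <= M * (hnorm dV x + 1) * d.
  by apply: ler_pM; rewrite ?mulr_ge0 ?hnorm_ge0 ?ler_wpM2l ?(ltW h2).
have h8 : M * hnorm dV (x - x') * hnorm dV y <= M * d * hnorm dV y.
  by rewrite ler_wpM2r ?ler_wpM2l ?(ltW h1).
by move: dB; rewrite /B; lra.
Qed.

(** * Completeness, truncation and finite double sums *)

Section hilbert_sum_theory.
Context {R : realType} {I : choiceType} {E : I -> lmodType R[i]}.
Variable dE : forall i, {dot E i for Num.conj}.
Implicit Types (x y : hsum dE) (i k : I).
Local Notation N := (hnorm (hsum_dot dE)).

Lemma sqr_hnorm_hsumE x :
  (N x ^+ 2)%:E = (\esum_(i in [set: I]) (hnorm (dE i) (x i) ^+ 2)%:E)%E.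
Proof.
have -> : N x ^+ 2 = Re (hsum_dot dE x x) by exact: sqr_hnorm.
rewrite hsum_dotuu; apply: rsum_ge0E; first by have /sq_summableE := hsumP x.
by move=> i; exact: sqr_ge0.
Qed.

Lemma hnorm_component_le x i : hnorm (dE i) (x i) <= N x.
Proof.
rewrite -(@ler_pXn2r _ 2)// ?nnegrE ?hnorm_ge0// -lee_fin sqr_hnorm_hsumE.
apply: esum_ge; exists [set i]; last by rewrite fsbig_set1.
by split => //; exact: finite_set1.
Qed.

Lemma sum_hnorm_le x (s : seq I) : uniq s ->
  \sum_(i <- s) hnorm (dE i) (x i) ^+ 2 <= N x ^+ 2.
Proof.
move=> us; rewrite -lee_fin sqr_hnorm_hsumE -sumEFin.
apply: esum_ge; exists [set` s]; first by split=> //; exact: finite_seq.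
by rewrite fsbig_seq.
Qed.

Lemma sq_summable_le x (z : forall i, E i) (K : R) :
  (forall i, hnorm (dE i) (z i) <= K * hnorm (dE i) (x i)) -> sq_summable dE z.
Proof.
move=> zx; apply/sq_summableE; have /sq_summableE := hsumP x.
move=> /(rsummableZ (K ^+ 2)) sx; apply: rsummable_le sx _ => i.
rewrite ger0_norm ?sqr_ge0// -exprMn ler_sqr ?nnegrE ?hnorm_ge0//.
exact: le_trans (hnorm_ge0 _ _) (zx _).
Qed.

Lemma hsum_singleE i (u : E i) : hsum_single dE u i = u.
Proof. by rewrite /= dfwithin. Qed.

Lemma hsum_single_neq i k (u : E i) : i != k -> hsum_single dE u k = 0.
Proof. by move=> ik; rewrite /= dfwithout. Qed.

Lemma hsum_single_linear i : linear (@hsum_single _ _ _ dE i).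
Proof.
move=> r u v; apply: hsum_ext => k.
have [<-|ik] := eqVneq i k.
  by rewrite hsum_singleE -[RHS]/(r *: hsum_single dE u i + hsum_single dE v i) !hsum_singleE.
rewrite hsum_single_neq// -[RHS]/(r *: hsum_single dE u k + hsum_single dE v k).
by rewrite !hsum_single_neq// scaler0 addr0.
Qed.
HB.instance Definition _ i := GRing.isLinear.Build R[i] (E i) (hsum dE) _
  (@hsum_single _ _ _ dE i) (@hsum_single_linear i).

Lemma hnorm_single i (u : E i) : N (hsum_single dE u) = hnorm (dE i) u.
Proof.
apply/eqP; rewrite -(@eqrXn2 _ 2)// ?hnorm_ge0//; apply/eqP/EFin_inj.
rewrite sqr_hnorm_hsumE (esumID [set i]); last by move=> k _; rewrite lee_fin sqr_ge0.
rewrite setIidr//= esum_set1 ?lee_fin ?sqr_ge0// dfwithin [X in (_ + X)%E](_ : _ = 0%E) ?adde0//.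
rewrite esum1// => k [_ /eqP ki].
by rewrite dfwithout 1?eq_sym// hnorm0 expr0n.
Qed.

Lemma hsum_complete : (forall i, complete_dot (dE i)) -> complete_dot (hsum_dot dE).
Proof.
move=> cE u cu.
have hl i : exists l, hnorm (dE i) (u n i - l) @[n --> \oo] --> (0 : R).
  apply: cE => e /cu[M hM]; exists M => m n Mm Mn.
  by apply: le_lt_trans (hM m n Mm Mn); exact: (hnorm_component_le (u m - u n)).
have {hl}[l hl] : exists l : forall i, E i,
    forall i, hnorm (dE i) (u n i - l i) @[n --> \oo] --> (0 : R).
  have h i : {l | hnorm (dE i) (u n i - l) @[n --> \oo] --> (0 : R)} by exact: cid.
  by exists (fun i => projT1 (h i)) => i; exact: projT2 (h i).
have fin (s : seq I) (e : R) : 0 < e -> exists M, forall m, (M <= m)%N ->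
    \sum_(i <- s) hnorm (dE i) (u m i - l i) ^+ 2 <= e.
  elim: s e => [|i s IH] e e0.
    by exists 0%N => m _; rewrite big_nil ltW.
  have e2 : 0 < e / 2 by rewrite divr_gt0.
  have [M1 hM1] := IH _ e2.
  have e1 : 0 < Num.min 1 (e / 2) by rewrite lt_min ltr01.
  have /cvgrPdist_lt/(_ _ e1)[M2 _ hM2] := hl i.
  exists (maxn M1 M2) => m; rewrite geq_max => /andP[m1 m2].
  rewrite big_cons [e]splitr lerD ?hM1//.
  have := hM2 m m2; rewrite sub0r normrN ger0_norm ?hnorm_ge0// lt_min => /andP[h1 h2].
  rewrite (le_trans _ (ltW h2))// expr2 ler_piMl ?hnorm_ge0//; exact: ltW.
have tail (e : R) : 0 < e -> exists M, forall n, (M <= n)%N ->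
    (\esum_(i in [set: I]) (hnorm (dE i) (u n i - l i) ^+ 2)%:E <= (4 * e ^+ 2)%:E)%E.
  move=> e0; have [M hM] := cu _ e0; exists M => n Mn.
  apply: esum_le_seq => s us _.
  (* The comparison index [m] depends on the finite set [s], but the resulting bound does not, and
     so it passes to the infinite sum. *)
  have [M' hM'] := fin s (e ^+ 2) (exprn_gt0 _ e0).
  pose m := maxn M M'.
  apply: (@le_trans _ _ (\sum_(i <- s) (2 * hnorm (dE i) ((u n - u m) i) ^+ 2
      + 2 * hnorm (dE i) (u m i - l i) ^+ 2))).
    apply: ler_sum => i _; rewrite -[u n i - l i](subrKA (u m i)).
    exact: sqr_hnormD_le.
  rewrite big_split/= -!mulr_sumr.
  have h1 := sum_hnorm_le (u n - u m) us.
  have h2 : N (u n - u m) ^+ 2 <= e ^+ 2.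
    rewrite ler_pXn2r// ?nnegrE ?hnorm_ge0 ?(ltW e0)//; apply/ltW/hM => //.
    exact: leq_maxl.
  have := hM' m (leq_maxr _ _); lra.
have sl : sq_summable dE l.
  have [M /(_ M (leqnn M)) hM] := tail 1 ltr01.
  have sM : sq_summable dE (fun i => u M i - l i).
    by apply: le_lt_trans hM _; rewrite ltry.
  have := sq_summableD (hsumP (u M)) (sq_summableN sM).
  congr sq_summable; apply: functional_extensionality_dep => i.
  by rewrite opprB addrC subrK.
exists (HSum sl); apply/cvgrPdist_lt => e e0.
have e4 : 0 < e / 4 by rewrite divr_gt0.
have [M hM] := tail _ e4; exists M => // n /hM.
rewrite -[X in (X <= _)%E](sqr_hnorm_hsumE (u n - HSum sl)) lee_fin => h.
rewrite sub0r normrN ger0_norm ?hnorm_ge0// -(@ltr_pXn2r _ 2)// ?nnegrE ?hnorm_ge0 ?(ltW e0)//.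
by apply: le_lt_trans h _; have := exprn_gt0 2 e0; lra.
Qed.

Definition hsum_trunc (s : seq I) x : hsum dE := \sum_(i <- s) hsum_single dE (x i).

Lemma hsum_truncE s x k : uniq s -> hsum_trunc s x k = if k \in s then x k else 0.
Proof.
rewrite /hsum_trunc; elim: s => [|i s IH]; first by rewrite big_nil.
move=> /= /andP[si us]; rewrite big_cons.
rewrite -[LHS]/(hsum_single dE (x i) k + (\sum_(i <- s) hsum_single dE (x i)) k) IH//.
rewrite in_cons; have [->|ki] := eqVneq k i.
  by rewrite (negPf si) addr0 hsum_singleE.
by rewrite hsum_single_neq 1?eq_sym// add0r.
Qed.

Lemma hsum_trunc_cvg x (e : R) : 0 < e ->
  exists s0 : seq I, forall s, uniq s -> {subset s0 <= s} -> N (x - hsum_trunc s x) < e.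
Proof.
move=> e0; have e2 : 0 < e ^+ 2 by rewrite exprn_gt0.
have [s0 us0 hs0] : exists2 s0, uniq s0 &
    N x ^+ 2 - e ^+ 2 < \sum_(i <- s0) hnorm (dE i) (x i) ^+ 2.
  by apply: lt_esum_seq; rewrite -sqr_hnorm_hsumE lte_fin; lra.
exists s0 => s us s0s.
rewrite -(@ltr_pXn2r _ 2)// ?nnegrE ?hnorm_ge0 ?(ltW e0)// -lte_fin sqr_hnorm_hsumE.
have tE i : (x - hsum_trunc s x) i = if i \in s then 0 else x i.
  rewrite -[LHS]/(x i - hsum_trunc s x i) hsum_truncE//.
  by case: ifP => _; rewrite ?subrr ?subr0.
rewrite (esumID [set` s]); last by move=> k _; rewrite lee_fin sqr_ge0.
rewrite esum1 ?add0e; last first.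
  by move=> i [_ si]; rewrite tE [i \in s]si hnorm0 expr0n.
rewrite (eq_esum (b := fun i => (hnorm (dE i) (x i) ^+ 2)%:E)); last first.
  by move=> i [_ /negP/negPf si]; rewrite tE [i \in s]si.
have := sqr_hnorm_hsumE x; rewrite (esumID [set` s]); last first.
  by move=> k _; rewrite lee_fin sqr_ge0.
rewrite !setTI esum_fset; last 2 first.
- exact: finite_seq.
- by move=> i _; rewrite lee_fin sqr_ge0.
rewrite -fsbig_seq// sumEFin.
have h1 : N x ^+ 2 - e ^+ 2 < \sum_(i <- s) hnorm (dE i) (x i) ^+ 2.
  by apply: lt_le_trans hs0 _; apply: sum_le_subset => // i; exact: sqr_ge0.
case: (\esum_(i in _) _)%E => [r| |] //.
  by rewrite -EFinD lte_fin => -[hr]; lra.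
Qed.

Variable a : {bilinear hsum dE -> hsum dE -> R[i] | *%R & Num.conj \; *%R}.

Lemma form_comp_bilinear i k : bilinear_for *%R (Num.conj \; *%R) (@form_comp _ _ _ _ a i k).
Proof.
by split=> w r u v; rewrite /form_comp linearP ?linearPl ?linearPr.
Qed.
HB.instance Definition _ i k := bilinear_isBilinear.Build R[i] (E k) (E i) R[i]
  *%R (Num.conj \; *%R) (@form_comp _ _ _ _ a i k) (form_comp_bilinear i k).


Hypothesis a_continuous : form_continuous (hsum_dot dE) a.

Lemma form_continuous_comp i : form_continuous (dE i) (@form_comp _ _ _ _ a i i).
Proof.
by have [M hM] := a_continuous; exists M => u v; rewrite -!hnorm_single; exact: hM.
Qed.

Lemma form_accretive_comp i : form_accretive a -> form_accretive (@form_comp _ _ _ _ a i i).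
Proof. by move=> h u; exact: h. Qed.

Lemma real_linear_sum {W : lmodType R[i]} (f : W -> R) (s : seq I) (w : I -> W) :
  real_linear f -> f (\sum_(i <- s) w i) = \sum_(i <- s) f (w i).
Proof.
move=> lf; elim: s => [|i s IH]; first by rewrite !big_nil real_linear0.
by rewrite !big_cons real_linearD// IH.
Qed.

Lemma form_truncE s x y : Re (a (hsum_trunc s x) (hsum_trunc s y)) =
  \sum_(i <- s) \sum_(k <- s) Re (form_comp a (x k) (y i)).
Proof.
rewrite (real_linear_sum _ _ (Re_formPr a _)); apply: eq_bigr => i _.
by rewrite (real_linear_sum _ _ (Re_formPl a _)).
Qed.

Lemma form_comp_ge0 x y :
  (forall s, uniq s -> 0 <= \sum_(i <- s) \sum_(k <- s) Re (form_comp a (x k) (y i))) ->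
  0 <= Re (a x y).
Proof.
move=> h; apply: (form_approx_ge0 a_continuous) => d d0.
have [s1 h1] := hsum_trunc_cvg x d0; have [s2 h2] := hsum_trunc_cvg y d0.
(* Both arguments are truncated to the same finite set, so that the double sum is square and its
   diagonal is available. *)
have us : uniq (undup (s1 ++ s2)) by exact: undup_uniq.
exists (hsum_trunc (undup (s1 ++ s2)) x), (hsum_trunc (undup (s1 ++ s2)) y).
split; last by rewrite form_truncE h.
- by apply: h1 => // i si; rewrite mem_undup mem_cat si.
- by apply: h2 => // i si; rewrite mem_undup mem_cat si orbT.
Qed.

End hilbert_sum_theory.

Lemma projection_norm {R : realType} {H : lmodType R[i]} (dH : {dot H for Num.conj}) C P u :
  projection_on dH C P -> C 0 -> hnorm dH (P u) <= hnorm dH u.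
Proof.
move=> CP C0; have := CP.2 u 0 C0; rewrite sub0r rdotNl rdotBr rdotuu oppr_le0 => h.
have [->|n0] := eqVneq (hnorm dH (P u)) 0; first exact: hnorm_ge0.
have np : 0 < hnorm dH (P u) by rewrite lt_neqAle eq_sym n0 hnorm_ge0.
rewrite -(ler_pM2l np) -expr2; have := rdot_le_hnorm dH (P u) u; lra.
Qed.

Lemma rdot_hsum_le0 {R : realType} {I : choiceType} {E : I -> lmodType R[i]}
    (dE : forall i, {dot E i for Num.conj}) (x y : hsum dE) :
  (forall i, rdot (dE i) (x i) (y i) <= 0) -> rdot (hsum_dot dE) x y <= 0.
Proof.
move=> h; rewrite /rdot /= /hsum_dot /csum /=.
have [sr _] := csummable_dot x y.
rewrite -[rsum _]opprK oppr_le0 -mulN1r -rsumZ// -lee_fin rsum_ge0E.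
- by apply: esum_ge0 => i _; rewrite lee_fin mulN1r oppr_ge0 h.
- exact: rsummableZ.
- by move=> i; rewrite mulN1r oppr_ge0 h.
Qed.

(** * Forms on Hilbert sums and componentwise projections *)

Section hilbert_sum_form.
Context {R : realType} {I : choiceType} {V H : I -> lmodType R[i]}.
Variables (dV : forall i, {dot V i for Num.conj}) (dH : forall i, {dot H i for Num.conj}).
Variables (j : forall i, {linear V i -> H i}) (c : R).
Hypothesis jc : forall i (u : V i), hnorm (dH i) (j i u) <= c * hnorm (dV i) u.
Hypothesis V_complete : forall i, complete_dot (dV i).
Hypothesis j_inj : forall i, injective (j i).
Hypothesis j_dense : forall i, dense_range (dH i) (j i).
Local Notation N := (hnorm (hsum_dot dV)).
Local Notation NH := (hnorm (hsum_dot dH)).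
Local Notation jj := (hsum_map jc).

Lemma hsum_map_single i (u : V i) : jj (hsum_single dV u) = hsum_single dH (j i u).
Proof.
apply: hsum_ext => k; rewrite /hsum_map /=.
have [<-|ik] := eqVneq i k; first by rewrite !dfwithin.
by rewrite !dfwithout// raddf0.
Qed.

Lemma hsum_mapE (x : hsum dV) i : jj x i = j i (x i).
Proof. by []. Qed.

Lemma hsum_map_bounded (x : hsum dV) : NH (jj x) <= `|c| * N x.
Proof.
have c0 : 0 <= c ^+ 2 by exact: sqr_ge0.
rewrite -(@ler_pXn2r _ 2)// ?nnegrE ?mulr_ge0 ?hnorm_ge0// exprMn real_normK ?num_real//.
rewrite -lee_fin sqr_hnorm_hsumE.
apply: esum_le_seq => s us _.
apply: (@le_trans _ _ (c ^+ 2 * \sum_(i <- s) hnorm (dV i) (x i) ^+ 2)); last first.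
  by rewrite ler_wpM2l// sum_hnorm_le.
rewrite mulr_sumr; apply: ler_sum => i _; rewrite hsum_mapE -exprMn.
rewrite ler_pXn2r// ?nnegrE ?hnorm_ge0//.
exact: le_trans (hnorm_ge0 _ _) (jc (x i)).
Qed.

Lemma hsum_map_inj : injective jj.
Proof.
move=> x y xy; apply: hsum_ext => i; apply: j_inj.
by have := congr1 (fun z : hsum dH => z i) xy.
Qed.

Lemma hnorm_sum_le {E : lmodType R[i]} (dE : {dot E for Num.conj}) (s : seq I) (f : I -> E) :
  hnorm dE (\sum_(i <- s) f i) <= \sum_(i <- s) hnorm dE (f i).
Proof.
elim: s => [|i s IH]; first by rewrite !big_nil hnorm0.
by rewrite !big_cons (le_trans (hnormD_le _ _ _))// lerD2l.
Qed.

Lemma hsum_map_dense : dense_range (hsum_dot dH) jj.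
Proof.
move=> x e e0; have e2 : 0 < e / 2 by rewrite divr_gt0.
have [s hs] := hsum_trunc_cvg x e2.
pose t := undup s; have ut : uniq t by exact: undup_uniq.
have {}hs : NH (x - hsum_trunc t x) < e / 2.
  by apply: hs => // i; rewrite mem_undup.
(* Half of the error is spent on truncation; the other half is shared by the components in [t], and
   the added 1 covers an empty [t]. *)
pose d := e / 2 / ((size t)%:R + 1).
have q0 : 0 < (size t)%:R + 1 :> R by rewrite ltr_wpDl.
have d0 : 0 < d by rewrite divr_gt0.
have [v hv] : exists v : forall i, V i, forall i, hnorm (dH i) (x i - j i (v i)) < d.
  have h i : {v | hnorm (dH i) (x i - j i v) < d} by apply: cid; exact: j_dense.
  by exists (fun i => projT1 (h i)) => i; exact: projT2 (h i).
exists (\sum_(i <- t) hsum_single dV (v i)).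
apply: (le_lt_trans (hnorm_tri _ (hsum_trunc t x) _ _)).
rewrite [e]splitr ltr_leD// /hsum_trunc.
have -> : jj (\sum_(i <- t) hsum_single dV (v i)) = \sum_(i <- t) hsum_single dH (j i (v i)).
  by rewrite raddf_sum; apply: eq_bigr => i _; exact: hsum_map_single.
rewrite -sumrB (le_trans (hnorm_sum_le _ _ _))//.
apply: (@le_trans _ _ (\sum_(i <- t) d)).
  apply: ler_sum => i _; rewrite -linearB hnorm_single; exact/ltW.
rewrite big_const_seq count_predT iter_addr addr0 -[d *+ _]mulr_natr /d.
by rewrite mulrAC ler_pdivrMr// ler_pM2l// lerDl.
Qed.

Variable a : {bilinear hsum dV -> hsum dV -> R[i] | *%R & Num.conj \; *%R}.
Hypothesis a_continuous : form_continuous (hsum_dot dV) a.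
Hypothesis a_elliptic : form_elliptic (hsum_dot dH) (hsum_dot dV) jj a.
Hypothesis a_accretive : form_accretive a.

Lemma form_elliptic_comp i : form_elliptic (dH i) (dV i) (j i) (@form_comp _ _ _ _ a i i).
Proof.
have [alpha [omega [alpha0 h]]] := a_elliptic; exists alpha, omega; split=> // u.
by have := h (hsum_single dV u); rewrite hsum_map_single !hnorm_single.
Qed.

Section projection.
Variables (C : forall i, H i -> Prop) (P : forall i, H i -> H i).
Arguments C : clear implicits.
Arguments P : clear implicits.
Hypothesis CP : forall i, projection_on (dH i) (C i) (P i).
Hypothesis C0 : forall i, C i 0.

Lemma sq_summable_proj (x : hsum dH) : sq_summable dH (fun i => P i (x i)).
Proof.
by apply: (@sq_summable_le _ _ _ _ x _ 1) => i; rewrite mul1r; apply: projection_norm (CP i) _.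
Qed.

Definition hsum_proj (x : hsum dH) : hsum dH := HSum (sq_summable_proj x).

Lemma hsum_projection : projection_on (hsum_dot dH) (fun x => forall i, C i (x i)) hsum_proj.
Proof.
split=> [u i|u q hq]; first exact: (CP i).1.
by apply: rdot_hsum_le0 => i; exact: ((CP i).2 (u i) (q i)).
Qed.

Lemma proj0 i : P i 0 = 0.
Proof. exact: (projection_id (CP i) (C0 i)). Qed.

(** The condition of [preserves_form] for the product of the sets [C i], stated componentwise. *)
Definition form_proj := forall u : hsum dV, exists2 p : hsum dV,
  (forall i, j i (p i) = P i (j i (u i))) & 0 <= Re (a p (u - p)).

Definition form_proj_comp i := forall u : V i, exists2 p : V i,
  j i p = P i (j i u) & 0 <= Re (form_comp a p (u - p)).

Lemma preserves_hsum T : form_semigroup (hsum_dot dH) jj a T ->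
  preserves (fun x : hsum dH => forall i, C i (x i)) T <-> form_proj.
Proof.
move=> Tsg.
rewrite (preserves_form (hsum_complete V_complete) hsum_map_inj hsum_map_dense
  hsum_map_bounded a_continuous a_elliptic a_accretive Tsg hsum_projection).
split=> h u; have [p pE hp] := h u; exists p => //.
  by move=> i; have := congr1 (fun z : hsum dH => z i) pE.
by apply: hsum_ext => i; exact: pE.
Qed.

Lemma preserves_component i S :
  form_semigroup (dH i) (j i) (@form_comp _ _ _ _ a i i) S ->
  preserves (C i) S <-> form_proj_comp i.
Proof.
move=> Ssg; exact (preserves_form (@V_complete i) (@j_inj i) (@j_dense i) (@jc i)
  (form_continuous_comp a_continuous i) (@form_elliptic_comp i)
  (form_accretive_comp a_accretive) Ssg (CP i)).
Qed.

(** Since each [P k] fixes 0, the projection of a vector supported in one component is supported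
    there too. *)
Lemma form_proj_component i : form_proj -> form_proj_comp i.
Proof.
move=> h u; have [p pE hp] := h (hsum_single dV u).
exists (p i); first by rewrite pE hsum_singleE.
have p_single : p = hsum_single dV (p i).
  apply: hsum_ext => k; have [<-|ik] := eqVneq i k; first by rewrite hsum_singleE.
  by apply: j_inj; rewrite pE !hsum_single_neq// raddf0 proj0.
by move: hp; rewrite {1 2}p_single -raddfB.
Qed.

Lemma form_proj_lift : (forall i, form_proj_comp i) -> forall u : hsum dV,
  exists p : hsum dV, forall i, j i (p i) = P i (j i (u i)).
Proof.
move=> h u; have [K K0 hK] := form_projection_bound hsum_map_bounded a_continuous a_elliptic.
have [p pE] : exists p : forall i, V i, forall i,
    j i (p i) = P i (j i (u i)) /\ 0 <= Re (form_comp a (p i) (u i - p i)).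
  have h' i : {p | j i p = P i (j i (u i)) /\ 0 <= Re (form_comp a p (u i - p))}.
    by apply: cid; have [p] := h i (u i); exists p.
  by exists (fun i => projT1 (h' i)) => i; exact: projT2 (h' i).
have sp : sq_summable dV p.
  apply: (@sq_summable_le _ _ _ _ u _ K) => i; have [pi hp] := pE i.
  have h1 : 0 <= Re (a (hsum_single dV (p i)) (hsum_single dV (u i) - hsum_single dV (p i))).
    by rewrite -linearB.
  have h2 : NH (jj (hsum_single dV (p i))) <= NH (jj (hsum_single dV (u i))).
    by rewrite !hsum_map_single !hnorm_single pi; apply: projection_norm (CP i) _.
  by have := hK _ _ h1 h2; rewrite !hnorm_single.
by exists (HSum sp) => i; have [] := pE i.
Qed.

End projection.

End hilbert_sum_form.

(** * Projections in L2 *)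

Lemma normc_conjE {R : realType} (z : R[i]) : normc (Num.conj z) = normc z.
Proof. by case: z => a b /=; rewrite sqrrN. Qed.

Section L2_projections.
Context d (T : measurableType d) (R : realType) (mu : {measure set T -> \bar R}).
Implicit Types u v : L2 mu.

Lemma L2BE u v : \forall x \ae mu, (u - v : L2 mu) x = u x - v x.
Proof.
rewrite -scaleN1r; apply: filterS2 (L2DE u (-1 *: v)) (L2ZE (-1) v) => x -> ->.
by rewrite mulN1r.
Qed.

Lemma L2NE u : \forall x \ae mu, (- u : L2 mu) x = - u x.
Proof. by rewrite -scaleN1r; apply: filterS (L2ZE (-1) u) => x ->; rewrite mulN1r. Qed.

Lemma rdot_L2_ge0 u v : (\forall x \ae mu, 0 <= Re (u x * Num.conj (v x))) ->
  0 <= rdot (L2_dot mu) u v.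
Proof.
move=> uv0; rewrite /rdot /= /L2_dot /cintegral /= /Rintegral.
have [/measurable_int mf _] := cintegrable_mul (L2_funP u) (L2_funP v).
have /measurable_EFinP mf' := mf.
rewrite (@ae_eq_integral _ _ _ mu setT
  (fun x => (Num.max (Re (u x * Num.conj (v x))) 0)%:E))//.
- by apply: fine_ge0; apply: integral_ge0 => x _; rewrite lee_fin le_max lexx orbT.
- by apply/measurable_EFinP; apply: measurable_maxr => //; exact: measurable_cst.
- by apply: filterS uv0 => x h _; rewrite max_l.
Qed.

Lemma rdot_L2_le0 u v : (\forall x \ae mu, Re (u x * Num.conj (v x)) <= 0) ->
  rdot (L2_dot mu) u v <= 0.
Proof.
move=> uv0; rewrite -oppr_ge0 -rdotNl; apply: rdot_L2_ge0.
apply: filterS2 uv0 (L2NE u) => x h ->; rewrite mulNr.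
by move: h; case: (_ * _) => a b /=; rewrite oppr_ge0.
Qed.

(** The variational inequality in the complex plane holds at almost every point and is
    integrated. *)
Lemma L2_projection (C : R[i] -> Prop) (f : R[i] -> R[i]) (P : L2 mu -> L2 mu) :
  (forall u, \forall x \ae mu, P u x = f (u x)) -> (forall z, C (f z)) ->
  (forall z w, C w -> Re ((w - f z) * Num.conj (z - f z)) <= 0) ->
  projection_on (L2_dot mu) (fun u => \forall x \ae mu, C (u x)) P.
Proof.
move=> PE Cf hf; split=> [u|u q hq].
  by apply: filterS (PE u) => x ->; exact: Cf.
apply: rdot_L2_le0; apply: filterS2 (filterI hq (PE u)) (filterI (L2BE q (P u)) (L2BE u (P u))).
by move=> x [Cq Pux] [-> ->]; rewrite Pux; exact: hf.
Qed.

Lemma L2_ReE u : \forall x \ae mu, L2_Re u x = (Re (u x))%:C.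
Proof. exact: L2_ofE. Qed.

Lemma L2_Re_projection : projection_on (L2_dot mu) (@L2_real _ _ _ mu) (@L2_Re _ _ _ mu).
Proof.
apply: (L2_projection (C := fun z => Im z = 0) (f := fun z => (Re z)%:C) L2_ReE) => //.
move=> [a b] [a' b'] /= ->.
by rewrite !subrr !subr0 mulr0 mul0r !oppr0 addr0.
Qed.

Lemma sqint_posRe u : (fun x => (Num.max (Re (u x)) 0)%:C) \in sqint mu.
Proof.
have /sqintP[[mr mi] _] := L2_funP u; apply: sqint_le (L2_funP u) _ _.
  by split => //=; apply: measurable_maxr => //; exact: measurable_cst.
move=> x; rewrite normc_real (le_trans _ (normRe_normc _))//.
rewrite ger0_norm ?le_max ?lexx ?orbT// ge_max normr_ge0 andbT; exact: ler_norm.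
Qed.

Definition L2_posRe u : L2 mu := L2_of (sqint_posRe u).

Lemma L2_posReE u : \forall x \ae mu, L2_posRe u x = (Num.max (Re (u x)) 0)%:C.
Proof. exact: L2_ofE. Qed.

Lemma L2_posRe_projection : projection_on (L2_dot mu) (@L2_pos _ _ _ mu) L2_posRe.
Proof.
apply: (L2_projection (C := fun z => 0 <= z)
  (f := fun z => (Num.max (Re z) 0)%:C) L2_posReE) => [z|[x y] w].
  by rewrite lecR le_max lexx orbT.
case: w => x' y'; rewrite lecE /= => /andP[/eqP -> x0].
rewrite !subr0 mul0r oppr0 addr0.
have [x1|x1] := leP x 0; first by rewrite !subr0 mulr_ge0_le0.
by rewrite subrr mulr0.
Qed.

(** Outside the unit disc the truncation is the unit vector s = [csign z], and z - s is a positive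
    multiple of s; so the sign is that of Re (w conj(s)) - 1, which is nonpositive for w in the
    disc. Inside the disc the excess vanishes. *)
Lemma L2_trunc_projection : projection_on (L2_dot mu)
  (fun u => \forall x \ae mu, normc (u x) <= 1) (@L2_trunc _ _ _ mu).
Proof.
apply: (L2_projection (C := fun z => normc z <= 1) (f := ctrunc)) => [u|z|z w w1].
- exact: L2_ofE.
- rewrite /ctrunc normcM normc_real ger0_norm ?le_min ?ler01 ?normc_ge0//.
  by rewrite mulr_ile1 ?normc_ge0 ?normc_csign ?le_min ?ler01 ?normc_ge0 ?ge_min ?lexx.
have -> : z - ctrunc z = cexcess z by rewrite -{1}(ctrunc_excess z) addrC addKr.
rewrite /cexcess /ctrunc; have [z1|z1] := leP (normc z) 1.
  by rewrite max_r ?subr_le0// mul0r rmorph0 mulr0.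
rewrite max_l ?subr_ge0 ?(ltW z1)// mul1r.
have s1 : normc (csign z) = 1.
  apply: complexI; rewrite normcC /csign normrM normfV normr_id divff// normr_eq0.
  by apply: contraTneq z1 => ->; rewrite normc0 ltNge ler01.
rewrite rmorphM /= mulrCA ReM.
have -> : Re ((w - csign z) * Num.conj (csign z)) = Re (w * Num.conj (csign z)) - 1.
  rewrite mulrBl ReD (_ : 1 = Re (csign z * Num.conj (csign z))).
    by case: (csign z * _).
  by rewrite -normc_conj s1 expr1n.
have h : Re (w * Num.conj (csign z)) <= 1.
  apply: (le_trans (ler_norm _)); apply: (le_trans (normRe_normc _)).
  by rewrite normcM normc_conjE s1 mulr1.
rewrite Re_conj Im_conj /= oppr0 mul0r subr0 mulr_ge0_le0// ?subr_ge0 ?subr_le0//.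
exact: ltW.
Qed.

Lemma L2_Linf1P u : L2_Linf1 u <-> \forall x \ae mu, normc (u x) <= 1.
Proof.
(* [Lnorm] at infinity is the essential supremum when the space has positive measure and 0
   otherwise; on a null space both sides hold trivially. *)
rewrite /L2_Linf1 unlock; case: ifPn => [mu0|]; last first.
  rewrite -leNgt => mu0; split=> _; last by rewrite lee_fin.
  exists setT; split=> //; apply/eqP; rewrite eq_le mu0; exact: measure_ge0.
split=> [/ess_supP|h].
  by apply: filterS => x /=; rewrite ger0_norm ?normc_ge0// lee_fin.
apply/ess_supP; apply: filterS h => x /=; rewrite ger0_norm ?normc_ge0//.
Qed.

Lemma L2_real0 : L2_real (0 : L2 mu).
Proof. by apply: filterS (L20E mu) => x ->. Qed.

Lemma L2_pos0 : L2_pos (0 : L2 mu).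
Proof. by apply: filterS (L20E mu) => x ->. Qed.

Lemma L2_bounded0 : \forall x \ae mu, normc ((0 : L2 mu) x) <= 1.
Proof. by apply: filterS (L20E mu) => x ->; rewrite normc0 ler01. Qed.

Lemma L2_pos_real u : L2_pos u -> L2_real u.
Proof. by apply: filterS => x; rewrite lecE => /andP[/eqP ->]. Qed.

Lemma L2_Re_imD u v (z : R[i]) : Re z = 0 -> L2_real u -> L2_real v -> L2_Re (u + z *: v) = u.
Proof.
move=> z0 ur vr; apply/L2P.
apply: filterS3 (filterI ur vr) (L2_ReE (u + z *: v)) (filterI (L2DE u (z *: v)) (L2ZE z v)).
move=> x [ux vx] -> [-> ->]; rewrite ReD ReM z0 vx mul0r mulr0 subrr addr0.
by case: (u x) ux => a b /= ->.
Qed.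

(** The vector is the imaginary part of [u]. *)
Lemma L2_real_im u : L2_real (- 'i%C *: (u - L2_Re u)).
Proof.
apply: filterS3 (L2ZE (- 'i%C) (u - L2_Re u)) (L2BE u (L2_Re u)) (L2_ReE u).
move=> x -> -> ->; case: (u x) => a b /=; ring.
Qed.

Lemma L2_posReN u : L2_pos u -> L2_posRe (- u) = 0.
Proof.
move=> u0; apply/L2P.
apply: filterS3 (filterI u0 (L20E mu)) (L2NE u) (L2_posReE (- u)) => x [ux ->] uN ->.
rewrite uN; move: ux; case: (u x) => a b; rewrite lecE /= => /andP[_ a0].
by rewrite max_r// oppr_le0.
Qed.

(** The vector is the negative part of the real part of [u]. *)
Lemma L2_pos_negRe u : L2_pos (L2_posRe u - L2_Re u).
Proof.
apply: filterS3 (L2BE (L2_posRe u) (L2_Re u)) (L2_posReE u) (L2_ReE u) => x -> -> ->.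
by rewrite -rmorphB /= lecR subr_ge0 le_max lexx.
Qed.

End L2_projections.

Lemma hsum_single_ind {R : realType} {I : choiceType} {V : I -> lmodType R[i]}
    (dV : forall i, {dot V i for Num.conj}) k (u : V k) (Q : forall l, V l -> Prop) :
  Q k u -> (forall l, k != l -> Q l 0) -> forall l, Q l (hsum_single dV u l).
Proof.
move=> Qu Q0 l; have [<-|kl] := eqVneq k l; first by rewrite hsum_singleE.
by rewrite hsum_single_neq//; exact: Q0.
Qed.

Lemma Re_conj_csignM {R : realType} (z : R[i]) : Re (Num.conj (csign z) * z) = normc z.
Proof.
rewrite csignE ReM Re_conj Im_conj /= mulNr opprK.
have [z0|n0] := eqVneq (normc z) 0.
  by rewrite z0 invr0 !mulr0 !mul0r addr0.
by rewrite mulrAC [X in _ + X]mulrAC -mulrDl -!expr2 -sqr_normcE expr2 mulfK.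
Qed.

(** * Real, positive and bounded functions: conditions on the components of the form *)

Section L2_forms.
Context {R : realType} {I : choiceType} {d : I -> measure_display}.
Context {X : forall i, measurableType (d i)}.
Variable mu : forall i, {measure set (X i) -> \bar R}.
Context {V : I -> lmodType R[i]}.
Variables (dV : forall i, {dot V i for Num.conj}).
Variables (j : forall i, {linear V i -> L2 (mu i)}) (c : R).
Hypothesis j_inj : forall i, injective (j i).
Hypothesis j_bounded : forall i (u : V i), hnorm (L2_dot (mu i)) (j i u) <= c * hnorm (dV i) u.
Variable a : {bilinear hsum dV -> hsum dV -> R[i] | *%R & Num.conj \; *%R}.
Hypothesis a_continuous : form_continuous (hsum_dot dV) a.
Hypothesis a_elliptic : form_elliptic (L2_sum_dot mu) (hsum_dot dV) (hsum_map j_bounded) a.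
Local Notation PRe := (fun i => @L2_Re _ _ _ (mu i)).
Local Notation Ppos := (fun i => @L2_posRe _ _ _ (mu i)).
Local Notation Ptr := (fun i => @L2_trunc _ _ _ (mu i)).
Local Notation CPRe := (fun i => L2_Re_projection (mu i)).
Local Notation CPpos := (fun i => L2_posRe_projection (mu i)).
Local Notation CPtr := (fun i => L2_trunc_projection (mu i)).

Lemma form_compZl i k z (u : V k) (v : V i) :
  form_comp a (z *: u) v = z * form_comp a u v.
Proof. by rewrite /form_comp linearZ_LR linearZl_LR. Qed.

Lemma form_compZr i k z (u : V k) (v : V i) :
  form_comp a u (z *: v) = Num.conj z * form_comp a u v.
Proof. by rewrite /form_comp linearZ_LR linearZr_LR. Qed.

Lemma Re_form_compB i k (u : V k) (v w : V i) :
  Re (form_comp a u (v - w)) = Re (form_comp a u v) - Re (form_comp a u w).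
Proof. by rewrite /form_comp linearB Re_formB. Qed.

(** The vector [u - r] is the imaginary unit times a real function, so a real component takes a
    purely imaginary value at [p] and [u - r]. *)
Lemma form_comp_imag i k (p : V k) (u r : V i) :
  (forall i k (u : V k) (v : V i), L2_real (j k u) -> L2_real (j i v) ->
     Im (form_comp a u v) = 0) ->
  L2_real (j k p) -> j i r = L2_Re (j i u) -> Re (form_comp a p (u - r)) = 0.
Proof.
move=> hreal pr rE; have qr : L2_real (j i (- 'i%C *: (u - r))).
  rewrite linearZ_LR linearB /= rE; exact: L2_real_im.
have -> : u - r = 'i%C *: (- 'i%C *: (u - r)).
  by rewrite scalerA mulrN -expr2 sqr_i opprK scale1r.
rewrite form_compZr ReM (hreal _ _ _ _ pr qr) Re_conj /=; ring.
Qed.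

(** For real [x], [y] and purely imaginary [z], the vector [x + z *: y] projects to [x], and the
    criterion reads [0 <= Im z * Im (a x y)]; both signs of [z] force realness. Conversely, every
    term of the finite double sums vanishes. *)
Lemma form_proj_Re : form_proj j a PRe <->
  (forall i (u : V i), range (j i) (L2_Re (j i u))) /\
  (forall i k (u : V k) (v : V i), L2_real (j k u) -> L2_real (j i v) ->
     Im (form_comp a u v) = 0).
Proof.
split=> [h|[hrange hreal] u].
  split=> [i u|i k u v ur vr].
    have [p pE _] := form_proj_component j_inj CPRe (fun i => L2_real0 (mu i)) (i := i) h u.
    by exists p.
  pose x := hsum_single dV u; pose y := hsum_single dV v.
  have xr : forall l, L2_real (j l (x l)).
    apply: (@hsum_single_ind _ _ _ _ _ _ (fun l w => L2_real (j l w))) => // l _.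
    by rewrite linear0; exact: L2_real0.
  have yr : forall l, L2_real (j l (y l)).
    apply: (@hsum_single_ind _ _ _ _ _ _ (fun l w => L2_real (j l w))) => // l _.
    by rewrite linear0; exact: L2_real0.
  have key (z : R[i]) : Re z = 0 -> 0 <= Im z * Im (a x y).
    move=> z0; have [p pE] := h (x + z *: y).
    have -> : p = x.
      apply: hsum_ext => l; apply: j_inj; rewrite pE.
      rewrite -[(x + z *: y) l]/(x l + z *: y l) linearD linearZ_LR.
      by apply: L2_Re_imD => //; [exact: xr|exact: yr].
    rewrite addrC addKr linearZr_LR /= ReM Re_conj Im_conj z0 mul0r sub0r mulNr opprK.
    by [].
  have := key 'i%C erefl; have := key (- 'i%C); rewrite /= oppr0 => /(_ erefl).
  by rewrite -[a x y]/(form_comp a u v) => h1 h2; lra.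
have hcomp i : form_proj_comp j a PRe i.
  move=> w; have [p _ pE] := hrange i w; exists p => //.
  rewrite (@form_comp_imag _ _ p w p)// pE.
  exact: (L2_Re_projection (mu i)).1.
have [p pE] := form_proj_lift a_continuous a_elliptic CPRe (fun i => L2_real0 (mu i)) hcomp u.
exists p => //; apply: form_comp_ge0 => // s us.
apply: sumr_ge0 => i _; apply: sumr_ge0 => k _.
rewrite -[(u - p) i]/(u i - p i) form_comp_imag ?pE//.
exact: (L2_Re_projection (mu k)).1.
Qed.

(** Positive vectors [x] and [y] in different components have disjoint supports, so [x - y] projects
    to [x] and the criterion reads [0 <= Re (a x (- y))]. Conversely, the diagonal terms are
    nonnegative by hypothesis and the others by a sign argument. *)
Lemma form_proj_pos : form_proj j a PRe ->
  form_proj j a Ppos <-> (forall i, form_proj_comp j a Ppos i) /\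
  (forall i k, i != k -> forall (u : V k) (v : V i),
     L2_pos (j k u) -> L2_pos (j i v) -> form_comp a u v <= 0).
Proof.
move=> /form_proj_Re[hrange hreal]; split=> [h|[hcomp hneg] u].
  split=> [i|i k ik u v u0 v0].
    exact: (form_proj_component j_inj CPpos (fun i => L2_pos0 (mu i)) (i := i) h).
  pose x := hsum_single dV u; pose y := hsum_single dV v.
  have [p pE] := h (x - y).
  have -> : p = x.
    apply: hsum_ext => l; apply: j_inj; rewrite pE.
    rewrite -[(x - y) l]/(x l - y l) linearB /x /y.
    have [->|li] := eqVneq l i.
      rewrite hsum_singleE hsum_single_neq 1?eq_sym// !linear0 sub0r.
      exact: L2_posReN.
    rewrite (@hsum_single_neq _ _ _ _ i) 1?eq_sym// linear0 subr0.
    apply: (projection_id (L2_posRe_projection (mu l))); move: l {li}.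
    apply: (@hsum_single_ind _ _ _ _ _ _ (fun l w => L2_pos (j l w))) => // l _.
    by rewrite linear0; exact: L2_pos0.
  rewrite addrC addKr -/(form_comp a u _) (real_linearN (Re_formPr a x)) oppr_ge0 => h1.
  rewrite lecE /= eq_sym (hreal _ _ _ _ (L2_pos_real u0) (L2_pos_real v0)) eqxx.
  exact: h1.
have [p pE] := form_proj_lift a_continuous a_elliptic CPpos (fun i => L2_pos0 (mu i)) hcomp u.
have p0 k : L2_pos (j k (p k)) by rewrite pE; exact: (L2_posRe_projection (mu k)).1.
exists p => //; apply: form_comp_ge0 => // s us.
apply: sumr_ge0 => i _; apply: sumr_ge0 => k _.
rewrite -[(u - p) i]/(u i - p i).
have [ki|ki] := eqVneq k i.
  case: i / ki; have [q qE] := hcomp k (u k).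
  by rewrite (_ : q = p k)//; apply: j_inj; rewrite qE pE.
(* With [r] the real part of [u i], the difference [u i - p i] splits into an imaginary part, whose
   contribution vanishes, and minus the negative part [p i - r]. *)
have [r _ rE] := hrange i (u i).
have -> : u i - p i = (u i - r) - (p i - r) by rewrite opprB addrA subrK.
rewrite Re_form_compB form_comp_imag//; last exact: L2_pos_real.
rewrite sub0r oppr_ge0.
have := hneg i k; rewrite eq_sym => /(_ ki (p k) (p i - r) (p0 k)).
rewrite linearB /= pE rE => /(_ (L2_pos_negRe _)).
by rewrite lecE => /andP[].
Qed.

(** If all components but the one at [i] are bounded by 1, the projection changes only that
    component and the criterion involves only the row [i] of the form. Conversely, the inequality
    for [i] makes the row sums of the finite double sum nonnegative. *)
Lemma form_proj_trunc : form_proj j a Ptr <->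
  (forall i (u : V i), range (j i) (L2_trunc (j i u))) /\
  (forall i (u : hsum dV) (p q : V i),
     (forall k, k != i -> L2_Linf1 (j k (u k))) ->
     j i p = L2_trunc (j i (u i)) -> j i q = L2_excess (j i (u i)) ->
     (\esum_(k in [set~ i]) (normc (form_comp a (u k) q))%:E
        <= (Re (form_comp a p q))%:E)%E).
Proof.
have C0 i := L2_bounded0 (mu i).
split=> [h|[hrange hineq] u].
  split=> [i u|i u p q u1 pE qE].
    have [p pE _] := form_proj_component j_inj CPtr C0 (i := i) h u.
    by exists p.
  have pq : u i - p = q.
    by apply: j_inj; rewrite linearB /= pE qE -{1}(L2_trunc_excess (j i (u i))) addrC addKr.
  apply: esum_le_seq => s us si.
  (* Rotating the components makes each term a_ik (u_k, q) equal to - |a_ik (u_k, q)|. *)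
  pose th k := - Num.conj (csign (form_comp a (u k) q)).
  have th1 k : normc (th k) <= 1 by rewrite normcN normc_conjE normc_csign.
  have sy : sq_summable dV (fun k => th k *: u k).
    apply: (@sq_summable_le _ _ _ _ u _ 1) => k; rewrite mul1r.
    rewrite -(@ler_pXn2r _ 2)// ?nnegrE ?hnorm_ge0// sqr_hnormZ ler_piMl ?sqr_ge0//.
    by rewrite expr_le1 ?normc_ge0.
  pose y := HSum sy; pose t := hsum_trunc s y.
  have is_ : i \notin s by apply/negP => /si /=.
  have ti : t i = 0 by rewrite hsum_truncE// (negPf is_).
  have [w wE] := h (hsum_single dV (u i) + t).
  have wE' : w = hsum_single dV p + t.
    apply: hsum_ext => l; apply: j_inj; rewrite wE.
    rewrite -[(hsum_single dV (u i) + t) l]/(hsum_single dV (u i) l + t l).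
    rewrite -[(hsum_single dV p + t) l]/(hsum_single dV p l + t l).
    have [->|li] := eqVneq l i; first by rewrite !hsum_singleE ti !addr0 pE.
    rewrite !hsum_single_neq 1?eq_sym// !add0r.
    apply: (projection_id (L2_trunc_projection (mu l))).
    rewrite hsum_truncE//; case: ifP => _; last by rewrite linear0.
    rewrite linearZ_LR; have /L2_Linf1P := u1 l li.
    apply: filterS2 (L2ZE (th l) (j l (u l))) => x -> h1.
    by rewrite normcM mulr_ile1 ?normc_ge0.
  have wq : hsum_single dV (u i) + t - w = hsum_single dV q.
    by rewrite wE' opprD addrACA subrr addr0 -linearB pq.
  rewrite wq wE' (real_linearD (Re_formPl a _)) (real_linear_sum _ _ (Re_formPl a _)).
  rewrite -[a _ _]/(form_comp a p q) => h1.
  rewrite -subr_ge0; apply: le_trans h1 _; rewrite lerD2l -sumrN; apply: ler_sum => k _.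
  rewrite -[a _ _]/(form_comp a (th k *: u k) q) form_compZl /th mulNr.
  by rewrite raddfN /= Re_conj_csignM.
(* For a vector supported in the component [i], the inequality bounds the diagonal term below by a
   sum of absolute values, hence by 0. *)
have hcomp i : form_proj_comp j a Ptr i.
  move=> w; have [p _ pE] := hrange i w; exists p => //.
  pose x := hsum_single dV w.
  have xi : x i = w by rewrite hsum_singleE.
  have h1 : forall k, k != i -> L2_Linf1 (j k (x k)).
    move=> k ki; rewrite hsum_single_neq 1?eq_sym// linear0; exact/L2_Linf1P.
  have := hineq i x p (w - p) h1; rewrite xi => /(_ pE).
  have qE : j i (w - p) = L2_excess (j i w).
    by rewrite linearB /= pE -{1}(L2_trunc_excess (j i w)) addrC addKr.
  move=> /(_ qE) h2; rewrite -lee_fin; apply: le_trans h2.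
  by apply: esum_ge0 => k _; rewrite lee_fin normc_ge0.
have [p pE] := form_proj_lift a_continuous a_elliptic CPtr C0 hcomp u.
exists p => //; apply: form_comp_ge0 => // s us.
rewrite big_seq; apply: sumr_ge0 => i si.
rewrite -[(u - p) i]/(u i - p i) (bigD1_seq i)//=.
have qE : j i (u i - p i) = L2_excess (j i (u i)).
  by rewrite linearB /= pE -{1}(L2_trunc_excess (j i (u i))) addrC addKr.
(* The truncated vector with its component [i] restored to [u i]: it meets the boundedness condition
   away from [i], and its truncation and excess at [i] are those of [u]. *)
pose x := p + hsum_single dV (u i - p i).
have xi : x i = u i.
  by rewrite -[x i]/(p i + hsum_single dV (u i - p i) i) hsum_singleE addrC subrK.
have xk k : k != i -> x k = p k.
  move=> ki; rewrite -[x k]/(p k + hsum_single dV (u i - p i) k).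
  by rewrite hsum_single_neq 1?eq_sym// addr0.
have h1 k : k != i -> L2_Linf1 (j k (x k)).
  move=> ki; rewrite xk// pE; apply/L2_Linf1P; exact: (L2_trunc_projection (mu k)).1.
have := hineq i x (p i) (u i - p i) h1; rewrite xi => /(_ (pE i) qE) h2.
have h3 : \sum_(k <- s | k != i) normc (form_comp a (p k) (u i - p i)) <=
    Re (form_comp a (p i) (u i - p i)).
  rewrite -lee_fin; apply: le_trans h2; apply: esum_ge.
  exists [set` [seq k <- s | k != i]].
    split; first exact: finite_seq.
    by move=> k /=; rewrite mem_filter => /andP[/eqP].
  rewrite -fsbig_seq ?filter_uniq// sumEFin lee_fin big_filter.
  rewrite le_eqVlt (eq_bigr (fun k => normc (form_comp a (x k) (u i - p i)))) ?eqxx//.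
  by move=> k /xk ->.
have h4 : - (\sum_(k <- s | k != i) normc (form_comp a (p k) (u i - p i))) <=
    \sum_(k <- s | k != i) Re (form_comp a (p k) (u i - p i)).
  rewrite -sumrN; apply: ler_sum => k _; rewrite lerNl.
  by apply: le_trans (ler_norm _) _; rewrite normrN normRe_normc.
lra.
Qed.

End L2_forms.

(** Membership in V_i is expressed by [range (j i)], and truncation and excess enter the last
    inequality through their preimages [p] and [q], unique by injectivity. The series there is taken
    in the extended reals, so the inequality includes its convergence. *)
Theorem theorem27 (R : realType) (I : countType)
    (d : I -> measure_display) (X : forall i, measurableType (d i))
    (mu : forall i, {measure set (X i) -> \bar R})
    (mu_sigma_finite : forall i, sigma_finite [set: X i] (mu i))
    (V : I -> lmodType R[i]) (dV : forall i, {dot V i for Num.conj})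
    (V_complete : forall i, complete_dot (dV i))
    (j : forall i, {linear V i -> L2 (mu i)}) (j_inj : forall i, injective (j i))
    (j_dense : forall i, dense_range (L2_dot (mu i)) (j i))
    (c : R)
    (j_bounded : forall i (u : V i),
       hnorm (L2_dot (mu i)) (j i u) <= c * hnorm (dV i) u)
    (a : {bilinear hsum dV -> hsum dV -> R[i] | *%R & Num.conj \; *%R})
    (a_continuous : form_continuous (hsum_dot dV) a)
    (a_elliptic : form_elliptic (L2_sum_dot mu) (hsum_dot dV) (hsum_map j_bounded) a)
    (a_accretive : form_accretive a)
    (T : R -> L2_sum mu -> L2_sum mu)
    (T_semigroup : form_semigroup (L2_sum_dot mu) (hsum_map j_bounded) a T) :
  [/\ preserves (fun u : L2_sum mu => forall i, L2_real (u i)) T <->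
      (forall i (u : V i), range (j i) (L2_Re (j i u))) /\
      (forall i k (u : V k) (v : V i), L2_real (j k u) -> L2_real (j i v) ->
         Im (form_comp a u v) = 0),

      forall S : forall i, R -> L2 (mu i) -> L2 (mu i),
      (forall i, form_semigroup (L2_dot (mu i)) (j i)
         (@form_comp _ _ _ _ a i i) (S i)) ->
      preserves (fun u : L2_sum mu => forall i, L2_real (u i)) T ->
      (preserves (fun u : L2_sum mu => forall i, L2_pos (u i)) T <->
       (forall i, preserves (@L2_pos _ _ _ (mu i)) (S i)) /\
       (forall i k, i != k -> forall (u : V k) (v : V i),
          L2_pos (j k u) -> L2_pos (j i v) -> form_comp a u v <= 0))
    & contractive (L2_sum_dot mu) T ->
      (preserves (fun u : L2_sum mu => forall i, L2_Linf1 (u i)) T <->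
       (forall i (u : V i), range (j i) (L2_trunc (j i u))) /\
       (forall i (u : hsum dV) (p q : V i),
          (forall k, k != i -> L2_Linf1 (j k (u k))) ->
          j i p = L2_trunc (j i (u i)) -> j i q = L2_excess (j i (u i)) ->
          (\esum_(k in [set~ i]) (normc (form_comp a (u k) q))%:E
             <= (Re (form_comp a p q))%:E)%E))].

Proof.
have pres C P CP C0 := @preserves_hsum _ _ _ _ dV _ j c j_bounded V_complete j_inj j_dense
  a a_continuous a_elliptic a_accretive C P CP C0 T T_semigroup.
have presRe := pres _ _ (fun i => L2_Re_projection (mu i)) (fun i => L2_real0 (mu i)).
have formRe := form_proj_Re j_inj a_continuous a_elliptic.
split.
- by rewrite presRe.
- move=> S S_semigroup; rewrite presRe => real.
  rewrite (pres _ _ (fun i => L2_posRe_projection (mu i)) (fun i => L2_pos0 (mu i))).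
  rewrite (form_proj_pos j_inj a_continuous a_elliptic real).
  have S_pos i : preserves (@L2_pos _ _ _ (mu i)) (S i) <->
      form_proj_comp j a (fun i => @L2_posRe _ _ _ (mu i)) i.
    exact: (preserves_component V_complete j_inj j_dense a_continuous a_elliptic a_accretive
      (fun i => L2_posRe_projection (mu i)) (S_semigroup i)).
  by split=> -[h1 h2]; split=> // i; apply/S_pos.
move=> _; rewrite -(form_proj_trunc j_inj a_continuous a_elliptic).
rewrite -(pres _ _ (fun i => L2_trunc_projection (mu i)) (fun i => L2_bounded0 (mu i))).
by split=> h t u t0 hu i; [apply/L2_Linf1P|apply/L2_Linf1P]; apply: h => // k; apply/L2_Linf1P.
Qed.
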